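(* Let $H$ be a finite-dimensional factorizable ribbon Hopf algebra over $\mathbb{C}$ and $g,n\ge0$. The map $$\alpha_{g,n}:\mathcal{L}_{g,n}(H)\to\mathcal{L}_{1,0}(H)^{\otimes g}\otimes\mathcal{L}_{0,1}(H)^{\otimes n}$$ defined by $\overset{I}{A}(i)\mapsto\overset{I}{\Lambda}_i\,\overset{I}{\underline{A}}(i)\,\overset{I}{\Lambda}{}_i^{-1}$ and $\overset{I}{B}(i)\mapsto\overset{I}{\Lambda}_i\,\overset{I}{\underline{B}}(i)\,\overset{I}{\Lambda}{}_i^{-1}$ for $1\le i\le g$, and $\overset{I}{M}(i)\mapsto\overset{I}{\Gamma}_i\,\overset{I}{\underline{M}}(i)\,\overset{I}{\Gamma}{}_i^{-1}$ for $g+1\le i\le g+n$ (for all finite-dimensional $H$-modules $I$), is an isomorphism of algebras.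
   Context: **Hopf algebra.** $H$ has coproduct $\Delta(x)=x'\otimes x''$, counit $\varepsilon$, antipode $S$, universal $R$-matrix $R=a_i\otimes b_i$ (implicit summation), $R'=b_i\otimes a_i$, and a ribbon element. Factorizable means that $H^*\to H$, $\varphi\mapsto(\varphi\otimes\mathrm{id})(RR')$ is bijective. All modules are finite-dimensional. ''?'' denotes the variable of a linear form. **Matrices.** For an $H$-module $I$ (with a chosen basis), $\overset{I}{x}$ is the matrix of $x\in H$ acting on $I$, and $\overset{I}{T}$ is the matrix with entries in $H^*$ such that $\overset{I}{T}(x)=\overset{I}{x}$. For matrices $M,N$ over an algebra, $M_1$ and $N_2$ denote $M$ and $N$ acting on the first and second factor of $\mathrm{Mat}_m(\mathbb{C})\otimes\mathrm{Mat}_{n}(\mathbb{C})$, so $(M_1N_2)^{ik}_{jl}=M^i_jN^k_l$. $\overset{IJ}{X}_{12}$ is the action of $X\in H\otimes H$ on $I\otimes J$. $\mathbb{I}_k$ is the identity matrix. **The algebras.** $\mathcal{L}_{g,n}(H)$ is the associative unital algebra generated by $2g+n$ copies of the vector space $H^*$; the images of $\overset{I}{T}$ in these copies are the matrices $\overset{I}{A}(i),\overset{I}{B}(i)$ ($1\le i\le g$) and $\overset{I}{M}(i)$ ($g+1\le i\le g+n$), equal to $1$ for $I$ the trivial module. With $U(i),V(i)$ standing for $A(i)$ or $B(i)$ if $i\le g$ and for $M(i)$ if $i>g$, the relations are, for all $I,J$: $\overset{I\otimes J}{U}(i)_{12}=\overset{I}{U}(i)_1\overset{IJ}{R'}_{12}\overset{J}{U}(i)_2(\overset{IJ}{R'})_{12}^{-1}$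 for all $i$; $\overset{IJ}{R}_{12}\overset{I}{U}(i)_1\overset{IJ}{R}{}_{12}^{-1}\overset{J}{V}(j)_2=\overset{J}{V}(j)_2\overset{IJ}{R}_{12}\overset{I}{U}(i)_1\overset{IJ}{R}{}_{12}^{-1}$ for $i<j$; $\overset{IJ}{R}_{12}\overset{I}{B}(i)_1\overset{IJ}{R'}_{12}\overset{J}{A}(i)_2=\overset{J}{A}(i)_2\overset{IJ}{R}_{12}\overset{I}{B}(i)_1\overset{IJ}{R}{}_{12}^{-1}$ for $i\le g$. (Equivalently $\mathcal{L}_{g,n}(H)$ is the braided tensor product $\mathcal{L}_{1,0}(H)^{\widetilde\otimes g}\,\widetilde\otimes\,\mathcal{L}_{0,1}(H)^{\widetilde\otimes n}$, so it has dimension $(\dim H)^{2g+n}$.) In $\mathcal{L}_{1,0}(H)$ write $\overset{I}{A},\overset{I}{B}$ and in $\mathcal{L}_{0,1}(H)$ write $\overset{I}{M}$ for the generating matrices. $\overset{I}{\underline{A}}(i),\overset{I}{\underline{B}}(i)$ ($i\le g$), $\overset{I}{\underline{M}}(i)$ ($i>g$), and more generally $\underline{X}(i)$ for a matrix $X$ over $\mathcal{L}_{1,0}(H)$ or $\mathcal{L}_{0,1}(H)$, denote the images in the $i$-th factor of the ordinary tensor product algebra $\mathcal{L}_{1,0}(H)^{\otimes g}\otimes\mathcal{L}_{0,1}(H)^{\otimes n}$. **Auxiliary isomorphisms.** Let $\mathcal{O}(H)$ be $H^*$ with the dual Hopf algebra structure. The Heisenberg double $\mathcal{H}(\mathcal{O}(H))=\mathcal{O}(H)\otimes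 H$ is the algebra containing $\mathcal{O}(H)$ and $H$ as subalgebras with $h\psi=\psi(?h')h''$; it acts faithfully on $H^*$ by $\psi\triangleright\varphi=\psi\varphi$, $h\triangleright\varphi=\varphi(?h)$, which identifies it with $\mathrm{End}_{\mathbb{C}}(H^* )$. For $h\in H$, $\widetilde h\in\mathcal{H}(\mathcal{O}(H))$ is defined by $\widetilde h\triangleright\varphi=\varphi(S^{-1}(h)?)$. Put $\overset{I}{L}{}^{(+)}=\overset{I}{a_i}b_i$, $\overset{I}{L}{}^{(-)}=\overset{I}{S^{-1}(b_i)}a_i$, $\overset{I}{\widetilde L}{}^{(-)}=\overset{I}{S^{-1}(b_i)}\widetilde{a_i}$. The following are known algebra isomorphisms: $\Psi_{0,1}:\mathcal{L}_{0,1}(H)\to H$, $\overset{I}{M}\mapsto\overset{I}{L}{}^{(+)}\overset{I}{L}{}^{(-)-1}$, and $\Psi_{1,0}:\mathcal{L}_{1,0}(H)\to\mathcal{H}(\mathcal{O}(H))$, $\overset{I}{A}\mapsto\overset{I}{L}{}^{(+)}\overset{I}{L}{}^{(-)-1}$, $\overset{I}{B}\mapsto\overset{I}{L}{}^{(+)}\overset{I}{T}\overset{I}{L}{}^{(-)-1}$. **The matrices $\Lambda_i,\Gamma_i$.** Let $\overset{I}{M}{}^{(-)}=\Psi_{0,1}^{-1}(\overset{I}{L}{}^{(-)})$ and $\overset{I}{C}{}^{(-)}=\Psi_{1,0}^{-1}(\overset{I}{L}{}^{(-)}\overset{I}{\widetilde L}{}^{(-)})$. Then $\overset{I}{\Lambda}_1=\mathbb{I}_{\dim(I)}$,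 $\overset{I}{\Lambda}_i=\overset{I}{\underline{C}}{}^{(-)}(1)\cdots\overset{I}{\underline{C}}{}^{(-)}(i-1)$ for $2\le i\le g+1$; $\overset{I}{\Gamma}_{g+1}=\overset{I}{\Lambda}_{g+1}$, $\overset{I}{\Gamma}_i=\overset{I}{\Lambda}_{g+1}\overset{I}{\underline{M}}{}^{(-)}(g+1)\cdots\overset{I}{\underline{M}}{}^{(-)}(i-1)$ for $g+2\le i\le g+n$. *)

(* Defs.v *)
From HB Require Import structures.
From mathcomp Require Import all_boot all_order all_algebra all_field.
From mathcomp Require Import boolp classical_sets reals.
From mathcomp Require Import complex mxtens monalg.

Set Implicit Arguments.
Unset Strict Implicit.
Unset Printing Implicit Defensive.

Import GRing.Theory.

Local Open Scope ring_scope.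
Local Open Scope quotient_scope.

(* Stated on functions: lalgType/algType of MathComp require 1 != 0, which is *)
(* not available a priori for an algebra given by a presentation, so such     *)
(* algebras are only a pzRingType and an lmodType with compatible operations. *)
Notation alg_morphism f := (linear f /\ monoid_morphism f).

(* Inverse of a square matrix over a noncommutative ring (invmx needs a       *)
(* commutative one); M itself when there is no inverse.                       *)
Definition ncinvmx (A : pzRingType) d (M : 'M[A]_d) : 'M[A]_d :=
  xget M [set N | M *m N = 1%:M /\ N *m M = 1%:M]%classic.

Section Presented.
Variables (F : fieldType) (X : choiceType).

Definition freealg := {malg F[{fmonom X}]}.
HB.instance Definition _ := GRing.Lalgebra.on freealg.

Definition freegen (x : X) : freealg := << fmu x >>.

Inductive ideal_gen (E : freealg -> Prop) : freealg -> Prop :=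
| ideal_gen_base u : E u -> ideal_gen E u
| ideal_gen0 : ideal_gen E 0
| ideal_genB u v : ideal_gen E u -> ideal_gen E v -> ideal_gen E (u - v)
| ideal_genM a u b : ideal_gen E u -> ideal_gen E (a * u * b).

Variable E : freealg -> Prop.

Definition ideal_pred : {pred freealg} := fun u => `[< ideal_gen E u >].

Fact ideal_pred_zmod : zmod_closed ideal_pred.
Proof.
split; first by apply/asboolP; apply: ideal_gen0.
by move=> u v /asboolP hu /asboolP hv; apply/asboolP; apply: ideal_genB.
Qed.

HB.instance Definition _ :=
  GRing.isZmodClosed.Build freealg ideal_pred ideal_pred_zmod.

Definition presented := Quotient.quot ideal_pred.
HB.instance Definition _ := GRing.Zmodule.on presented.
HB.instance Definition _ := Choice.on presented.

Definition pclass (u : freealg) : presented := \pi_(Quotient.quot ideal_pred) u.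
Definition pgen (x : X) : presented := pclass (freegen x).

Definition pone : presented := pclass 1.
Definition pmul (x y : presented) : presented :=
  pclass (repr (x : Quotient.quot ideal_pred)
        * repr (y : Quotient.quot ideal_pred)).
Definition pscale (c : F) (x : presented) : presented :=
  pclass (c *: repr (x : Quotient.quot ideal_pred)).

Lemma pclassP u v : pclass u = pclass v <-> ideal_gen E (u - v).
Proof.
rewrite /pclass; split => [/eqP|h].
  by rewrite -Quotient.idealrBE => /asboolP.
by apply/eqP; rewrite -Quotient.idealrBE; apply/asboolP.
Qed.

Lemma pclassK (x : presented) :
  pclass (repr (x : Quotient.quot ideal_pred)) = x.
Proof. exact: reprK. Qed.

Lemma pclass_ind (P : presented -> Prop) :
  (forall u, P (pclass u)) -> forall x, P x.
Proof. by move=> h x; rewrite -[x]pclassK. Qed.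

Lemma ideal_genD u v : ideal_gen E u -> ideal_gen E v -> ideal_gen E (u + v).
Proof.
move=> hu hv; rewrite -[v]opprK -[- v]add0r.
by apply: ideal_genB => //; apply: ideal_genB => //; apply: ideal_gen0.
Qed.

Lemma ideal_genMl a u : ideal_gen E u -> ideal_gen E (a * u).
Proof. by move=> hu; rewrite -[a * u]mulr1; apply: ideal_genM. Qed.

Lemma ideal_genMr a u : ideal_gen E u -> ideal_gen E (u * a).
Proof. by move=> hu; rewrite -[u]mul1r; apply: ideal_genM. Qed.

Lemma ideal_repr u : ideal_gen E (repr (pclass u : Quotient.quot ideal_pred) - u).
Proof. by apply/pclassP; rewrite pclassK. Qed.

Lemma pclassD u v : pclass (u + v) = pclass u + pclass v.
Proof. by rewrite /pclass !piE. Qed.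

Lemma pclassM u v : pclass (u * v) = pmul (pclass u) (pclass v).
Proof.
apply/esym/pclassP; set u' := repr _; set v' := repr _.
have -> : u' * v' - u * v = (u' - u) * v' + u * (v' - v).
  by rewrite mulrBl mulrBr addrA subrK.
by apply: ideal_genD;
  [apply: ideal_genMr | apply: ideal_genMl]; apply: ideal_repr.
Qed.

Lemma pclassZ c u : pclass (c *: u) = pscale c (pclass u).
Proof.
apply/esym/pclassP; rewrite -scalerBr -[_ - _]mul1r scalerAl.
by apply: ideal_genMl; apply: ideal_repr.
Qed.

Fact pmulA : associative pmul.
Proof.
by do 3!elim/pclass_ind => ?; rewrite -!pclassM mulrA.
Qed.
Fact pmul1 : left_id pone pmul.
Proof. by elim/pclass_ind => u; rewrite -!pclassM mul1r. Qed.
Fact pmulr1 : right_id pone pmul.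
Proof. by elim/pclass_ind => u; rewrite -!pclassM mulr1. Qed.
Fact pmulDl : left_distributive pmul +%R.
Proof.
by do 3!elim/pclass_ind => ?; rewrite -!pclassM -!pclassD -pclassM mulrDl.
Qed.
Fact pmulDr : right_distributive pmul +%R.
Proof.
by do 3!elim/pclass_ind => ?; rewrite -!pclassM -!pclassD -pclassM mulrDr.
Qed.

HB.instance Definition _ := GRing.Zmodule_isPzRing.Build presented
  pmulA pmul1 pmulr1 pmulDl pmulDr.

Fact pscaleA c d x : pscale c (pscale d x) = pscale (c * d) x.
Proof. by elim/pclass_ind: x => u; rewrite -!pclassZ scalerA. Qed.
Fact pscale1 : left_id 1 pscale.
Proof. by elim/pclass_ind => u; rewrite -!pclassZ scale1r. Qed.
Fact pscaleDr : right_distributive pscale +%R.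
Proof.
by move=> c; do 2!elim/pclass_ind => ?; rewrite -!(pclassZ, pclassD) scalerDr.
Qed.
Fact pscaleDl x : {morph pscale^~ x : c d / c + d}.
Proof.
by move=> c d; elim/pclass_ind: x => u; rewrite -!(pclassZ, pclassD) scalerDl.
Qed.

HB.instance Definition _ := GRing.Zmodule_isLmodule.Build F presented
  pscaleA pscale1 pscaleDr pscaleDl.

Lemma freealg_scaleE (c : F) (u : freealg) : u * c%:MP = c *: u.
Proof.
rewrite malgM_def malgZ_def fgmulgU; apply/eq_bigr=> /= k _.
by rewrite mulm1 mulrC.
Qed.

Fact freealg_scalerAr c (u v : freealg) : c *: (u * v) = u * (c *: v).
Proof. by rewrite -!freealg_scaleE mulrA. Qed.

Lemma pscaleAl c (x y : presented) : c *: (x * y) = (c *: x) * y.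
Proof.
elim/pclass_ind: x => u; elim/pclass_ind: y => v.
by rewrite /GRing.mul/= /GRing.scale/= -!(pclassZ, pclassM) scalerAl.
Qed.
Lemma pscaleAr c (x y : presented) : c *: (x * y) = x * (c *: y).
Proof.
elim/pclass_ind: x => u; elim/pclass_ind: y => v.
by rewrite /GRing.mul/= /GRing.scale/= -!(pclassZ, pclassM) freealg_scalerAr.
Qed.

End Presented.

(* Tensor product of a finite family of algebras A_k. The symbols [a], for a  *)
(* in the product of the A_k, multiply componentwise: modulo the first        *)
(* two relations they span the vector space freely generated by the product   *)
(* of the A_k; the other relations are multilinearity.                        *)

Section BigTensor.
Variables (F : fieldType) (I : finType).
Variables (X : I -> choiceType) (E : forall k, freealg F (X k) -> Prop).
Local Notation A k := (presented (@E k)).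

Definition ptuple : choiceType := {dffun forall k, A k}.

Definition upd (a : ptuple) k (x : A k) : ptuple :=
  [ffun j => dfwith (fun j => a j) x j].

Inductive tens_rel : freealg F ptuple -> Prop :=
| tens_rel1 : tens_rel (freegen F ([ffun k => 1] : ptuple) - 1)
| tens_relM (a b : ptuple) :
    tens_rel (freegen F a * freegen F b
              - freegen F ([ffun k => a k * b k] : ptuple))
| tens_relL (a : ptuple) k c (x y : A k) :
    tens_rel (freegen F (upd a (c *: x + y))
              - (c *: freegen F (upd a x) + freegen F (upd a y))).

Definition bigtens := presented tens_rel.

Definition tens_in k (x : A k) : bigtens :=
  pgen tens_rel (upd [ffun k => 1] x).

End BigTensor.

(* Tensor product of two finite-dimensional spaces, through the coordinates   *)
(* in the tensor product of bases. \tsum_(a, b <- X) f a b is the implicit    *)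
(* (Sweedler) summation: the image of X under the linear map induced by f; it *)
(* is meaningful for bilinear f only.                                         *)

Section Tensor.
Variables (F : fieldType) (V W : vectType F).

Definition tens := 'M[F]_(\dim {:V}, \dim {:W}).
HB.instance Definition _ := Vector.on tens.

Definition pure (x : V) (y : W) : tens :=
  \matrix_(i, j) (coord (vbasis {:V}) i x * coord (vbasis {:W}) j y).

Definition tsum (U : lmodType F) (X : tens) (f : V -> W -> U) : U :=
  \sum_i \sum_j X i j *: f (vbasis {:V})`_i (vbasis {:W})`_j.

End Tensor.

Notation "x \ox y" := (pure x y) (at level 40, left associativity).
Notation "\tsum_ ( a , b <- X ) E" := (tsum X (fun a b => E))
  (at level 41, E at level 41, a name, b name,
   format "\tsum_ ( a ,  b  <-  X )  E").

Section TensorTheory.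
Variables (F : fieldType) (V W : vectType F).
Implicit Types (U : lmodType F) (X : tens V W).

Definition bilinear_map U (f : V -> W -> U) :=
  (forall y, linear (f^~ y)) /\ (forall x, linear (f x)).

Lemma pure_bilin : bilinear_map (@pure F V W).
Proof.
split=> z c x y; apply/matrixP=> i j; rewrite !mxE linearP /=.
  by rewrite mulrDl -mulrA.
by rewrite mulrDr mulrCA.
Qed.

Lemma tsum_linear U (f : V -> W -> U) : linear (fun X => tsum X f).
Proof.
move=> c X Y; rewrite /tsum scaler_sumr -big_split; apply: eq_bigr => i _ /=.
rewrite scaler_sumr -big_split; apply: eq_bigr => j _ /=.
by rewrite !mxE scalerDl scalerA.
Qed.

Lemma tsum_pure U (f : V -> W -> U) x y :
  bilinear_map f -> \tsum_(a, b <- x \ox y) f a b = f x y.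
Proof.
case=> fl fr; pose hl y := HB.pack_for {linear V -> U} (f^~ y)
  (GRing.isLinear.Build _ _ _ _ _ (fl y)).
pose hr x := HB.pack_for {linear W -> U} (f x)
  (GRing.isLinear.Build _ _ _ _ _ (fr x)).
rewrite [in RHS](coord_vbasis (memvf x)) -[RHS]/(hl y _) linear_sum.
apply: eq_bigr => i _; rewrite linearZ /=.
rewrite [in RHS](coord_vbasis (memvf y)) -[f _ _]/(hr _ _) linear_sum scaler_sumr.
by apply: eq_bigr => j _; rewrite linearZ /= mxE scalerA.
Qed.

Lemma linear_tsum U U' (h : U -> U') (f : V -> W -> U) X :
  linear h -> h (\tsum_(a, b <- X) f a b) = \tsum_(a, b <- X) h (f a b).
Proof.
move=> hl; pose hL := HB.pack_for {linear U -> U'} h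
  (GRing.isLinear.Build _ _ _ _ _ hl).
rewrite -[h]/(hL : U -> U') linear_sum; apply: eq_bigr => i _.
by rewrite linear_sum; apply: eq_bigr => j _; rewrite linearZ.
Qed.

Lemma tens_pureE X : X = \tsum_(a, b <- X) a \ox b.
Proof.
apply/matrixP => i j; rewrite summxE (bigD1 i) //= summxE (bigD1 j) //= !mxE.
rewrite !coord_free ?(basis_free (vbasisP _)) // !eqxx !mulr1.
rewrite !big1 ?addr0 // => k /negPf nk.
  rewrite summxE big1 // => l _; rewrite !mxE.
  by rewrite coord_free ?(basis_free (vbasisP _)) // nk mul0r mulr0.
rewrite !mxE [X in _ * (_ * X)]coord_free ?(basis_free (vbasisP _)) //.
by rewrite nk !mulr0.
Qed.

Lemma eq_tens_lin U (f g : tens V W -> U) :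
  linear f -> linear g -> (forall x y, f (x \ox y) = g (x \ox y)) -> f =1 g.
Proof.
move=> fl gl fg X; rewrite [X]tens_pureE !linear_tsum //.
by apply: eq_bigr => i _; apply: eq_bigr => j _; rewrite fg.
Qed.

End TensorTheory.

Section TensorLin.
Variables (F : fieldType) (V W : vectType F) (U : lmodType F).

Lemma tsumDl c (X Y : tens V W) (f : V -> W -> U) :
  tsum (c *: X + Y) f = c *: tsum X f + tsum Y f.
Proof. exact: tsum_linear. Qed.

Lemma tsumDr c (X : tens V W) (f g h : V -> W -> U) :
  (forall a b, f a b = c *: g a b + h a b) ->
  tsum X f = c *: tsum X g + tsum X h.
Proof.
move=> fE; rewrite /tsum scaler_sumr -big_split; apply: eq_bigr => i _ /=.
rewrite scaler_sumr -big_split; apply: eq_bigr => j _ /=.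
by rewrite fE scalerDr !scalerA [c * _]mulrC.
Qed.

Lemma eq_tsum (X : tens V W) (f g : V -> W -> U) :
  (forall a b, f a b = g a b) -> tsum X f = tsum X g.
Proof. by move=> fg; apply: eq_bigr => i _; apply: eq_bigr => j _; rewrite fg. Qed.

Lemma pureDl c (x x' : V) (y : W) :
  (c *: x + x') \ox y = c *: (x \ox y) + x' \ox y.
Proof. exact: (pure_bilin V W).1. Qed.

Lemma pureDr c (x : V) (y y' : W) :
  x \ox (c *: y + y') = c *: (x \ox y) + x \ox y'.
Proof. exact: (pure_bilin V W).2. Qed.

Lemma linfunE (g : V -> W) : linear g -> linfun g =1 g.
Proof.
move=> gl x; pose gL := HB.pack_for {linear V -> W} g
  (GRing.isLinear.Build _ _ _ _ _ gl).
exact: (lfunE gL).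
Qed.

Lemma tsum_exchange (V' W' : vectType F) (X : tens V W) (Y : tens V' W')
    (f : V -> W -> V' -> W' -> U) :
  \tsum_(a, b <- X) \tsum_(c, d <- Y) f a b c d
  = \tsum_(c, d <- Y) \tsum_(a, b <- X) f a b c d.
Proof.
rewrite /tsum.
under eq_bigr => i _ do under eq_bigr => j _ do rewrite scaler_sumr.
under [RHS]eq_bigr => i _ do under eq_bigr => j _ do rewrite scaler_sumr.
under eq_bigr => i _ do rewrite exchange_big /=.
rewrite exchange_big /=; apply: eq_bigr => k _.
under eq_bigr => i _ do under eq_bigr => j _ do rewrite scaler_sumr.
under [RHS]eq_bigr => i _ do under eq_bigr => j _ do rewrite scaler_sumr.
under eq_bigr => i _ do rewrite exchange_big /=.
rewrite exchange_big /=; apply: eq_bigr => l _.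
apply: eq_bigr => i _; apply: eq_bigr => j _.
by rewrite !scalerA mulrC.
Qed.

End TensorLin.

(* Threefold tensors live in (H (x) H) (x) H.                                 *)
Record hopfAlg (F : fieldType) := HopfAlg {
  hopf_sort :> falgType F;
  comul : 'Hom(hopf_sort, tens hopf_sort hopf_sort);
  counit : 'Hom(hopf_sort, F^o);
  antipode : 'End(hopf_sort);
  comulA : forall x,
    \tsum_(a, b <- comul x) \tsum_(a1, a2 <- comul a) a1 \ox a2 \ox b
    = \tsum_(a, b <- comul x) \tsum_(b1, b2 <- comul b) a \ox b1 \ox b2;
  counitl : forall x, \tsum_(a, b <- comul x) counit a *: b = x;
  counitr : forall x, \tsum_(a, b <- comul x) counit b *: a = x;
  comul1 : comul 1 = 1 \ox 1;
  comulM : forall x y, comul (x * y)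
    = \tsum_(a, b <- comul x) \tsum_(c, d <- comul y) (a * c) \ox (b * d);
  counit1 : counit 1 = 1;
  counitM : forall x y, counit (x * y) = counit x * counit y;
  antipodel : forall x,
    \tsum_(a, b <- comul x) antipode a * b = counit x *: 1;
  antipoder : forall x,
    \tsum_(a, b <- comul x) a * antipode b = counit x *: 1
}.

Definition tmul (F : fieldType) (H : falgType F) (X Y : tens H H) : tens H H :=
  \tsum_(a, b <- X) \tsum_(c, d <- Y) (a * c) \ox (b * d).

Definition tflip (F : fieldType) (H : falgType F) (X : tens H H) : tens H H :=
  \tsum_(a, b <- X) b \ox a.

Record ribbonHopf (F : fieldType) := RibbonHopf {
  ribbon_hopf :> hopfAlg F;
  Rmat : tens ribbon_hopf ribbon_hopf;
  Rmat_inv : exists Q, tmul Rmat Q = 1 \ox 1 /\ tmul Q Rmat = 1 \ox 1;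
  Rmat_comul : forall x : ribbon_hopf,
    tmul Rmat (comul ribbon_hopf x) = tmul (tflip (comul ribbon_hopf x)) Rmat;
  Rmat_comull :
    \tsum_(a, b <- Rmat) \tsum_(a1, a2 <- comul ribbon_hopf a) a1 \ox a2 \ox b
    = \tsum_(a, b <- Rmat) \tsum_(c, d <- Rmat) a \ox c \ox (b * d);
  Rmat_comulr :
    \tsum_(a, b <- Rmat) \tsum_(b1, b2 <- comul ribbon_hopf b) a \ox b1 \ox b2
    = \tsum_(a, b <- Rmat) \tsum_(c, d <- Rmat) (a * c) \ox d \ox b;
  ribbon : ribbon_hopf;
  ribbon_unit : ribbon \is a GRing.unit;
  ribbon_central : forall x, ribbon * x = x * ribbon;
  ribbon_sqr : let u := \tsum_(a, b <- Rmat) antipode ribbon_hopf b * a in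
    ribbon * ribbon = u * antipode ribbon_hopf u;
  ribbon_comul :
    tmul (tmul (tflip Rmat) Rmat) (comul ribbon_hopf ribbon) = ribbon \ox ribbon;
  ribbon_antipode : antipode ribbon_hopf ribbon = ribbon;
  ribbon_counit : counit ribbon_hopf ribbon = 1
}.

Section HopfDefs.
Variable F : fieldType.
Implicit Type H : hopfAlg F.

Local Notation dual H := 'Hom(hopf_sort H, F^o).

Definition dmul H (psi phi : dual H) : dual H :=
  linfun (fun x : H => \tsum_(a, b <- comul H x) (psi a * phi b : F^o)).

(* The linear forms phi(? h) and phi(h ?).                                    *)
Definition dtransr H (phi : dual H) (h : H) : dual H :=
  linfun (fun x : H => phi (x * h)).
Definition dtransl H (phi : dual H) (h : H) : dual H :=
  linfun (fun x : H => phi (h * x)).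

Lemma dmulE H (psi phi : dual H) x :
  dmul psi phi x = \tsum_(a, b <- comul H x) (psi a * phi b : F^o).
Proof. by rewrite linfunE // => c y z; rewrite linearP tsumDl. Qed.

Lemma dtransrE H (phi : dual H) h x : dtransr phi h x = phi (x * h).
Proof. by rewrite linfunE // => c y z; rewrite mulrDl -scalerAl linearP. Qed.

Lemma dtranslE H (phi : dual H) h x : dtransl phi h x = phi (h * x).
Proof. by rewrite linfunE // => c y z; rewrite mulrDr -scalerAr linearP. Qed.

(* The Heisenberg double: psi \ox h stands for psi h, so that the product is  *)
(* determined by h psi = psi(? h') h''.                                       *)
Definition heis H := tens (dual H) H.
HB.instance Definition _ H := Vector.on (heis H).

Definition hone H : heis H := counit H \ox 1.
Definition hmul H (x y : heis H) : heis H :=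
  \tsum_(psi, h <- x) \tsum_(phi, k <- y) \tsum_(a, b <- comul H h)
    dmul psi (dtransr phi a) \ox (b * k).

Section Laws.
Variable H : hopfAlg F.
Implicit Types (psi phi chi : dual H) (x y z : heis H).

Lemma comulA_trilin (U : lmodType F) (f : H -> H -> H -> U) (h : H) :
  (forall c (x y b d : H), f (c *: x + y) b d = c *: f x b d + f y b d) ->
  (forall c (x y b d : H), f b (c *: x + y) d = c *: f b x d + f b y d) ->
  (forall c (x y b d : H), f b d (c *: x + y) = c *: f b d x + f b d y) ->
  \tsum_(a, b <- comul H h) \tsum_(a1, a2 <- comul H a) f a1 a2 b
  = \tsum_(a, b <- comul H h) \tsum_(b1, b2 <- comul H b) f a b1 b2.
Proof.
move=> f1 f2 f3.
pose Phi (T : tens (tens H H) H) : U := \tsum_(p, c <- T) \tsum_(a, b <- p) f a b c.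
have PhiL : linear Phi by move=> c x y; exact: tsumDl.
have PhiP a b c : Phi (a \ox b \ox c) = f a b c.
  rewrite /Phi tsum_pure; first by rewrite tsum_pure //; split=> ? c0 x y /=.
  split=> [y|p] c0 u v /=; first exact: tsumDl.
  by apply: tsumDr => a' b'; exact: f3.
have := congr1 Phi (comulA h).
rewrite !linear_tsum // => e.
transitivity (\tsum_(a, b <- comul H h) Phi (\tsum_(a1, a2 <- comul H a) a1 \ox a2 \ox b)).
  by apply: eq_tsum => a b; rewrite linear_tsum //; apply: eq_tsum => *; rewrite PhiP.
rewrite e; apply: eq_tsum => a b; rewrite linear_tsum //.
by apply: eq_tsum => *; rewrite PhiP.
Qed.

Lemma comul_mul_tsum (U : lmodType F) (f : H -> H -> U) (h k : H) :
  bilinear_map f ->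
  \tsum_(a, b <- comul H (h * k)) f a b
  = \tsum_(a, b <- comul H h) \tsum_(c, d <- comul H k) f (a * c) (b * d).
Proof.
move=> bf; rewrite comulM (linear_tsum _ _ (@tsum_linear _ _ _ _ f)).
apply: eq_tsum => a b; rewrite (linear_tsum _ _ (@tsum_linear _ _ _ _ f)).
by apply: eq_tsum => c d; rewrite tsum_pure.
Qed.

Lemma dmulDl c psi psi' phi :
  dmul (c *: psi + psi') phi = c *: dmul psi phi + dmul psi' phi.
Proof.
apply/lfunP => x; rewrite !lfunE /= lfunE /= !dmulE; apply: tsumDr => a b.
by rewrite !lfunE /= lfunE /= mulrDl -scalerAl.
Qed.

Lemma dmulDr c psi phi phi' :
  dmul psi (c *: phi + phi') = c *: dmul psi phi + dmul psi phi'.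
Proof.
apply/lfunP => x; rewrite !lfunE /= lfunE /= !dmulE; apply: tsumDr => a b.
by rewrite !lfunE /= lfunE /= mulrDr -scalerAr.
Qed.

Lemma dtransrDl c phi phi' h :
  dtransr (c *: phi + phi') h = c *: dtransr phi h + dtransr phi' h.
Proof. by apply/lfunP => x; rewrite !(dtransrE, add_lfunE, scale_lfunE). Qed.

Lemma dtransrDr c phi h h' :
  dtransr phi (c *: h + h') = c *: dtransr phi h + dtransr phi h'.
Proof.
apply/lfunP => x; rewrite !(dtransrE, add_lfunE, scale_lfunE).
by rewrite mulrDr -scalerAr linearP.
Qed.

Lemma dmulA psi phi chi : dmul psi (dmul phi chi) = dmul (dmul psi phi) chi.
Proof.
apply/lfunP => x; rewrite !dmulE.
transitivity (\tsum_(a, b <- comul H x) \tsum_(b1, b2 <- comul H b)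
  (psi a * (phi b1 * chi b2) : F^o)).
  apply: eq_tsum => a b; rewrite dmulE.
  by apply: (linear_tsum (h := fun t : F^o => psi a * t : F^o)) => c u v;
    rewrite mulrDr scalerAr.
rewrite -(comulA_trilin (f := fun a b c => psi a * (phi b * chi c) : F^o)).
- apply: eq_tsum => a b; rewrite dmulE.
  rewrite (linear_tsum (h := fun t : F^o => t * chi b : F^o)); last first.
    by move=> c u v; rewrite mulrDl scalerAl.
  by apply: eq_tsum => *; rewrite mulrA.
- by move=> c u v b d; rewrite linearP mulrDl -scalerAl.
- by move=> c u v b d; rewrite linearP /= mulrDl mulrDr -mulrA mulrCA.
- move=> c u v b d; rewrite linearP /= !mulrDr; congr (_ + _).
  by rewrite [X in psi _ * X]mulrCA [LHS]mulrCA.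
Qed.

Lemma dmul1l phi : dmul (counit H) phi = phi.
Proof.
apply/lfunP => x; rewrite dmulE -[in RHS](counitl x).
rewrite (linear_tsum (h := fun t : H => phi t)) => [|c u v]; last exact: linearP.
by apply: eq_tsum => a b; rewrite linearZ.
Qed.

Lemma dmul1r phi : dmul phi (counit H) = phi.
Proof.
apply/lfunP => x; rewrite dmulE -[in RHS](counitr x).
rewrite (linear_tsum (h := fun t : H => phi t)) => [|c u v]; last exact: linearP.
by apply: eq_tsum => a b; rewrite linearZ /= mulrC.
Qed.

Lemma dtransr1 phi : dtransr phi 1 = phi.
Proof. by apply/lfunP => x; rewrite dtransrE mulr1. Qed.

Lemma dtransrM phi a b : dtransr (dtransr phi a) b = dtransr phi (b * a).
Proof. by apply/lfunP => x; rewrite !dtransrE mulrA. Qed.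

Lemma dtransr_counit h : dtransr (counit H) h = counit H h *: counit H.
Proof. by apply/lfunP => x; rewrite dtransrE lfunE /= counitM mulrC. Qed.

Lemma dtransr_dmul psi phi h :
  dtransr (dmul psi phi) h
  = \tsum_(a, b <- comul H h) dmul (dtransr psi a) (dtransr phi b).
Proof.
apply/lfunP => x; rewrite dtransrE dmulE.
rewrite (comul_mul_tsum (f := fun a b => psi a * phi b : F^o)); last first.
  split=> [y|y] c u v; rewrite linearP.
    by rewrite mulrDl -scalerAl.
  by rewrite mulrDr -scalerAr.
rewrite tsum_exchange.
rewrite (linear_tsum (h := fun f : dual H => f x)) => [|c u v]; last first.
  by rewrite !lfunE /= lfunE.
by apply: eq_tsum => a b; rewrite dmulE; apply: eq_tsum => c d; rewrite !dtransrE.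
Qed.

Definition hmulf psi h phi k : heis H :=
  \tsum_(a, b <- comul H h) dmul psi (dtransr phi a) \ox (b * k).

Lemma hmulf1 c psi psi' h phi k :
  hmulf (c *: psi + psi') h phi k = c *: hmulf psi h phi k + hmulf psi' h phi k.
Proof. by apply: tsumDr => a b; rewrite dmulDl pureDl. Qed.

Lemma hmulf2 c psi h h' phi k :
  hmulf psi (c *: h + h') phi k = c *: hmulf psi h phi k + hmulf psi h' phi k.
Proof. by rewrite /hmulf linearP tsumDl. Qed.

Lemma hmulf3 c psi h phi phi' k :
  hmulf psi h (c *: phi + phi') k = c *: hmulf psi h phi k + hmulf psi h phi' k.
Proof. by apply: tsumDr => a b; rewrite dtransrDl dmulDr pureDl. Qed.

Lemma hmulf4 c psi h phi k k' :
  hmulf psi h phi (c *: k + k') = c *: hmulf psi h phi k + hmulf psi h phi k'.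
Proof. by apply: tsumDr => a b; rewrite mulrDr -scalerAr pureDr. Qed.

Lemma hmulfE x y : hmul x y =
  \tsum_(psi, h <- x) \tsum_(phi, k <- y) hmulf psi h phi k.
Proof. by []. Qed.

Lemma hmul_linearl y : linear (fun x => hmul x y).
Proof. by move=> c x x'; rewrite hmulfE tsumDl. Qed.

Lemma hmul_linearr x : linear (hmul x).
Proof. by move=> c y y'; apply: tsumDr => psi h; rewrite tsumDl. Qed.

Lemma hmul_purel psi h y :
  hmul (psi \ox h) y = \tsum_(phi, k <- y) hmulf psi h phi k.
Proof.
rewrite hmulfE tsum_pure //; split=> ? c u v; apply: tsumDr => a b.
  exact: hmulf1.
exact: hmulf2.
Qed.

Lemma hmul_pure psi h phi k :
  hmul (psi \ox h) (phi \ox k) = hmulf psi h phi k.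
Proof.
rewrite hmul_purel tsum_pure //; split=> ? c u v.
  exact: hmulf3.
exact: hmulf4.
Qed.

Fact hmulA : associative (hmul (H := H)).
Proof.
move=> x y z.
pose lx (f : heis H -> heis H) (g : heis H -> heis H) := @eq_tens_lin F _ _ _ f g.
apply: (lx (fun x => hmul x (hmul y z)) (fun x => hmul (hmul x y) z)).
- exact: hmul_linearl.
- by move=> c u v; rewrite !hmul_linearl.
move=> psi h {x}.
apply: (lx (fun y => hmul _ (hmul y z)) (fun y => hmul (hmul _ y) z)).
- by move=> c u v; rewrite hmul_linearl hmul_linearr.
- by move=> c u v; rewrite hmul_linearr hmul_linearl.
move=> phi k {y}.
apply: (lx (fun z => hmul _ (hmul _ z)) (fun z => hmul _ z)).
- by move=> c u v; rewrite !hmul_linearr.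
- exact: hmul_linearr.
move=> chi l {z lx}.
rewrite !hmul_pure [in LHS]/hmulf (linear_tsum _ _ (hmul_linearr _)).
rewrite [in RHS]/hmulf (linear_tsum _ _ (hmul_linearl _)).
under eq_tsum => a b do rewrite hmul_pure /hmulf.
under [RHS]eq_tsum => a b.
  rewrite hmul_pure /hmulf.
  rewrite (comul_mul_tsum (f := fun u v =>
    dmul (dmul psi (dtransr phi a)) (dtransr chi u) \ox (v * l))); last first.
    split=> ? c u v; first by rewrite dtransrDr dmulDr pureDl.
    by rewrite mulrDl -scalerAl pureDr.
  over.
rewrite [RHS]/=.
rewrite -(comulA_trilin (f := fun a b d => \tsum_(c, e <- comul H k)
   dmul (dmul psi (dtransr phi a)) (dtransr chi (b * c)) \ox (d * e * l)));
  first last.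
- move=> c u v b d; apply: tsumDr => p q.
  by rewrite !mulrDl -!scalerAl pureDr.
- move=> c u v b d; apply: tsumDr => p q.
  by rewrite mulrDl -scalerAl dtransrDr dmulDr pureDl.
- move=> c u v b d; apply: tsumDr => p q.
  by rewrite dtransrDr dmulDr dmulDl pureDl.
rewrite tsum_exchange; apply: eq_tsum => a b.
rewrite tsum_exchange; apply: eq_tsum => c d.
rewrite dtransr_dmul (linear_tsum (h := fun f => dmul psi f \ox _)); last first.
  by move=> e u v; rewrite dmulDr pureDl.
by apply: eq_tsum => p q; rewrite dtransrM dmulA mulrA.
Qed.

Fact hmul1l : left_id (hone H) (hmul (H := H)).
Proof.
apply: eq_tens_lin; [exact: hmul_linearr|by []|] => phi k.
rewrite hmul_pure /hmulf comul1 tsum_pure; last first.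
  split=> ? c u v; first by rewrite dtransrDr dmulDr pureDl.
  by rewrite mulrDl -scalerAl pureDr.
by rewrite dtransr1 dmul1l mul1r.
Qed.

Fact hmulr1 : right_id (hone H) (hmul (H := H)).
Proof.
apply: (@eq_tens_lin _ _ _ _ (fun x => hmul x (hone H)));
  [exact: hmul_linearl|by []|] => psi h.
rewrite hmul_pure /hmulf -[in RHS](counitl h).
rewrite (linear_tsum (h := fun t : H => psi \ox t)); last first.
  by move=> c u v; rewrite pureDr.
apply: eq_tsum => a b; rewrite mulr1 dtransr_counit.
have -> : dmul psi (counit H a *: counit H) = counit H a *: psi.
  apply/lfunP => x; rewrite scale_lfunE -[in RHS](dmul1r psi) !dmulE.
  rewrite (linear_tsum (h := fun t : F^o => counit H a *: t)); last first.
    by move=> c u v; rewrite scalerDr !scalerA mulrC.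
  by apply: eq_tsum => c d; rewrite scale_lfunE /= mulrCA.
apply/matrixP => i j; rewrite !mxE !linearZ /= .
by rewrite -mulrA mulrCA.
Qed.

Lemma hscaleAl c x y : c *: hmul x y = hmul (c *: x) y.
Proof. by have /scalable_linear hl := @hmul_linearl y; rewrite hl. Qed.

Lemma hscaleAr c x y : c *: hmul x y = hmul x (c *: y).
Proof. by have /scalable_linear hl := @hmul_linearr x; rewrite hl. Qed.

Fact hmulDl : left_distributive (hmul (H := H)) +%R.
Proof. by move=> x y z; have := hmul_linearl z 1 x y; rewrite !scale1r. Qed.

Fact hmulDr : right_distributive (hmul (H := H)) +%R.
Proof. by move=> x y z; have := hmul_linearr x 1 y z; rewrite !scale1r. Qed.

End Laws.

HB.instance Definition _ H := GRing.Zmodule_isPzRing.Build (heis H)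
  (@hmulA H) (@hmul1l H) (@hmulr1 H) (@hmulDl H) (@hmulDr H).

Definition heis_O H (psi : dual H) : heis H := psi \ox 1.
Definition heis_H H (h : H) : heis H := counit H \ox h.

(* (psi h) |> phi = psi phi(? h), with values in End(H^* ).                   *)
Definition heis_act H : 'Hom(heis H, 'End('Hom(hopf_sort H, F^o))) :=
  linfun (fun x : heis H =>
    \tsum_(psi, h <- x) linfun (fun phi : dual H => dmul psi (dtransr phi h))).

Definition antipode_inv H : 'End(hopf_sort H) := (antipode H)^-1%VF.

Definition heis_tilde H (h : H) : heis H :=
  (heis_act H)^-1%VF
    (linfun (fun phi : dual H => dtransl phi (antipode_inv H h))).

(* A module is given in a basis: mrep x is the matrix of x on column vectors. *)
Record hmod H := HMod {
  mdim : nat;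
  mrep : {linear H -> 'M[F]_mdim};
  mrep1 : mrep 1 = 1%:M;
  mrepM : forall x y, mrep (x * y) = mrep x *m mrep y
}.

(* The action of an element of H (x) H on I (x) J.                            *)
Definition act2 H (I J : hmod H) (X : tens H H) : 'M[F]_(mdim I * mdim J) :=
  \tsum_(x, y <- X) tensmx (mrep I x) (mrep J y).

Section Modules.
Variable H : hopfAlg F.
Implicit Types I J : hmod H.

Lemma act2_linear I J : linear (act2 I J).
Proof. by move=> c X Y; rewrite /act2 tsumDl. Qed.

Lemma act2_bilin I J :
  bilinear_map (fun x y : H => tensmx (mrep I x) (mrep J y)).
Proof.
split=> [y|x] c u v; rewrite linearP; apply/matrixP => i j; rewrite !mxE.
  by rewrite mulrDl mulrA.
by rewrite mulrDr mulrCA.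
Qed.

Lemma act2_pure I J x y : act2 I J (x \ox y) = tensmx (mrep I x) (mrep J y).
Proof. by rewrite /act2 tsum_pure //; apply: act2_bilin. Qed.

Lemma act2_tmul I J X Y : act2 I J (tmul X Y) = act2 I J X *m act2 I J Y.
Proof.
rewrite /tmul (linear_tsum _ _ (@act2_linear I J)) [act2 I J X]/act2.
rewrite (linear_tsum (h := fun M => M *m act2 I J Y)); last first.
  by move=> c M N; rewrite mulmxDl scalemxAl.
apply: eq_tsum => a b; rewrite (linear_tsum _ _ (@act2_linear I J)) /act2.
rewrite (linear_tsum (h := fun M => _ *m M)); last first.
  by move=> c M N; rewrite mulmxDr scalemxAr.
by apply: eq_tsum => c d; rewrite -/(act2 I J _) act2_pure !mrepM tensmx_mul.
Qed.

Definition mtens_rep I J (x : H) := act2 I J (comul H x).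

Fact mtens_rep_linear I J : linear (mtens_rep I J).
Proof. by move=> c x y; rewrite /mtens_rep linearP act2_linear. Qed.

HB.instance Definition _ I J :=
  GRing.isLinear.Build F H 'M[F]_(mdim I * mdim J) _ (mtens_rep I J)
    (mtens_rep_linear I J).

Fact mtens_rep1 I J : mtens_rep I J 1 = 1%:M.
Proof.
rewrite /mtens_rep comul1 act2_pure !mrep1.
apply/matrixP => i j; case: (mxtens_indexP i) => i1 i2.
case: (mxtens_indexP j) => j1 j2; rewrite tensmxE !mxE -natrM mulnb.
by rewrite (can_eq (@mxtens_indexK _ _)) xpair_eqE.
Qed.

Fact mtens_repM I J x y :
  mtens_rep I J (x * y) = mtens_rep I J x *m mtens_rep I J y.
Proof. by rewrite /mtens_rep comulM -act2_tmul. Qed.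

Definition mtens I J : hmod H :=
  HMod (mtens_rep1 I J) (@mtens_repM I J).

Definition mtriv_rep (x : H) : 'M[F]_1 := (counit H x)%:M.

Fact mtriv_rep_linear : linear mtriv_rep.
Proof.
by move=> c x y; rewrite /mtriv_rep linearP raddfD /= scale_scalar_mx.
Qed.

HB.instance Definition _ :=
  GRing.isLinear.Build F H 'M[F]_1 _ mtriv_rep mtriv_rep_linear.

Fact mtriv_rep1 : mtriv_rep 1 = 1%:M.
Proof. by rewrite /mtriv_rep counit1. Qed.

Fact mtriv_repM x y : mtriv_rep (x * y) = mtriv_rep x *m mtriv_rep y.
Proof. by rewrite /mtriv_rep counitM scalar_mxM. Qed.

Definition mtriv : hmod H := HMod mtriv_rep1 mtriv_repM.

Definition Tmx I : 'M[dual H]_(mdim I) :=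
  \matrix_(i, j) linfun (fun x : H => mrep I x i j : F^o).

End Modules.

(* Indices start at 0: the letter lM j stands for M(g + 1 + j).               *)
Definition letter (g n : nat) := ('I_g * bool + 'I_n)%type.

Definition lA g n (i : 'I_g) : letter g n := inl (i, true).
Definition lB g n (i : 'I_g) : letter g n := inl (i, false).
Definition lM g n (j : 'I_n) : letter g n := inr j.

Definition site g n (k : letter g n) : nat :=
  match k with inl (i, _) => i | inr j => (g + j)%N end.

Section GraphAlgebra.
Variable (H : ribbonHopf F).
Implicit Types I J : hmod H.

Local Notation R := (Rmat H).
Local Notation R' := (tflip (Rmat H)).

(* M_1 and N_2: (mx1 M *m mx2 N) has entries M i j * N k l in this order.     *)
Definition mx1 (A : pzRingType) d e (M : 'M[A]_d) : 'M[A]_(d * e) :=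
  tensmx M (1%:M : 'M_e).
Definition mx2 (A : pzRingType) d e (N : 'M[A]_e) : 'M[A]_(d * e) :=
  tensmx (1%:M : 'M_d) N.

Section Relations.
Variables g n : nat.

Definition Lgens : choiceType := (letter g n * dual H)%type.
Local Notation FA := (freealg F Lgens).

Definition fmx (k : letter g n) I : 'M[FA]_(mdim I) :=
  map_mx (fun phi => freegen F ((k, phi) : Lgens)) (Tmx I).

Definition fscal d (M : 'M[F]_d) : 'M[FA]_d := map_mx (fun c => c *: 1) M.

Definition rel_fusion k I J : 'M[FA]_(mdim I * mdim J) :=
  fmx k (mtens I J)
  - mx1 _ (fmx k I) *m fscal (act2 I J R') *m mx2 _ (fmx k J)
      *m fscal (invmx (act2 I J R')).

Definition rel_exchange k l I J : 'M[FA]_(mdim I * mdim J) :=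
  fscal (act2 I J R) *m mx1 _ (fmx k I) *m fscal (invmx (act2 I J R))
    *m mx2 _ (fmx l J)
  - mx2 _ (fmx l J) *m fscal (act2 I J R) *m mx1 _ (fmx k I)
      *m fscal (invmx (act2 I J R)).

Definition rel_handle (i : 'I_g) I J : 'M[FA]_(mdim I * mdim J) :=
  fscal (act2 I J R) *m mx1 _ (fmx (lB n i) I) *m fscal (act2 I J R')
    *m mx2 _ (fmx (lA n i) J)
  - mx2 _ (fmx (lA n i) J) *m fscal (act2 I J R) *m mx1 _ (fmx (lB n i) I)
      *m fscal (invmx (act2 I J R)).

Inductive Lrel : FA -> Prop :=
| Lrel_linear k c (phi psi : dual H) :
    Lrel (freegen F ((k, c *: phi + psi) : Lgens)
          - (c *: freegen F ((k, phi) : Lgens) + freegen F ((k, psi) : Lgens)))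
| Lrel_trivial k i j : Lrel ((fmx k (mtriv H) - 1%:M) i j)
| Lrel_fusion k I J i j : Lrel (rel_fusion k I J i j)
| Lrel_exchange k l I J i j :
    (site k < site l)%N -> Lrel (rel_exchange k l I J i j)
| Lrel_handle a I J i j : Lrel (rel_handle a I J i j).

Definition Lgn := presented Lrel.

Definition Lmx (k : letter g n) I : 'M[Lgn]_(mdim I) :=
  map_mx (fun phi => pgen Lrel ((k, phi) : Lgens)) (Tmx I).

End Relations.

Definition factorizable : Prop :=
  bijective (fun phi : dual H => \tsum_(x, y <- tmul R R') phi x *: y).

Definition Lplus I : 'M[H]_(mdim I) :=
  \matrix_(i, j) \tsum_(a, b <- R) mrep I a i j *: b.
Definition Lminus I : 'M[H]_(mdim I) :=
  \matrix_(i, j) \tsum_(a, b <- R) mrep I (antipode_inv H b) i j *: a.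
Definition Ltilde I : 'M[heis H]_(mdim I) :=
  \matrix_(i, j)
    \tsum_(a, b <- R) mrep I (antipode_inv H b) i j *: heis_tilde a.

Definition is_Psi01 (f : Lgn 0 1 -> H) :=
  alg_morphism f /\
  forall I, map_mx f (Lmx (lM 0 ord0) I) = Lplus I *m ncinvmx (Lminus I).

Definition is_Psi10 (f : Lgn 1 0 -> heis H) :=
  alg_morphism f /\
  forall I,
    let Lp := map_mx (@heis_H H) (Lplus I) in
    let Lm := map_mx (@heis_H H) (Lminus I) in
    map_mx f (Lmx (lA 0 ord0) I) = Lp *m ncinvmx Lm /\
    map_mx f (Lmx (lB 0 ord0) I)
      = Lp *m map_mx (@heis_O H) (Tmx I) *m ncinvmx Lm.

(* At most one algebra morphism has the prescribed values, since the matrix   *)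
(* coefficients of all modules span H^*; it is selected by choice.            *)
Definition Psi01 : Lgn 0 1 -> H :=
  xget (fun=> 0 : H) [set f : {classic (Lgn 0 1 -> H)} | is_Psi01 f]%classic.
Definition Psi10 : Lgn 1 0 -> heis H :=
  xget (fun=> 0 : heis H)
    [set f : {classic (Lgn 1 0 -> heis H)} | is_Psi10 f]%classic.

Definition Psi01_inv (h : H) : Lgn 0 1 := xget 0 [set x | Psi01 x = h]%classic.
Definition Psi10_inv (h : heis H) : Lgn 1 0 :=
  xget 0 [set x | Psi10 x = h]%classic.

Definition Mminus I : 'M[Lgn 0 1]_(mdim I) := map_mx Psi01_inv (Lminus I).
Definition Cminus I : 'M[Lgn 1 0]_(mdim I) :=
  map_mx Psi10_inv (map_mx (@heis_H H) (Lminus I) *m Ltilde I).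

Section Target.
Variables g n : nat.

Definition fgenus (k : 'I_g + 'I_n) : nat := if k is inl _ then 1 else 0.
Definition fpunct (k : 'I_g + 'I_n) : nat := if k is inl _ then 0 else 1.

(* L_{1,0}(H) ^{(x) g} (x) L_{0,1}(H) ^{(x) n}.                               *)
Definition Ltens :=
  bigtens (fun k : 'I_g + 'I_n => @Lrel (fgenus k) (fpunct k)).

Definition in_handle (i : 'I_g) (x : Lgn 1 0) : Ltens :=
  @tens_in _ _ _ (fun k => @Lrel (fgenus k) (fpunct k)) (inl i) x.
Definition in_puncture (j : 'I_n) (x : Lgn 0 1) : Ltens :=
  @tens_in _ _ _ (fun k => @Lrel (fgenus k) (fpunct k)) (inr j) x.

Definition uA (i : 'I_g) I : 'M[Ltens]_(mdim I) :=
  map_mx (in_handle i) (Lmx (lA 0 ord0) I).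
Definition uB (i : 'I_g) I : 'M[Ltens]_(mdim I) :=
  map_mx (in_handle i) (Lmx (lB 0 ord0) I).
Definition uM (j : 'I_n) I : 'M[Ltens]_(mdim I) :=
  map_mx (in_puncture j) (Lmx (lM 0 ord0) I).
Definition uC (i : 'I_g) I : 'M[Ltens]_(mdim I) :=
  map_mx (in_handle i) (Cminus I).
Definition uMminus (j : 'I_n) I : 'M[Ltens]_(mdim I) :=
  map_mx (in_puncture j) (Mminus I).

(* Ordered products over the indices smaller than m; Lambda m and Gamma m are *)
(* attached to the (0-based) handle m and puncture m.                         *)
Definition Lambda (m : nat) I : 'M[Ltens]_(mdim I) :=
  \big[mulmx/1%:M]_(k < g | (k < m)%N) uC k I.
Definition Gamma (m : nat) I : 'M[Ltens]_(mdim I) :=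
  Lambda g I *m \big[mulmx/1%:M]_(k < n | (k < m)%N) uMminus k I.

Definition is_alpha (f : Lgn g n -> Ltens) : Prop :=
  [/\ alg_morphism f,
      forall I (i : 'I_g),
        map_mx f (Lmx (lA n i) I) = Lambda i I *m uA i I *m ncinvmx (Lambda i I),
      forall I (i : 'I_g),
        map_mx f (Lmx (lB n i) I) = Lambda i I *m uB i I *m ncinvmx (Lambda i I)
    & forall I (j : 'I_n),
        map_mx f (Lmx (lM g j) I) = Gamma j I *m uM j I *m ncinvmx (Gamma j I)].

End Target.
End GraphAlgebra.
End HopfDefs.

(* Main.v *)
(* To a morphism s from H to an algebra L is attached the matrix Lambda =     *)
(* s(L^(-)), i.e. R^(-1) with one leg represented in L. If the image of s     *)
(* commutes with the entries of U, conjugation by Lambda preserves the fusion *)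
(* and handle relations, because the Yang-Baxter equation lets Lambda_1 and   *)
(* Lambda_2 slide along R.                                                    *)
(*                                                                            *)
(* Each tensor factor carries a moment map r from H, namely Psi_{0,1}^(-1)    *)
(* for M and h |-> Psi_{1,0}^(-1)(tilde(h') h'') for A and B, and its         *)
(* generating matrices U are equivariant: r(h') h'' commutes with U.          *)
(* Convolving the moment maps of the factors before i gives a morphism s_i    *)
(* with s_i(L^(-)) = Lambda_i or Gamma_i. Given equivariance, the braided     *)
(* exchange relation between two matrices conjugated by their Lambda's is     *)
(* equivalent to plain commutation of the original matrices. So alpha is well *)
(* defined by the presentation of L_{g,n}(H); conversely, undoing the         *)
(* conjugations one factor after the other in L_{g,n}(H) produces commuting   *)
(* copies of L_{1,0}(H) and L_{0,1}(H), hence the inverse morphism by the     *)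
(* universal property of the tensor product.                                  *)
(*                                                                            *)
(* The moment maps require Psi_{0,1} and Psi_{1,0} to be bijective. They are  *)
(* onto by factorizability, and the fusion and handle relations show that the *)
(* entries of M span L_{0,1}(H) and that the products of an entry of A by an  *)
(* entry of B span L_{1,0}(H), which bounds the dimensions.                   *)

(* Every R-matrix below is a [Rel f g], the image of R under two maps from H into one algebra. For
   mutually commuting morphisms the quasitriangularity axioms become [Rel_convl], [Rel_convr],
   [Rel_intertwine] and [YBE], and the matrix relations are handled through these alone. A morphism
   out of L_{g,n}(H) is the same thing as an [Lsys], a family of linear maps on H^* subject to the
   matrix relations ([Lgn_hom], [lgen_sys]); a morphism out of the tensor product is a family of
   morphisms of the factors with pairwise commuting images ([bigtens_hom]).

   The theorem then compares two kinds of data in an arbitrary algebra L: commuting morphisms [e]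
   from the factors, and a system [u] whose matrices at each site are those of [e] conjugated by the
   Lambda of the preceding sites ([dressed]). Conjugation respects each relation in both directions:
   [twist_triv], [twist_fusion] and [twist_handle] within a site, and [twist_exchange] between two
   sites, where equivariance under the moment maps ([equivariant01], [equivariant10]) turns braided
   exchange into plain commutation. So dressing commuting morphisms gives a system ([dressed_sys]),
   every system arises so ([undress_exists]), and from only one family ([dressed_uniq]).

   For L the tensor product with its canonical embeddings this produces alpha; for L = L_{g,n}(H)
   with its own generators it produces the inverse. Both composites are identities because dressing
   and undressing are unique ([alpha_isomorphism]). Factorizability enters through [Psi01_bij] and
   [Psi10_bij], which provide the moment maps. *)
Require Import Defs.
From HB Require Import structures.
From mathcomp Require Import all_boot all_order all_algebra all_field.
From mathcomp Require Import boolp classical_sets reals complex.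
From mathcomp Require Import finmap mxtens monalg.

Set Implicit Arguments.
Unset Strict Implicit.
Unset Printing Implicit Defensive.

Import GRing.Theory.

Local Open Scope ring_scope.

(* L_{g,n}(H) is only known a posteriori to be nonzero, which excludes the    *)
(* algebra structures of the library.                                         *)
HB.mixin Record PzRing_isPzAlg (F : fieldType) A of GRing.PzRing A := {
  pz_scale : F -> A -> A;
  pz_scaleA : forall c d x, pz_scale c (pz_scale d x) = pz_scale (c * d) x;
  pz_scale1 : left_id 1 pz_scale;
  pz_scaleDr : right_distributive pz_scale +%R;
  pz_scaleDl : forall x c d, pz_scale (c + d)%R x = pz_scale c x + pz_scale d x;
  pz_scaleAl : forall c (x y : A), pz_scale c (x * y) = pz_scale c x * y;
  pz_scaleAr : forall c (x y : A), pz_scale c (x * y) = x * pz_scale c y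
}.

#[short(type="pzAlgType")]
HB.structure Definition PzAlg (F : fieldType) :=
  { A of GRing.PzRing A & PzRing_isPzAlg F A }.

HB.instance Definition _ (F : fieldType) (A : pzAlgType F) :=
  GRing.Zmodule_isLmodule.Build F (PzAlg.sort A) (@pz_scaleA F A) (@pz_scale1 F A)
    (@pz_scaleDr F A) (@pz_scaleDl F A).

Definition pzscaleAl (F : fieldType) (A : pzAlgType F) (c : F) (x y : A) :
  c *: (x * y) = (c *: x) * y := pz_scaleAl c x y.
Definition pzscaleAr (F : fieldType) (A : pzAlgType F) (c : F) (x y : A) :
  c *: (x * y) = x * (c *: y) := pz_scaleAr c x y.

HB.instance Definition _ (F : fieldType) (A : falgType F) :=
  PzRing_isPzAlg.Build F (Falgebra.sort A) (@scalerA F A) (@scale1r F A)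
    (@scalerDr F A) (fun x c d => scalerDl x c d) (@scalerAl F A) (@scalerAr F A).

HB.instance Definition _ (F : fieldType) (X : choiceType)
    (E : freealg F X -> Prop) :=
  PzRing_isPzAlg.Build F (presented E) (@scalerA _ _)
    (@scale1r F _) (@scalerDr F _) (fun x c d => scalerDl x c d)
    (@pscaleAl F X E) (@pscaleAr F X E).

HB.instance Definition _ (F : fieldType) (H : hopfAlg F) :=
  PzRing_isPzAlg.Build F (heis H) (@scalerA _ _)
    (@scale1r F _) (@scalerDr F _) (fun x c d => scalerDl x c d)
    (@hscaleAl F H) (@hscaleAr F H).

(** * Algebras that may be zero, and algebras given by generators *)

Section AlgMorphisms.
Variables (F : fieldType).
Implicit Types A B C : pzAlgType F.

Lemma lin0 (U V : lmodType F) (f : U -> V) : linear f -> f 0 = 0.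
Proof. by move=> lf; have := lf (-1) 0 0; rewrite scaler0 addr0 scaleN1r addNr. Qed.
Lemma linD (U V : lmodType F) (f : U -> V) : linear f -> {morph f : x y / x + y}.
Proof. by move=> lf x y; have := lf 1 x y; rewrite !scale1r. Qed.
Lemma linZ (U V : lmodType F) (f : U -> V) : linear f -> forall c x, f (c *: x) = c *: f x.
Proof. by move=> lf c x; have := lf c x 0; rewrite (lin0 lf) !addr0. Qed.

Lemma alg_comp A B C (f : A -> B) (h : B -> C) :
  alg_morphism f -> alg_morphism h -> alg_morphism (h \o f).
Proof.
move=> [fl [f1 fM]] [hl [h1 hM]]; split; last split; rewrite /=.
- by move=> c x y /=; rewrite fl hl.
- by rewrite f1 h1.
- by move=> x y /=; rewrite fM hM.
Qed.

Lemma linear_comp (U V W : lmodType F) (f : U -> V) (h : V -> W) :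
  linear f -> linear h -> linear (h \o f).
Proof. by move=> fl hl c x y; rewrite /= fl hl. Qed.

Lemma alg_id A : alg_morphism (@id A).
Proof. by split. Qed.

Lemma bilin_mul A (V W : vectType F) (f : V -> A) (h : W -> A) :
  linear f -> linear h -> bilinear_map (fun x y => f x * h y).
Proof.
move=> fl hl; split=> [y c x x'|x c y y'].
  by rewrite fl mulrDl pzscaleAl.
by rewrite hl mulrDr pzscaleAr.
Qed.

Lemma linear_mull A (V : lmodType F) (f : V -> A) x :
  linear f -> linear (fun v => x * f v).
Proof. by move=> fl c u v; rewrite fl mulrDr pzscaleAr. Qed.
Lemma linear_mulr A (V : lmodType F) (f : V -> A) x :
  linear f -> linear (fun v => f v * x).
Proof. by move=> fl c u v; rewrite fl mulrDl pzscaleAl. Qed.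

Lemma mulr_tsuml A (V W : vectType F) (f : V -> W -> A) X (x : A) :
  x * (\tsum_(a, b <- X) f a b) = \tsum_(a, b <- X) x * f a b.
Proof. by apply: (linear_tsum (h := fun t => x * t)); apply: linear_mull. Qed.
Lemma mulr_tsumr A (V W : vectType F) (f : V -> W -> A) X (x : A) :
  (\tsum_(a, b <- X) f a b) * x = \tsum_(a, b <- X) f a b * x.
Proof.
pose h (t : A) := t * x.
by have hl : linear h; [exact: (linear_mulr (f := id)) | exact: (linear_tsum f X hl)].
Qed.

Lemma comm_tsum A (V W : vectType F) (f : V -> W -> A) X (x : A) :
  (forall a b, GRing.comm x (f a b)) -> GRing.comm x (\tsum_(a, b <- X) f a b).
Proof.
move=> cf; rewrite /GRing.comm mulr_tsuml mulr_tsumr.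
by apply: eq_tsum => a b; apply: cf.
Qed.

End AlgMorphisms.

Section Universal.
Variables (F : fieldType) (X : choiceType).
Variable (L : pzAlgType F).
Variable (u : X -> L).

Definition feval (w : freealg F X) : L :=
  \sum_(k <- msupp w) w@_k *: \prod_(x <- (k : seq X)) u x.

Lemma fevalEw (d : {fset {fmonom X}}) (w : freealg F X) : (msupp w `<=` d)%fset ->
  feval w = \sum_(k <- d) w@_k *: \prod_(x <- (k : seq X)) u x.
Proof.
move=> le; rewrite /feval (big_fset_incl _ le) => //= x xd /mcoeff_outdom ->.
by rewrite scale0r.
Qed.

Lemma feval_linear : linear feval.
Proof.
move=> c v w; pose d := (msupp v `|` msupp w `|` msupp (c *: v + w)%R)%fset.
have [dv dw dvw] : [/\ (msupp v `<=` d)%fset, (msupp w `<=` d)%fset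
    & (msupp (c *: v + w) `<=` d)%fset].
  split; rewrite /d ?fsubsetUr //; apply: fsubset_trans (fsubsetUl _ _);
  [exact: fsubsetUl | exact: fsubsetUr].
rewrite !(fevalEw dv, fevalEw dw, fevalEw dvw) scaler_sumr -big_split /=.
by apply: eq_bigr => k _; rewrite mcoeffD mcoeffZ scalerDl scalerA.
Qed.

Lemma fevalU c (k : {fmonom X}) :
  feval << c *g k >> = c *: \prod_(x <- (k : seq X)) u x.
Proof. by rewrite (fevalEw msuppU_le) big_seq_fset1 mcoeffUU. Qed.

Lemma feval_sum I (r : seq I) (G : I -> {malg F[{fmonom X}]}) :
  feval (\sum_(i <- r) G i) = \sum_(i <- r) feval (G i).
Proof.
apply: (big_morph feval); last exact: (lin0) feval_linear.
exact: linD feval_linear.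
Qed.

Lemma feval_morph : alg_morphism feval.
Proof.
split; first exact: feval_linear.
split=> [|v w]; first by rewrite (fevalU 1 (fmone X)) fmoneE big_nil scale1r.
rewrite malgME; etransitivity; first exact: feval_sum.
rewrite /feval mulr_suml; apply: eq_bigr => k _.
etransitivity; first exact: feval_sum.
rewrite mulr_sumr; apply: eq_bigr => l _.
by rewrite fevalU fmM big_cat -pzscaleAl -pzscaleAr scalerA.
Qed.

Lemma feval_gen x : feval (freegen F x) = u x.
Proof. by rewrite /freegen fevalU fmU big_seq1 scale1r. Qed.

Variable (E : freealg F X -> Prop).

(** Evaluating the chosen representative defines the map before anything is known about the
    relations; independence of the representative is [peval_class], once the relations evaluate to
    0. *)
Definition peval (x : presented E) : L := feval (repr (x : Quotient.quot (ideal_pred E))).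

Hypothesis evalE : forall w, E w -> feval w = 0.

Lemma peval_class w : peval (pclass E w) = feval w.
Proof.
have [fl [f1 fM]] := feval_morph.
suff h v : ideal_gen E v -> feval v = 0.
  have /h := ideal_repr E w; rewrite -scaleN1r addrC fl scaleN1r => /eqP.
  by rewrite addrC subr_eq0 => /eqP.
elim=> [{}v /evalE//||v1 v2 _ h1 _ h2|a v' b _ h'].
- exact: (lin0).
- by rewrite -scaleN1r addrC fl h1 h2 scaler0 addr0.
- by rewrite !fM h' mulr0 mul0r.
Qed.

Lemma peval_morph : alg_morphism peval.
Proof.
have [fl [f1 fM]] := feval_morph.
split; last split.
- move=> c; elim/pclass_ind => v; elim/pclass_ind => w.
  rewrite [_ *: pclass E v + _](_ : _ = pclass E (c *: v + w)).
    by rewrite !peval_class fl.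
  by rewrite pclassD pclassZ.
- by rewrite peval_class.
- elim/pclass_ind => v; elim/pclass_ind => w.
  by rewrite -[_ * _]pclassM !peval_class fM.
Qed.

Lemma peval_gen x : peval (pgen E x) = u x.
Proof. by rewrite peval_class feval_gen. Qed.

End Universal.

Section PresentedInd.
Variables (F : fieldType) (X : choiceType) (E : freealg F X -> Prop).

(** Writes each class as a noncommutative polynomial in the generators, which is what makes
    induction on words ([presented_ind]) available. *)
Lemma pclass_feval w : pclass E w = feval (L := presented E) (pgen E) w.
Proof.
have pcl : linear (pclass E) by move=> c x y; rewrite pclassD pclassZ.
have pcs (r : seq {fmonom X}) (G : {fmonom X} -> freealg F X) :
    pclass E (\sum_(i <- r) G i) = \sum_(i <- r) pclass E (G i).
  by apply: (big_morph (pclass E)); [exact: linD | exact: lin0].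
rewrite [in LHS](monalgE w) pcs; apply: eq_bigr => k _.
have -> : << w@_k *g k >> = w@_k *: << k >> :> freealg F X.
  by apply/malgP => l; rewrite mcoeffZ !mcoeffU mulrnAr mulr1.
rewrite (linZ pcl); congr (_ *: _); rewrite -[k]fmK.
elim: {k}(fmonom_val k) => [|x s ih]; first by rewrite big_nil -fmoneE.
rewrite big_cons -ih -[_ * _]pclassM; congr pclass.
rewrite /freegen malgM_def fgmulUU mulr1; congr << _ *g _ >>.
by apply/eqP; rewrite fmP fmM fmU.
Qed.

Lemma presented_ind (P : presented E -> Prop) :
  P 1 -> (forall (c : F) x y, P x -> P y -> P (c *: x + y)) ->
  (forall x y, P y -> P (pgen E x * y)) -> forall z, P z.
Proof.
move=> P1 PL PM z; have [w ->] : exists w, z = pclass E w.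
  by exists (repr (z : Quotient.quot (ideal_pred E))); rewrite pclassK.
have P0 : P 0 by have := PL (-1) 1 1 P1 P1; rewrite scaleN1r addNr.
rewrite pclass_feval /feval; elim: (enum_fset (msupp w)) => [|k r ih].
  by rewrite big_nil.
rewrite big_cons; apply: PL => //.
by elim: (fmonom_val k) => [|x s ihs]; rewrite ?big_nil // big_cons; apply: PM.
Qed.

Lemma eq_presented (L : pzAlgType F) (f h : presented E -> L) :
  alg_morphism f -> alg_morphism h -> (forall x, f (pgen E x) = h (pgen E x)) ->
  f =1 h.
Proof.
move=> [fl [f1 fM]] [hl [h1 hM]] fh; elim/presented_ind => [|c x y ex ey|x y e].
- by rewrite f1 h1.
- by rewrite fl hl ex ey.
- by rewrite fM hM fh e.
Qed.

End PresentedInd.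

(** * Convolution, the R-matrix and the antipode *)

Section Convolution.
Variables (F : fieldType) (H : hopfAlg F) (B : pzAlgType F).
Implicit Types (f g k : H -> B) (X Y : tens H H) (h x y : H).

Definition commuting f g := forall x y, GRing.comm (f x) (g y).

(** This is f ⊗ g applied to X, followed by the product of B. Legs of X acting on modules and legs
    lying in an algebra are treated alike. *)
Definition Ap X f g : B := \tsum_(a, b <- X) f a * g b.
Definition conv f g h : B := Ap (comul H h) f g.
Definition cunit h : B := (counit H h : F) *: (1 : B).

Lemma commutingC f g : commuting f g -> commuting g f.
Proof. by move=> c x y; apply/commr_sym/c. Qed.

Lemma Ap_linear f g : linear (fun X => Ap X f g).
Proof. by move=> c X Y; rewrite /Ap tsumDl. Qed.

Lemma Ap_tsum (V W : vectType F) (Y : tens V W) P Q f g :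
  linear f -> linear g ->
  Ap (\tsum_(a, b <- Y) P a b \ox Q a b) f g
  = \tsum_(a, b <- Y) f (P a b) * g (Q a b).
Proof.
move=> fl gl; rewrite (linear_tsum _ _ (@Ap_linear f g)).
by apply: eq_tsum => a b; rewrite /Ap tsum_pure //; apply: bilin_mul.
Qed.

Lemma Ap_pure x y f g : linear f -> linear g -> Ap (x \ox y) f g = f x * g y.
Proof. by move=> fl gl; rewrite /Ap tsum_pure //; apply: bilin_mul. Qed.

Lemma eq_Ap X f g f' g' : f =1 f' -> g =1 g' -> Ap X f g = Ap X f' g'.
Proof. by move=> ff gg; apply: eq_tsum => a b; rewrite ff gg. Qed.

Lemma Ap_flip X f g : linear f -> linear g -> commuting f g ->
  Ap (tflip X) f g = Ap X g f.
Proof.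
by move=> fl gl c; rewrite Ap_tsum //; apply: eq_tsum => a b; rewrite c.
Qed.

Lemma comm_Ap X f g (z : B) :
  (forall a, GRing.comm z (f a)) -> (forall a, GRing.comm z (g a)) ->
  GRing.comm z (Ap X f g).
Proof. by move=> zf zg; apply: comm_tsum => a b; apply: commrM. Qed.

Lemma Ap_mul X Y f g : alg_morphism f -> alg_morphism g -> commuting f g ->
  Ap (tmul X Y) f g = Ap X f g * Ap Y f g.
Proof.
move=> [fl [_ fM]] [gl [_ gM]] c; rewrite /tmul.
rewrite (linear_tsum _ _ (@Ap_linear f g)) [in RHS]/Ap mulr_tsumr.
apply: eq_tsum => a b; rewrite Ap_tsum // mulr_tsuml.
apply: eq_tsum => a' b'; rewrite fM gM -!mulrA; congr (_ * _).
by rewrite !mulrA c.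
Qed.

Lemma Ap1 f g : alg_morphism f -> alg_morphism g -> Ap (1 \ox 1) f g = 1.
Proof. by move=> [fl [f1 _]] [gl [g1 _]]; rewrite Ap_pure // f1 g1 mulr1. Qed.

Lemma conv_linear f g : linear (conv f g).
Proof. by move=> c x y; rewrite /conv linearP /= Ap_linear. Qed.

Lemma conv_morph f g : alg_morphism f -> alg_morphism g -> commuting f g ->
  alg_morphism (conv f g).
Proof.
move=> fm gm c; split; [exact: conv_linear | split].
  by rewrite /conv comul1 Ap1.
by move=> x y; rewrite /conv comulM -/(tmul _ _) Ap_mul.
Qed.

Lemma cunit_linear : linear cunit.
Proof. by move=> c x y; rewrite /cunit linearP scalerDl scalerA. Qed.

Lemma cunit_morph : alg_morphism cunit.
Proof.
split; [exact: cunit_linear | split; first by rewrite /cunit counit1 scale1r].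
by move=> x y; rewrite /cunit counitM -pzscaleAl mul1r scalerA.
Qed.

Lemma comm_cunit (z : B) h : GRing.comm z (cunit h).
Proof. by rewrite /GRing.comm /cunit -pzscaleAr -pzscaleAl mulr1 mul1r. Qed.

Lemma convA f g k : linear f -> linear g -> linear k ->
  conv (conv f g) k =1 conv f (conv g k).
Proof.
move=> fl gl kl h; rewrite /conv /Ap.
under eq_tsum => a b do rewrite /Ap mulr_tsumr.
under [RHS]eq_tsum => a b do rewrite /Ap mulr_tsuml.
rewrite (comulA_trilin (f := fun a b c => f a * g b * k c)).
- by apply: eq_tsum => a b; apply: eq_tsum => c d; rewrite mulrA.
- by move=> c x y b d; rewrite fl !mulrDl -!pzscaleAl.
- by move=> c x y b d; rewrite gl mulrDr mulrDl -pzscaleAr -pzscaleAl.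
- by move=> c x y b d; rewrite kl mulrDr -pzscaleAr.
Qed.

Lemma conv_unitl f : linear f -> conv cunit f =1 f.
Proof.
move=> fl h; rewrite -[in RHS](counitl h) (linear_tsum _ _ fl).
by apply: eq_tsum => a b; rewrite /cunit -pzscaleAl mul1r (linZ fl).
Qed.

Lemma conv_unitr f : linear f -> conv f cunit =1 f.
Proof.
move=> fl h; rewrite -[in RHS](counitr h) (linear_tsum _ _ fl).
by apply: eq_tsum => a b; rewrite /cunit -pzscaleAr mulr1 (linZ fl).
Qed.

Lemma eq_conv f g f' g' : f =1 f' -> g =1 g' -> conv f g =1 conv f' g'.
Proof. by move=> ff gg h; apply: eq_Ap. Qed.

(** In the convolution monoid a left inverse and a right inverse of the same element agree. *)
Lemma conv_inj f g k : linear f -> linear g -> linear k ->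
  conv f g =1 cunit -> conv g k =1 cunit -> f =1 k.
Proof.
move=> fl gl kl fg gk h; rewrite -(conv_unitr fl) -(conv_unitl kl).
by rewrite -(eq_conv (frefl f) gk) -convA //; apply: eq_conv.
Qed.

Let S : H -> H := antipode H.

Lemma antipode_linear : linear S. Proof. by move=> c x y; rewrite /S linearP. Qed.

Lemma conv_antir f : alg_morphism f -> conv f (f \o S) =1 cunit.
Proof.
move=> [fl [f1 fM]] h; rewrite /cunit -f1 -(linZ fl) -antipoder (linear_tsum _ _ fl).
by apply: eq_tsum => a b; rewrite fM.
Qed.

Lemma conv_antil f : alg_morphism f -> conv (f \o S) f =1 cunit.
Proof.
move=> [fl [f1 fM]] h; rewrite /cunit -f1 -(linZ fl) -antipodel (linear_tsum _ _ fl).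
by apply: eq_tsum => a b; rewrite fM.
Qed.

(** Both sides are convolution inverses of [conv f g]: the first by the antipode axiom for that
    morphism, the second by cancelling [g], then [f]. *)
Lemma conv_antipode f g : alg_morphism f -> alg_morphism g -> commuting f g ->
  conv f g \o S =1 conv (g \o S) (f \o S).
Proof.
move=> fm gm c; have fl := fm.1; have gl := gm.1.
have cm := conv_morph fm gm c; have cl := cm.1.
have lS (k : H -> B) : linear k -> linear (k \o S).
  exact: (linear_comp antipode_linear).
apply: (@conv_inj _ (conv f g)) => //; [exact: lS | exact: conv_linear| |].
  exact: conv_antil.
move=> h; rewrite convA //; [|exact: conv_linear].
transitivity (conv f (f \o S) h); last exact: conv_antir.
apply: eq_conv => // {}h; rewrite -convA //; [|exact: lS|exact: lS].
transitivity (conv cunit (f \o S) h); last by apply: conv_unitl; apply: lS.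
by apply: eq_conv => //; apply: conv_antir.
Qed.

Definition Ap3 (T : tens (tens H H) H) f g k : B :=
  \tsum_(p, c <- T) Ap p f g * k c.

Lemma Ap3_linear f g k : linear (fun T => Ap3 T f g k).
Proof. by move=> c T T'; rewrite /Ap3 tsumDl. Qed.

Lemma Ap3_pure f g k a b c : linear f -> linear g -> linear k ->
  Ap3 (a \ox b \ox c) f g k = f a * g b * k c.
Proof.
move=> fl gl kl; rewrite /Ap3 tsum_pure ?Ap_pure //.
by apply: bilin_mul => //; exact: Ap_linear.
Qed.

Lemma Ap3_tsum (V W V' W' : vectType F) (Y : tens V W) (Y' : V -> W -> tens V' W')
    P Q Z f g k :
  linear f -> linear g -> linear k ->
  Ap3 (\tsum_(a, b <- Y) \tsum_(c, d <- Y' a b) P a b c d \ox Q a b c d \ox Z a b c d)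
    f g k
  = \tsum_(a, b <- Y) \tsum_(c, d <- Y' a b)
      f (P a b c d) * g (Q a b c d) * k (Z a b c d).
Proof.
move=> fl gl kl; rewrite (linear_tsum _ _ (@Ap3_linear f g k)).
apply: eq_tsum => a b; rewrite (linear_tsum _ _ (@Ap3_linear f g k)).
by apply: eq_tsum => c d; rewrite Ap3_pure.
Qed.

End Convolution.

(** * Quasitriangularity and the Yang-Baxter equation for commuting morphisms *)

Section RCalculus.
Variables (F : fieldType) (H : ribbonHopf F) (B : pzAlgType F).
Implicit Types (f g k : H -> B).

(** For commuting morphisms f_1, f_2, f_3 the element [Rel] of f_i and f_j is the usual R_ij, so
    identities in the threefold tensor power of H are stated inside the single algebra B. *)
Definition Rel f g := Ap (Rmat H) f g.

Lemma Rel_convl f g k : linear f -> linear g -> alg_morphism k ->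
  commuting g k -> Rel (conv f g) k = Rel f k * Rel g k.
Proof.
move=> fl gl [kl [_ kM]] c.
have := congr1 (fun T => Ap3 T f g k) (Rmat_comull H); rewrite !Ap3_tsum // => e.
transitivity (\tsum_(a, b <- Rmat H) \tsum_(a1, a2 <- comul H a) f a1 * g a2 * k b).
  by apply: eq_tsum => a b; rewrite /conv /Ap mulr_tsumr.
rewrite e /Rel [in RHS]/Ap mulr_tsumr; apply: eq_tsum => a b.
rewrite mulr_tsuml; apply: eq_tsum => a' b'; rewrite kM -!mulrA; congr (_ * _).
by rewrite !mulrA c.
Qed.

Lemma Rel_convr f g k : linear f -> linear g -> alg_morphism k ->
  commuting f g -> commuting g k -> Rel k (conv f g) = Rel k g * Rel k f.
Proof.
move=> fl gl [kl [_ kM]] cfg cgk.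
have := congr1 (fun T => Ap3 T k f g) (Rmat_comulr H); rewrite !Ap3_tsum // => e.
transitivity (\tsum_(a, b <- Rmat H) \tsum_(b1, b2 <- comul H b) k a * f b1 * g b2).
  apply: eq_tsum => a b; rewrite /conv /Ap mulr_tsuml.
  by apply: eq_tsum => *; rewrite mulrA.
rewrite e /Rel [in RHS]/Ap mulr_tsumr; apply: eq_tsum => a b.
rewrite mulr_tsuml; apply: eq_tsum => a' b'; rewrite kM -!mulrA; congr (_ * _).
by rewrite cfg mulrA -cgk mulrA.
Qed.

Lemma Rel_intertwine f g h : alg_morphism f -> alg_morphism g -> commuting f g ->
  Rel f g * conv f g h = conv g f h * Rel f g.
Proof.
move=> fm gm c; rewrite -Ap_mul // Rmat_comul Ap_mul //; congr (_ * _).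
by rewrite Ap_flip //; [case: fm|case: gm].
Qed.

Lemma comm_Rel f g (z : B) :
  (forall a, GRing.comm z (f a)) -> (forall a, GRing.comm z (g a)) ->
  GRing.comm z (Rel f g).
Proof. exact: comm_Ap. Qed.

(** R_13 R_23 is R with its first leg comultiplied; moving R_12 across it flips the coproduct, which
    gives R_23 R_13. *)
Lemma YBE f g k : alg_morphism f -> alg_morphism g -> alg_morphism k ->
  commuting f g -> commuting f k -> commuting g k ->
  Rel f g * Rel f k * Rel g k = Rel g k * Rel f k * Rel f g.
Proof.
move=> fm gm km fg fk gk; have [fl _] := fm; have [gl _] := gm.
rewrite -mulrA -Rel_convl // -Rel_convl // [Rel (conv f g) k]/Rel [Rel (conv g f) k]/Rel /Ap.
rewrite mulr_tsuml mulr_tsumr; apply: eq_tsum => a b.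
rewrite mulrA Rel_intertwine // -!mulrA; congr (_ * _).
by apply/commr_sym/comm_Rel => x; apply/commr_sym; [apply: fk|apply: gk].
Qed.

End RCalculus.

(** * Antimultiplicativity of the antipode *)

Section Antipode.
Variables (F : fieldType) (H : hopfAlg F).
Implicit Types (x y z : H).

Local Notation S := (antipode H).

Lemma antipode1 : S 1 = 1.
Proof.
have := antipodel (1 : H); rewrite comul1 counit1 scale1r tsum_pure ?mulr1 //.
by apply: (@bilin_mul _ H) => // c x y; rewrite linearP.
Qed.

Lemma antipodeM x y : S (x * y) = S y * S x.
Proof.
(* Summed over x, this is S(x_1 y_1) x_2 y_2 S(y_3) S(x_3). Cancelling S(x_1 y_1) against x_2 y_2
   leaves S(y) S(x) ([E1]); cancelling y_2 S(y_3), then x_2 S(x_3), leaves S(x y). *)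
pose f a b c := \tsum_(y', y3 <- comul H y) \tsum_(y1, y2 <- comul H y')
  (S (a * y1) * (b * (y2 * (S y3 * S c)))).
have E1 : \tsum_(x', x3 <- comul H x) \tsum_(x1, x2 <- comul H x') f x1 x2 x3
    = S y * S x.
  transitivity (\tsum_(x', x3 <- comul H x) \tsum_(y', y3 <- comul H y)
      ((counit H x' * counit H y') *: (S y3 * S x3))).
    apply: eq_tsum => x' x3; rewrite tsum_exchange; apply: eq_tsum => y' y3.
    rewrite -[in RHS](mul1r (S y3 * S x3)) scalerAl -counitM -antipodel.
    rewrite (comul_mul_tsum (f := fun a b => S a * b)); last first.
      by apply: (@bilin_mul _ H) => // c u v; rewrite linearP.
    rewrite (mulr_tsumr (A := H)); apply: eq_tsum => x1 x2.
    rewrite (mulr_tsumr (A := H)); apply: eq_tsum => y1 y2.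
    by rewrite !mulrA.
  rewrite -[in RHS](counitl x) linear_tsum => [|c u v]; last by rewrite linearP.
  rewrite (mulr_tsuml (A := H)); apply: eq_tsum => a b.
  rewrite -[in RHS](counitl y) linear_tsum => [|c u v]; last by rewrite linearP.
  rewrite (mulr_tsumr (A := H)); apply: eq_tsum => a' b'.
  by rewrite !linearZ /= -scalerAl -scalerAr scalerA mulrC.
rewrite -E1 comulA_trilin; first last.
- move=> c u v b d; apply: tsumDr => y' y3; apply: tsumDr => y1 y2.
  by rewrite linearP !mulrDr -!scalerAr.
- move=> c u v b d; apply: tsumDr => y' y3; apply: tsumDr => y1 y2.
  by rewrite !mulrDl mulrDr -!scalerAl -scalerAr.
- move=> c u v b d; apply: tsumDr => y' y3; apply: tsumDr => y1 y2.
  by rewrite !mulrDl -scalerAl linearP mulrDl -scalerAl.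
transitivity (\tsum_(x1, x' <- comul H x) (counit H x' *: S (x1 * y))).
  rewrite -[in LHS](counitr x) (mulr_tsumr (A := H)).
  rewrite linear_tsum => [|c u v]; last by rewrite linearP.
  by apply: eq_tsum => a b; rewrite -scalerAl linearZ.
apply: eq_tsum => x1 x'; rewrite /f; symmetry.
transitivity (\tsum_(x2, x3 <- comul H x') \tsum_(y1, y' <- comul H y)
    \tsum_(y2, y3 <- comul H y') (S (x1 * y1) * (x2 * (y2 * S y3 * S x3)))).
  apply: eq_tsum => x2 x3.
  rewrite comulA_trilin; first by do 2!apply: eq_tsum => ? ?; rewrite !mulrA.
  - by move=> c u v b d; rewrite mulrDr -scalerAr linearP mulrDl -scalerAl.
  - by move=> c u v b d; rewrite !mulrDl !mulrDr -!scalerAl -!scalerAr.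
  - move=> c u v b d; rewrite linearP !mulrDl !mulrDr.
    by rewrite -!scalerAl -!scalerAr.
transitivity (\tsum_(x2, x3 <- comul H x') \tsum_(y1, y' <- comul H y)
    (counit H y' *: (S (x1 * y1) * (x2 * S x3)))).
  apply: eq_tsum => x2 x3; apply: eq_tsum => y1 y'.
  transitivity (S (x1 * y1) * (x2 * (counit H y' *: 1 * S x3))).
    rewrite -antipoder (mulr_tsumr (A := H)) !(mulr_tsuml (A := H)).
    by apply: eq_tsum => a b.
  by rewrite -scalerAl mul1r -!scalerAr.
transitivity (\tsum_(x2, x3 <- comul H x') (S (x1 * y) * (x2 * S x3))).
  apply: eq_tsum => x2 x3; rewrite -[in RHS](counitr y) (mulr_tsuml (A := H)).
  rewrite linear_tsum => [|c u v]; last by rewrite linearP.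
  rewrite (mulr_tsumr (A := H)); apply: eq_tsum => a b.
  by rewrite -scalerAr linearZ -scalerAl.
transitivity (S (x1 * y) * (\tsum_(x2, x3 <- comul H x') x2 * S x3)).
  by rewrite (mulr_tsuml (A := H)).
by rewrite antipoder -scalerAr mulr1.
Qed.

End Antipode.

(** * The Drinfeld element, invertibility of the antipode, and the inverse of R *)

Section RInverse.
Variables (F : fieldType) (H : ribbonHopf F).
Implicit Types (x y z : H).

Local Notation S := (antipode H).
Local Notation Si := (antipode_inv H).

Lemma Rmat_comulr_trilin (U : lmodType F) (f : H -> H -> H -> U) :
  (forall c (x y b d : H), f (c *: x + y) b d = c *: f x b d + f y b d) ->
  (forall c (x y b d : H), f b (c *: x + y) d = c *: f b x d + f b y d) ->
  (forall c (x y b d : H), f b d (c *: x + y) = c *: f b d x + f b d y) ->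
  \tsum_(a, b <- Rmat H) \tsum_(b1, b2 <- comul H b) f a b1 b2
  = \tsum_(a, b <- Rmat H) \tsum_(c, d <- Rmat H) f (a * c) d b.
Proof.
move=> f1 f2 f3.
pose Phi (T : tens (tens H H) H) : U := \tsum_(p, c <- T) \tsum_(a, b <- p) f a b c.
have PhiL : linear Phi by move=> c x y; exact: tsumDl.
have PhiP a b c : Phi (a \ox b \ox c) = f a b c.
  rewrite /Phi tsum_pure; first by rewrite tsum_pure //; split=> ? c0 x y /=.
  split=> [y|p] c0 u v /=; first exact: tsumDl.
  by apply: tsumDr => a' b'; exact: f3.
have := congr1 Phi (Rmat_comulr H); rewrite !linear_tsum // => e.
transitivity (\tsum_(a, b <- Rmat H)
    Phi (\tsum_(b1, b2 <- comul H b) a \ox b1 \ox b2)).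
  by apply: eq_tsum => a b; rewrite linear_tsum //; apply: eq_tsum => *; rewrite PhiP.
rewrite e; apply: eq_tsum => a b; rewrite linear_tsum //.
by apply: eq_tsum => *; rewrite PhiP.
Qed.

Let u := \tsum_(a, b <- Rmat H) S b * a.

(** Apply a ⊗ b |-> S^2(x'') S(b) a to both sides of R Delta(x') = Delta^op(x') R. On the left
    S^2(x_3) S(x_2) = S(x_2 S(x_3)) collapses and leaves u x; on the right S(x_1) x_2 collapses and
    leaves S^2(x) u. *)
Lemma drinfeld_intertwine x : u * x = S (S x) * u.
Proof.
pose Phi z (X : tens H H) := \tsum_(a, b <- X) S (S z) * (S b * a).
have PhiL z : linear (Phi z) by move=> c X Y; exact: tsumDl.
have PhiP z a b : Phi z (a \ox b) = S (S z) * (S b * a).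
  rewrite /Phi tsum_pure //; split=> [y|y] c v w.
    by rewrite !mulrDr -!scalerAr.
  by rewrite linearP mulrDl mulrDr -scalerAl -scalerAr.
transitivity (\tsum_(p, z <- comul H x) Phi z (tmul (Rmat H) (comul H p))).
  transitivity (\tsum_(p, z <- comul H x) \tsum_(p1, p2 <- comul H p)
      S (S z) * S p2 * u * p1); last first.
    apply: eq_tsum => p z; rewrite /tmul (linear_tsum _ _ (PhiL z)).
    under [RHS]eq_tsum => a b do rewrite (linear_tsum _ _ (PhiL z)).
    rewrite tsum_exchange; apply: eq_tsum => p1 p2.
    rewrite /u (mulr_tsuml (A := H)) (mulr_tsumr (A := H)).
    by apply: eq_tsum => a b; rewrite PhiP antipodeM !mulrA.
  rewrite comulA_trilin; first last.
  - move=> c v w b d; rewrite !linearP !mulrDl -!scalerAl //.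
  - by move=> c v w b d; rewrite linearP mulrDr !mulrDl -scalerAr -!scalerAl.
  - by move=> c v w b d; rewrite mulrDr -scalerAr.
  rewrite -[in LHS](counitr x) (mulr_tsuml (A := H)); apply: eq_tsum => p1 p'.
  transitivity (S (counit H p' *: 1) * u * p1).
    by rewrite (linZ (@antipode_linear F H)) antipode1 -!scalerAl mul1r -scalerAr.
  rewrite -antipoder (linear_tsum _ _ (@antipode_linear F H)).
  rewrite !(mulr_tsumr (A := H)); apply: eq_tsum => p2 z.
  by rewrite antipodeM.
under eq_tsum => p z do rewrite Rmat_comul.
transitivity (\tsum_(p, z <- comul H x) \tsum_(p1, p2 <- comul H p)
    \tsum_(a, b <- Rmat H) S (S z) * S b * (S p1 * p2) * a).
  apply: eq_tsum => p z; rewrite /tmul (linear_tsum _ _ (PhiL z)) /tflip.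
  have tl : linear (fun X : tens H H => \tsum_(a, b <- X)
      Phi z (\tsum_(c, d <- Rmat H) (a * c) \ox (b * d))).
    by move=> c X Y; rewrite tsumDl.
  rewrite (linear_tsum _ _ tl); apply: eq_tsum => p1 p2; rewrite tsum_pure.
    rewrite (linear_tsum _ _ (PhiL z)); apply: eq_tsum => a b.
    by rewrite PhiP antipodeM !mulrA.
  split=> [y|y] c v w; rewrite !(linear_tsum _ _ (PhiL z)); apply: tsumDr => a b.
    by rewrite mulrDl -scalerAl pureDl PhiL.
  by rewrite mulrDl -scalerAl pureDr PhiL.
transitivity (\tsum_(p, z <- comul H x) (counit H p *: (S (S z) * u))).
  apply: eq_tsum => p z; rewrite tsum_exchange /u (mulr_tsuml (A := H)).
  rewrite (linear_tsum (h := fun t : H => counit H p *: t)) => [|c v w]; last first.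
    by rewrite scalerDr !scalerA mulrC.
  apply: eq_tsum => a b.
  transitivity (S (S z) * S b * (\tsum_(p1, p2 <- comul H p) S p1 * p2) * a).
    by rewrite (mulr_tsuml (A := H)) (mulr_tsumr (A := H)).
  by rewrite antipodel -scalerAr -scalerAl mulr1 mulrA.
rewrite -[in RHS](counitl x) !(linear_tsum _ _ (@antipode_linear F H)).
rewrite (mulr_tsumr (A := H)); apply: eq_tsum => a b.
by rewrite !(linZ (@antipode_linear F H)) -scalerAl.
Qed.

(* The Drinfeld element u is invertible because v ^ 2 = u S(u) is.            *)
Lemma antipode_inj : lker S == 0%VS.
Proof.
have [w uw1] : exists w, u * w = 1.
  exists (S u * (ribbon H * ribbon H)^-1); rewrite mulrA -ribbon_sqr mulrV //.
  by rewrite unitrMl ?ribbon_unit.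
(* As [u * w = 1], left multiplication by [w] is injective, hence bijective in finite dimension, and
   [w] is also a left inverse of [u]. *)
have kw : lker (amull w) == 0%VS.
  apply/lker0P => x y; rewrite !lfunE /= => e.
  by rewrite -[x]mul1r -[y]mul1r -uw1 -!mulrA e.
have wu1 : w * u = 1.
  have := lker0_lfunVK kw 1; rewrite lfunE /= => e.
  by rewrite -[w * u]mulr1 -[X in _ * X]e -mulrA [u * _]mulrA uw1 mul1r.
apply/lker0P => x y e; rewrite -[x]mul1r -[y]mul1r -wu1 -!mulrA.
by rewrite !drinfeld_intertwine e.
Qed.

Lemma antipodeK : cancel S Si. Proof. exact: lker0_lfunK antipode_inj. Qed.
Lemma antipodeVK : cancel Si S. Proof. exact: lker0_lfunVK antipode_inj. Qed.

Lemma antipode_invM x y : Si (x * y) = Si y * Si x.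
Proof.
by apply: (can_inj antipodeK); rewrite antipodeM !antipodeVK.
Qed.

Lemma antipode_inv1 : Si 1 = 1.
Proof. by apply: (can_inj antipodeK); rewrite antipodeVK antipode1. Qed.

Lemma antipode_inv_linear : linear Si. Proof. by move=> c x y; rewrite linearP. Qed.

Lemma antipode_invl x :
  \tsum_(a, b <- comul H x) Si b * a = (counit H x : F) *: (1 : H).
Proof.
have -> : (counit H x : F) *: (1 : H) = Si (counit H x *: 1).
  by rewrite (linZ antipode_inv_linear) antipode_inv1.
rewrite -antipodel (linear_tsum _ _ antipode_inv_linear).
by apply: eq_tsum => a b; rewrite antipode_invM antipodeK.
Qed.

Variable (B : pzAlgType F).
Implicit Types (f g k : H -> B).

Definition Rinv f g := Rel f (g \o Si).

Lemma Rinv_Ap f g : linear f -> linear g ->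
  Rinv f g = Ap (\tsum_(a, b <- Rmat H) a \ox Si b) f g.
Proof. by move=> fl gl; rewrite Ap_tsum. Qed.

Lemma Rel_unit f g : alg_morphism f -> alg_morphism g -> commuting f g ->
  exists Q, Rel f g * Q = 1 /\ Q * Rel f g = 1.
Proof.
move=> fm gm c; have [Q [RQ QR]] := Rmat_inv H.
by exists (Ap Q f g); rewrite -!Ap_mul // RQ QR Ap1.
Qed.

Lemma Rel_cunitl g : alg_morphism g -> Rel (cunit B) g = 1.
Proof.
move=> gm; set e := Rel _ _.
have cm := @cunit_morph _ H B; have cl := cm.1.
have cg : commuting (@cunit _ H B) g by move=> x y; apply/commr_sym/comm_cunit.
have [Q [eQ _]] := Rel_unit cm gm cg.
(* The counit is idempotent for convolution, so [e] is an invertible idempotent, that is 1. *)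
have ee : e = e * e.
  rewrite -Rel_convl //; apply: eq_Ap => // h.
  by rewrite conv_unitl.
by rewrite -eQ -/e [in RHS]ee -mulrA eQ mulr1.
Qed.

Lemma Rel_cunitr g : alg_morphism g -> Rel g (cunit B) = 1.
Proof.
move=> gm; set e := Rel _ _.
have cm := @cunit_morph _ H B; have cl := cm.1.
have cg : commuting (@cunit _ H B) g by move=> x y; apply/commr_sym/comm_cunit.
have cc : commuting (@cunit _ H B) (cunit B) by move=> x y; exact: comm_cunit.
have [Q [eQ _]] := Rel_unit gm cm (commutingC cg).
have ee : e = e * e.
  rewrite -Rel_convr //; apply: eq_Ap => // h.
  by rewrite conv_unitl.
by rewrite -eQ -/e [in RHS]ee -mulrA eQ mulr1.
Qed.

(** Comultiplying the second leg of R gives R_13 R_12, and S^(-1)(b'') b' is the counit of b; this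
    makes [Rinv f g] a left inverse. It is two-sided because R is invertible. *)
Lemma RinvP f g : alg_morphism f -> alg_morphism g -> commuting f g ->
  Rinv f g * Rel f g = 1 /\ Rel f g * Rinv f g = 1.
Proof.
move=> fm gm c; have [fl [f1 fM]] := fm; have [gl [g1 gM]] := gm.
suff VR : Rinv f g * Rel f g = 1.
  have [Q [RQ _]] := Rel_unit fm gm c; split=> //.
  by have -> : Rinv f g = Q by rewrite -[LHS]mulr1 -RQ mulrA VR mul1r.
rewrite /Rinv /Rel /Ap mulr_tsumr.
transitivity (\tsum_(a, b <- Rmat H) \tsum_(c, d <- Rmat H)
    f (a * c) * g (Si b * d)).
  apply: eq_tsum => a b; rewrite mulr_tsuml; apply: eq_tsum => a' b' /=.
  by rewrite fM gM -!mulrA; congr (_ * _); rewrite !mulrA c.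
rewrite -(Rmat_comulr_trilin (f := fun a b1 b2 => f a * g (Si b2 * b1))).
- rewrite -(Rel_cunitr fm); apply: eq_tsum => a b.
  rewrite -mulr_tsuml -(linear_tsum _ _ gl); congr (_ * _).
  by rewrite /cunit -g1 -(linZ gl) antipode_invl.
- by move=> k x y b d; rewrite fl mulrDl pzscaleAl.
- by move=> k x y b d; rewrite mulrDr -scalerAr gl mulrDr -pzscaleAr.
- by move=> k x y b d; rewrite linearP mulrDl -scalerAl gl mulrDr -pzscaleAr.
Qed.

(* Allows one to separate the two factors of M_1 R' M_2, see uncross.         *)
Lemma Rel_crossed f g : alg_morphism f -> alg_morphism g ->
  \tsum_(c, d <- Rmat H) \tsum_(a, b <- Rmat H) f (c * a) * g (b * S d) = 1.
Proof.
move=> fm gm; have [fl [f1 fM]] := fm; have [gl [g1 gM]] := gm.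
rewrite -(Rmat_comulr_trilin (f := fun a b1 b2 => f a * g (b1 * S b2))).
- rewrite -(Rel_cunitr fm); apply: eq_tsum => a b.
  rewrite -mulr_tsuml -(linear_tsum _ _ gl); congr (_ * _).
  by rewrite /cunit -g1 -(linZ gl) antipoder.
- by move=> k x y b d; rewrite fl mulrDl pzscaleAl.
- by move=> k x y b d; rewrite mulrDl -scalerAl gl mulrDr -pzscaleAr.
- by move=> k x y b d; rewrite linearP mulrDr -scalerAr gl mulrDr -pzscaleAr.
Qed.

End RInverse.

(** * Matrices over an algebra and systems satisfying the graph relations *)

Section MatrixAlgebra.
Variables (F : fieldType) (L : pzAlgType F).

(** The alias carries the entrywise scaling by F, as opposed to the scaling of matrices by L, so
    that matrices over L are again a possible target B of [Ap] and [Rel]. *)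
Definition amat d := 'M[L]_d.
HB.instance Definition _ d := GRing.PzRing.copy (amat d) 'M[L]_d.

Definition mscale d (c : F) (M : amat d) : amat d := map_mx (fun x : L => c *: x) M.

Fact mscaleA d c1 c2 (M : amat d) : mscale c1 (mscale c2 M) = mscale (c1 * c2) M.
Proof. by apply/matrixP => i j; rewrite !mxE scalerA. Qed.
Fact mscale1 d : left_id 1 (@mscale d).
Proof. by move=> M; apply/matrixP => i j; rewrite !mxE scale1r. Qed.
Fact mscaleDr d : right_distributive (@mscale d) +%R.
Proof. by move=> c M N; apply/matrixP => i j; rewrite !mxE scalerDr. Qed.
Fact mscaleDl d (M : amat d) c1 c2 : mscale (c1 + c2)%R M = mscale c1 M + mscale c2 M.
Proof. by apply/matrixP => i j; rewrite !mxE scalerDl. Qed.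
Fact mscaleAl d c (M N : amat d) : mscale c (M * N) = mscale c M * N.
Proof.
apply/matrixP => i j; rewrite !mxE scaler_sumr; apply: eq_bigr => k _.
by rewrite !mxE pzscaleAl.
Qed.
Fact mscaleAr d c (M N : amat d) : mscale c (M * N) = M * mscale c N.
Proof.
apply/matrixP => i j; rewrite !mxE scaler_sumr; apply: eq_bigr => k _.
by rewrite !mxE pzscaleAr.
Qed.

HB.instance Definition _ d := PzRing_isPzAlg.Build F (amat d) (@mscaleA d)
  (@mscale1 d) (@mscaleDr d) (@mscaleDl d) (@mscaleAl d) (@mscaleAr d).

HB.instance Definition _ d := GRing.Zmodule_isLmodule.Build F (amat d)
  (@mscaleA d) (@mscale1 d) (@mscaleDr d) (fun M c1 c2 => mscaleDl M c1 c2).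

Lemma amatZE d (c : F) (M : amat d) i j : (c *: M) i j = c *: M i j.
Proof. by rewrite mxE. Qed.

Definition mlift d (x : L) : amat d := x%:M.
Definition msc d (M : 'M[F]_d) : amat d := map_mx (fun c : F => c *: (1 : L)) M.

Lemma mlift_morph d : alg_morphism (@mlift d).
Proof.
split; last split.
- by move=> c x y; apply/matrixP => i j; rewrite !mxE mulrnDl scalerMnr.
- by [].
- by move=> x y; rewrite /mlift scalar_mxM.
Qed.

Lemma msc_linear d (V : lmodType F) (r : V -> 'M[F]_d) :
  linear r -> linear (fun x => msc (r x)).
Proof.
by move=> rl c x y; apply/matrixP => i j; rewrite rl !mxE scalerDl scalerA.
Qed.

Lemma msc1 d : msc (1%:M : 'M_d) = 1.
Proof. by apply/matrixP => i j; rewrite !mxE; case: eqP; rewrite ?scale1r ?scale0r. Qed.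

Lemma mscM d (M N : 'M[F]_d) : msc (M *m N) = msc M * msc N.
Proof.
apply/matrixP => i j; rewrite !mxE scaler_suml; apply: eq_bigr => k _.
by rewrite !mxE -pzscaleAl mul1r scalerA.
Qed.

Lemma mscE d (M : 'M[F]_d) i j (x : L) : GRing.comm x (msc M i j).
Proof. by rewrite !mxE /GRing.comm -pzscaleAr -pzscaleAl mulr1 mul1r. Qed.

Lemma comm_lift d (x : L) (M : amat d) :
  (forall i j, GRing.comm x (M i j)) <-> GRing.comm (mlift d x) M.
Proof.
split=> [c|/matrixP c i j].
  apply/matrixP => i j; rewrite -[_ * _]/(_ *m _) -[M * _]/(_ *m _) mul_scalar_mx.
  rewrite !mxE (bigD1 j) //= big1 => [|k nk]; rewrite !mxE ?eqxx ?addr0; first exact: c.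
  by rewrite (negPf nk) mulr0.
have := c i j; rewrite -[_ * M]/(_ *m _) -[M * _]/(_ *m _) mul_scalar_mx.
rewrite !mxE (bigD1 j) //= big1 => [|k nk]; rewrite !mxE ?eqxx ?addr0 //.
by rewrite (negPf nk) mulr0.
Qed.

Lemma comm_lift_sc d x (M : 'M[F]_d) : GRing.comm (mlift d x) (msc M).
Proof. by apply/comm_lift => i j; apply: mscE. Qed.

Section Slots.
Variables d e : nat.

Definition slot1 (M : amat d) : amat (d * e) := mx1 e M.
Definition slot2 (M : amat e) : amat (d * e) := mx2 d M.

Lemma sum_mxtens (V : nmodType) (G : 'I_(d * e) -> V) :
  \sum_k G k = \sum_i \sum_j G (mxtens_index (i, j)).
Proof.
rewrite pair_bigA (reindex (@mxtens_index d e)) /=; last first.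
  exists (@mxtens_unindex d e) => k _; [exact: mxtens_indexK | exact: mxtens_unindexK].
by apply: eq_bigr => -[].
Qed.

Lemma amat_slotP (M N : amat (d * e)) :
  (forall i1 i2 j1 j2, M (mxtens_index (i1, i2)) (mxtens_index (j1, j2))
    = N (mxtens_index (i1, i2)) (mxtens_index (j1, j2))) -> M = N.
Proof.
move=> MN; apply/matrixP => i j; case: (mxtens_indexP i) => i1 i2.
by case: (mxtens_indexP j) => j1 j2.
Qed.

Lemma slot1E M i1 i2 j1 j2 :
  slot1 M (mxtens_index (i1, i2)) (mxtens_index (j1, j2)) = M i1 j1 *+ (i2 == j2).
Proof. by rewrite /slot1 /mx1 tensmxE mxE mulr_natr. Qed.

Lemma slot2E M i1 i2 j1 j2 :
  slot2 M (mxtens_index (i1, i2)) (mxtens_index (j1, j2)) = M i2 j2 *+ (i1 == j1).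
Proof. by rewrite /slot2 /mx2 tensmxE mxE mulr_natl. Qed.

Lemma mxtens_index_eq (i1 j1 : 'I_d) (i2 j2 : 'I_e) :
  (mxtens_index (i1, i2) == mxtens_index (j1, j2)) = (i1 == j1) && (i2 == j2).
Proof. by rewrite (can_eq (@mxtens_indexK _ _)) xpair_eqE. Qed.

Lemma slot1_lift x : slot1 (mlift d x) = mlift (d * e) x.
Proof.
apply: amat_slotP => *; rewrite slot1E !mxE mxtens_index_eq.
by do 2!case: eqP.
Qed.

Lemma slot2_lift x : slot2 (mlift e x) = mlift (d * e) x.
Proof.
apply: amat_slotP => *; rewrite slot2E !mxE mxtens_index_eq.
by do 2!case: eqP.
Qed.

Lemma slot1_morph : alg_morphism slot1.
Proof.
split; last split.
- move=> c M N; apply: amat_slotP => i1 i2 j1 j2.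
  rewrite slot1E [in RHS]mxE amatZE !slot1E !mxE mulrnDl.
  by rewrite scalerMnr.
- exact: slot1_lift.
- move=> M N; apply: amat_slotP => i1 i2 j1 j2.
  rewrite slot1E -[_ * _]/(_ *m _) -[slot1 M * _]/(_ *m _) !mxE sum_mxtens -sumrMnl.
  apply: eq_bigr => k _; rewrite (bigD1 i2) //= big1 => [|l nl]; rewrite !slot1E.
    by rewrite eqxx addr0 mulrnAr.
  by rewrite eq_sym (negPf nl) mul0r.
Qed.

Lemma slot2_morph : alg_morphism slot2.
Proof.
split; last split.
- move=> c M N; apply: amat_slotP => i1 i2 j1 j2.
  rewrite slot2E [in RHS]mxE amatZE !slot2E !mxE mulrnDl.
  by rewrite scalerMnr.
- exact: slot2_lift.
- move=> M N; apply: amat_slotP => i1 i2 j1 j2.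
  rewrite slot2E -[_ * _]/(_ *m _) -[slot2 M * _]/(_ *m _) !mxE sum_mxtens -sumrMnl.
  rewrite exchange_big /=.
  apply: eq_bigr => k _; rewrite (bigD1 i1) //= big1 => [|l nl]; rewrite !slot2E.
    by rewrite eqxx addr0 mulrnAr.
  by rewrite eq_sym (negPf nl) mul0r.
Qed.

Lemma mul_slotE M N i1 i2 j1 j2 :
  (slot1 M * slot2 N) (mxtens_index (i1, i2)) (mxtens_index (j1, j2))
  = M i1 j1 * N i2 j2.
Proof.
rewrite -[_ * _]/(_ *m _) mxE sum_mxtens (bigD1 j1) //= (bigD1 i2) //= !slot1E !slot2E.
rewrite !eqxx !mulr1n big1 => [|l nl]; last by rewrite slot1E eq_sym (negPf nl) mul0r.
rewrite addr0 big1 ?addr0 // => k nk; apply: big1 => l _.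
by rewrite slot2E (negPf nk) mulr0.
Qed.

Lemma mul_slotVE M N i1 i2 j1 j2 :
  (slot2 N * slot1 M) (mxtens_index (i1, i2)) (mxtens_index (j1, j2))
  = N i2 j2 * M i1 j1.
Proof.
rewrite -[_ * _]/(_ *m _) mxE sum_mxtens (bigD1 i1) //= (bigD1 j2) //= !slot1E !slot2E.
rewrite !eqxx !mulr1n big1 => [|l nl]; last by rewrite slot1E (negPf nl) mulr0.
rewrite addr0 big1 ?addr0 // => k nk; apply: big1 => l _.
by rewrite slot2E eq_sym (negPf nk) mul0r.
Qed.

(** Passes between commutation of all entries of two matrices and one equation M_1 N_2 = N_2 M_1,
    the form in which the graph relations speak of commutation. *)
Lemma comm_slots (M : amat d) (N : amat e) :
  (forall i j k l, GRing.comm (M i j) (N k l)) <-> GRing.comm (slot1 M) (slot2 N).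
Proof.
split=> [c|/matrixP c i j k l].
  by apply: amat_slotP => *; rewrite mul_slotE mul_slotVE c.
have := c (mxtens_index (i, k)) (mxtens_index (j, l)).
by rewrite mul_slotE mul_slotVE.
Qed.

Lemma msc_tens (M : 'M[F]_d) (N : 'M[F]_e) :
  msc (tensmx M N) = slot1 (msc M) * slot2 (msc N).
Proof.
apply: amat_slotP => *; rewrite mul_slotE !mxE !mxtens_indexK /=.
by rewrite -pzscaleAl mul1r scalerA.
Qed.

End Slots.
End MatrixAlgebra.

Arguments slot1 {F L d} e M.
Arguments slot2 {F L} d {e} M.

Section MatrixMap.
Variables (F : fieldType) (L L' : pzAlgType F) (f : L -> L').
Hypothesis fm : alg_morphism f.

Definition mmap_amat d (M : amat L d) : amat L' d := map_mx f M.

Lemma mmap_amat_morph d : alg_morphism (@mmap_amat d).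
Proof.
have [fl [f1 fM]] := fm; split; last split.
- by move=> c M N; apply/matrixP => i j; rewrite !mxE fl.
- by apply/matrixP => i j; rewrite !mxE; case: eqP; rewrite ?f1 ?(lin0 fl).
- move=> M N; apply/matrixP => i j; rewrite !mxE.
  rewrite (big_morph f (linD fl) (lin0 fl)); apply: eq_bigr => k _.
  by rewrite !mxE fM.
Qed.

Lemma mmap_lift d x : mmap_amat (mlift d x) = mlift d (f x).
Proof.
have [fl _] := fm.
by apply/matrixP => i j; rewrite !mxE; case: eqP; rewrite ?(lin0 fl).
Qed.

Lemma mmap_sc d (M : 'M[F]_d) : mmap_amat (msc L M) = msc L' M.
Proof.
have [fl [f1 _]] := fm.
by apply/matrixP => i j; rewrite !mxE (linZ fl) f1.
Qed.

Lemma mmap_slot1 d e (M : amat L d) :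
  mmap_amat (slot1 e M) = slot1 e (mmap_amat M).
Proof.
have [fl _] := fm; apply: amat_slotP => i1 i2 j1 j2.
by rewrite mxE !slot1E mxE; case: eqP; rewrite ?mulr0n ?(lin0 fl).
Qed.

Lemma mmap_slot2 d e (M : amat L e) :
  mmap_amat (slot2 d M) = slot2 d (mmap_amat M).
Proof.
have [fl _] := fm; apply: amat_slotP => i1 i2 j1 j2.
by rewrite mxE !slot2E mxE; case: eqP; rewrite ?mulr0n ?(lin0 fl).
Qed.

End MatrixMap.

Arguments mmap_amat {F L L'} f {d} M.

Lemma ncinvmxE (A : pzRingType) d (M N : 'M[A]_d) :
  M *m N = 1%:M -> N *m M = 1%:M -> ncinvmx M = N.
Proof.
move=> MN NM; rewrite /ncinvmx; case: xgetP => [P _ [MP PM]|/(_ N) []//].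
by rewrite -[P]mulmx1 -MN mulmxA PM mul1mx.
Qed.

(** * The graph relations for linear maps on the dual of H, and the universal property *)

Section GraphSystem.
Variables (F : fieldType) (H : ribbonHopf F).
Local Notation dual := 'Hom(hopf_sort H, F^o).

Section OneAlgebra.
Variable L : pzAlgType F.
Implicit Types (I J : hmod H) (u : dual -> L).

Definition scal I (h : H) : amat L (mdim I) := msc L (mrep I h).
Definition scal1 I J (h : H) : amat L (mdim I * mdim J) := slot1 (mdim J) (scal I h).
Definition scal2 I J (h : H) : amat L (mdim I * mdim J) := slot2 (mdim I) (scal J h).
Definition genmx u I : amat L (mdim I) := map_mx u (Tmx I).

Lemma scal_morph I : alg_morphism (scal I).
Proof.
split; last split.
- by apply: msc_linear => c x y; rewrite linearP.
- by rewrite /scal mrep1 msc1.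
- by move=> x y; rewrite /scal mrepM mscM.
Qed.

Lemma scal1_morph I J : alg_morphism (scal1 I J).
Proof. by apply: (alg_comp (scal_morph I)); apply: slot1_morph. Qed.
Lemma scal2_morph I J : alg_morphism (scal2 I J).
Proof. by apply: (alg_comp (scal_morph J)); apply: slot2_morph. Qed.

Lemma comm_scal_slot2 I J h (M : amat L (mdim J)) :
  GRing.comm (scal1 I J h) (slot2 _ M).
Proof. by apply/comm_slots => i j k l; apply/commr_sym/mscE. Qed.

Lemma comm_scal_slot1 I J h (M : amat L (mdim I)) :
  GRing.comm (scal2 I J h) (slot1 _ M).
Proof. by apply/commr_sym/comm_slots => i j k l; apply/mscE. Qed.

Lemma commuting_scal I J : commuting (scal1 I J) (scal2 I J).
Proof. by move=> x y; apply: comm_scal_slot2. Qed.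

Lemma msc_act2 I J X : msc L (act2 I J X) = Ap X (scal1 I J) (scal2 I J).
Proof.
rewrite /act2 (linear_tsum (h := fun M => msc L M)); last first.
  exact: (@msc_linear F L _ 'M[F]_(mdim I * mdim J) id).
by apply: eq_tsum => a b; rewrite msc_tens.
Qed.

Lemma scal_mtens I J h : scal (mtens I J) h = conv (scal1 I J) (scal2 I J) h.
Proof. exact: msc_act2. Qed.

Lemma msc_act2_tflip I J X :
  msc L (act2 I J (tflip X)) = Ap X (scal2 I J) (scal1 I J).
Proof.
rewrite msc_act2 Ap_flip //; [exact: (scal1_morph I J).1|exact: (scal2_morph I J).1|].
exact: commuting_scal.
Qed.

Lemma ring_inv_uniq (B : pzRingType) (x y z : B) : y * x = 1 -> x * z = 1 -> y = z.
Proof. by move=> yx xz; rewrite -[y]mulr1 -xz mulrA yx mul1r. Qed.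

Lemma act2_unit I J Q X : tmul X Q = 1 \ox 1 -> act2 I J X \in unitmx.
Proof.
move=> XQ; have /mulmx1_unit[] // : act2 I J X *m act2 I J Q = 1%:M.
by rewrite -act2_tmul XQ -(comul1 H) -[act2 _ _ _]/(mrep (mtens I J) 1) mrep1.
Qed.

Lemma msc_invmx d (M : 'M[F]_d) (N : amat L d) : M \in unitmx ->
  msc L M * N = 1 -> msc L (invmx M) = N.
Proof. by move=> uM; apply: ring_inv_uniq; rewrite -mscM mulVmx // msc1. Qed.

Local Notation Rel12 I J := (Rel (scal1 I J) (scal2 I J)).
Local Notation Rel21 I J := (Rel (scal2 I J) (scal1 I J)).
Local Notation Rinv12 I J := (Rinv (scal1 I J) (scal2 I J)).
Local Notation Rinv21 I J := (Rinv (scal2 I J) (scal1 I J)).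

Lemma msc_R I J : msc L (act2 I J (Rmat H)) = Rel12 I J.
Proof. exact: msc_act2. Qed.
Lemma msc_R' I J : msc L (act2 I J (tflip (Rmat H))) = Rel21 I J.
Proof. exact: msc_act2_tflip. Qed.

Lemma tflip_tmul (X Y : tens H H) : tflip (tmul X Y) = tmul (tflip X) (tflip Y).
Proof.
have fl : linear (@tflip F H) by move=> c x y; rewrite /tflip tsumDl.
have ml Z : linear (fun W => @tmul F H W Z) by move=> c x y; rewrite /tmul tsumDl.
have pb : bilinear_map (fun a b : H => b \ox a).
  by split=> [y|x] c a b; rewrite ?pureDl ?pureDr.
have mpure a b W : tmul (a \ox b) W = \tsum_(c, d <- W) (a * c) \ox (b * d).
  rewrite /tmul tsum_pure //; split=> [y|x] c p q; apply: tsumDr => r s.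
    by rewrite mulrDl -scalerAl pureDl.
  by rewrite mulrDl -scalerAl pureDr.
rewrite [in RHS]/tflip (linear_tsum _ _ (ml _)) /tmul (linear_tsum _ _ fl).
apply: eq_tsum => a b; rewrite -/(tmul _ _) mpure (linear_tsum _ _ fl).
rewrite (linear_tsum (h := fun W => \tsum_(c, d <- W) (b * c) \ox (a * d))).
  apply: eq_tsum => c d; rewrite /tflip !tsum_pure //.
  split=> [y|x] k p q; rewrite mulrDr -scalerAr ?pureDl ?pureDr //.
by move=> k p q; rewrite tsumDl.
Qed.

Lemma msc_Rinv I J : msc L (invmx (act2 I J (Rmat H))) = Rinv12 I J.
Proof.
have [Q [RQ _]] := Rmat_inv H; apply: msc_invmx; first exact: act2_unit RQ.
rewrite msc_R; apply: (proj2 (RinvP _ _ _)).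
- exact: scal1_morph.
- exact: scal2_morph.
- exact: commuting_scal.
Qed.

Lemma msc_R'inv I J : msc L (invmx (act2 I J (tflip (Rmat H)))) = Rinv21 I J.
Proof.
have [Q [RQ _]] := Rmat_inv H; apply: msc_invmx.
  apply: (@act2_unit _ _ (tflip Q)); rewrite -tflip_tmul RQ /tflip tsum_pure //.
  by split=> [y|x] c a b; rewrite ?pureDl ?pureDr.
rewrite msc_R'; apply: (proj2 (RinvP _ _ _)).
- exact: scal2_morph.
- exact: scal1_morph.
- exact: (commutingC (@commuting_scal I J)).
Qed.

Section System.
Variables g n : nat.

Definition fusion_eq u := forall I J,
  genmx u (mtens I J)
  = slot1 _ (genmx u I) * Rel21 I J * slot2 _ (genmx u J) * Rinv21 I J.
Definition exchange_eq u v := forall I J,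
  Rel12 I J * slot1 _ (genmx u I) * Rinv12 I J * slot2 _ (genmx v J)
  = slot2 _ (genmx v J) * Rel12 I J * slot1 _ (genmx u I) * Rinv12 I J.
Definition handle_eq b a := forall I J,
  Rel12 I J * slot1 _ (genmx b I) * Rel21 I J * slot2 _ (genmx a J)
  = slot2 _ (genmx a J) * Rel12 I J * slot1 _ (genmx b I) * Rinv12 I J.

(** The defining relations of L_{g,n}(H) read in an arbitrary algebra. The matrix of the trivial
    module is the counit ([Tmx_mtriv]), so its relation becomes [sys_trivial]. *)
Record Lsys (u : letter g n -> dual -> L) : Prop := LSys {
  sys_linear : forall k, linear (u k);
  sys_trivial : forall k, u k (counit H) = 1;
  sys_fusion : forall k, fusion_eq (u k);
  sys_exchange : forall k l, (site k < site l)%N -> exchange_eq (u k) (u l);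
  sys_handle : forall i, handle_eq (u (lB n i)) (u (lA n i))
}.

Lemma Tmx_mtriv : Tmx (mtriv H) = (counit H)%:M.
Proof.
apply/matrixP => i j; rewrite !mxE !ord1 eqxx mulr1n; apply/lfunP => x.
rewrite linfunE /=; first by rewrite mxE eqxx mulr1n.
by move=> c y z; rewrite /mtriv_rep linearP !mxE eqxx !mulr1n.
Qed.

Variable f : freealg F (Lgens H g n) -> L.
Hypothesis flin : linear f.
Hypothesis fmon : monoid_morphism f.

Let mapM d (M N : 'M[freealg F (Lgens H g n)]_d) :
  map_mx f (M *m N) = (map_mx f M : amat L d) * (map_mx f N : amat L d).
Proof.
apply/matrixP => i j; rewrite !mxE (big_morph f (linD flin) (lin0 flin)).
by apply: eq_bigr => k _; rewrite !mxE fmon.2.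
Qed.

Let mapfscal d (M : 'M[F]_d) : map_mx f (fscal H g n M) = msc L M.
Proof. by apply/matrixP => i j; rewrite !mxE (linZ flin) fmon.1. Qed.

Let fu k phi := f (freegen F ((k, phi) : Lgens H g n)).

Let map1 k I e : map_mx f (mx1 e (fmx k I)) = slot1 e (genmx (fu k) I).
Proof.
apply/amat_slotP => i1 i2 j1 j2; rewrite slot1E mxE /mx1 tensmxE !mxE.
by case: eqP => _; rewrite ?mulr1 ?mulr1n ?mulr0n ?mulr0 ?(lin0 flin).
Qed.

Let map2 k I e : map_mx f (mx2 e (fmx k I)) = slot2 e (genmx (fu k) I).
Proof.
apply/amat_slotP => i1 i2 j1 j2; rewrite slot2E mxE /mx2 tensmxE !mxE.
by case: eqP => _; rewrite ?mul1r ?mulr1n ?mulr0n ?mul0r ?(lin0 flin).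
Qed.

Let map4 d (M1 M2 M3 M4 : 'M[freealg F (Lgens H g n)]_d) (N1 N2 N3 N4 : amat L d) :
  map_mx f M1 = N1 -> map_mx f M2 = N2 -> map_mx f M3 = N3 -> map_mx f M4 = N4 ->
  map_mx f (M1 *m M2 *m M3 *m M4) = N1 * N2 * N3 * N4.
Proof. by move=> <- <- <- <-; rewrite !mapM. Qed.

Let mapR I J : map_mx f (fscal H g n (act2 I J (Rmat H))) = Rel12 I J.
Proof. by rewrite mapfscal msc_R. Qed.
Let mapR' I J : map_mx f (fscal H g n (act2 I J (tflip (Rmat H)))) = Rel21 I J.
Proof. by rewrite mapfscal msc_R'. Qed.
Let mapRinv I J : map_mx f (fscal H g n (invmx (act2 I J (Rmat H)))) = Rinv12 I J.
Proof. by rewrite mapfscal msc_Rinv. Qed.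
Let mapR'inv I J :
  map_mx f (fscal H g n (invmx (act2 I J (tflip (Rmat H))))) = Rinv21 I J.
Proof. by rewrite mapfscal msc_R'inv. Qed.

Let map_sub d (M N : 'M[freealg F (Lgens H g n)]_d) (M' N' : amat L d) :
  map_mx f M = M' -> map_mx f N = N' ->
  (forall i j, f ((M - N) i j) = 0) <-> M' = N'.
Proof.
move=> <- <-; split=> [e|/matrixP e i j]; last first.
  have := e i j; rewrite !mxE => e'.
  by rewrite (linD flin) -scaleN1r (linZ flin) e' scaleN1r addrN.
apply/matrixP => i j; have := e i j; rewrite !mxE (linD flin) -scaleN1r (linZ flin).
by rewrite scaleN1r => /eqP; rewrite subr_eq0 => /eqP.
Qed.

Let trivE k (i j : 'I_1) :
  (fmx k (mtriv H) - 1%:M) i j = freegen F ((k, counit H) : Lgens H g n) - 1.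
Proof. by rewrite /fmx Tmx_mtriv !mxE !ord1 eqxx !mulr1n. Qed.

(** Serves twice: the quotient map kills the relations, so the generators of L_{g,n}(H) form a
    system ([lgen_sys]); conversely a system makes evaluation on the free algebra kill the relations
    ([Lgn_hom]). *)
Lemma Lsys_vanish : (forall w, @Lrel F H g n w -> f w = 0) <-> Lsys fu.
Proof.
have fus k I J : (forall i j, f (rel_fusion k I J i j) = 0) <->
  genmx (fu k) (mtens I J)
  = slot1 _ (genmx (fu k) I) * Rel21 I J * slot2 _ (genmx (fu k) J) * Rinv21 I J.
  apply: map_sub; first by rewrite /genmx -map_mx_comp.
  apply: map4; [exact: map1 | exact: mapR' | exact: map2 | exact: mapR'inv].
have exc k l I J : (forall i j, f (rel_exchange k l I J i j) = 0) <->
  Rel12 I J * slot1 _ (genmx (fu k) I) * Rinv12 I J * slot2 _ (genmx (fu l) J)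
  = slot2 _ (genmx (fu l) J) * Rel12 I J * slot1 _ (genmx (fu k) I) * Rinv12 I J.
  apply: map_sub; apply: map4.
  - exact: mapR.
  - exact: map1.
  - exact: mapRinv.
  - exact: map2.
  - exact: map2.
  - exact: mapR.
  - exact: map1.
  - exact: mapRinv.
have han (i : 'I_g) I J : (forall p q, f (rel_handle n i I J p q) = 0) <->
  Rel12 I J * slot1 _ (genmx (fu (lB n i)) I) * Rel21 I J * slot2 _ (genmx (fu (lA n i)) J)
  = slot2 _ (genmx (fu (lA n i)) J) * Rel12 I J * slot1 _ (genmx (fu (lB n i)) I)
    * Rinv12 I J.
  apply: map_sub; apply: map4.
  - exact: mapR.
  - exact: map1.
  - exact: mapR'.
  - exact: map2.
  - exact: map2.
  - exact: mapR.
  - exact: map1.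
  - exact: mapRinv.
have fB v w : f (v - w) = f v - f w by rewrite (linD flin) -scaleN1r (linZ flin) scaleN1r.
split=> [van|[ul ut uf ue uh] w].
  split.
  - move=> k c phi psi; apply/eqP; rewrite -subr_eq0 -flin -fB; apply/eqP.
    exact/van/Lrel_linear.
  - move=> k; apply/eqP; rewrite -subr_eq0 -fmon.1 -fB; apply/eqP.
    have := van _ (Lrel_trivial k ord0 ord0).
    by rewrite trivE.
  - by move=> k I J; apply/fus => i j; apply/van/Lrel_fusion.
  - by move=> k l kl I J; apply/exc => i j; apply/van/Lrel_exchange.
  - by move=> i I J; apply/han => p q; apply/van/Lrel_handle.
case=> [k c phi psi|k i j|k I J i j|k l I J i j kl|a I J i j].
- rewrite fB flin; apply/eqP; rewrite subr_eq0; apply/eqP; exact: ul.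
- rewrite trivE fB fmon.1.
  by apply/eqP; rewrite subr_eq0; apply/eqP; exact: ut.
- by move: i j; apply/fus; apply: uf.
- by move: i j; apply/exc; apply: ue.
- by move: i j; apply/han; apply: uh.
Qed.

End System.
End OneAlgebra.

Section UniversalSystem.
Variables (g n : nat).

Definition lgen (k : letter g n) (phi : dual) : Lgn H g n :=
  pgen (@Lrel F H g n) ((k, phi) : Lgens H g n).

Lemma pclass_morph (X : choiceType) (E : freealg F X -> Prop) :
  linear (pclass E) /\ monoid_morphism (pclass E).
Proof.
split; first by move=> c v w; rewrite pclassD pclassZ.
split; [exact: erefl | exact: pclassM].
Qed.

Lemma lgen_sys : Lsys lgen.
Proof.
have [pl pm] := pclass_morph (@Lrel F H g n).
apply/(Lsys_vanish (L := Lgn H g n) pl pm) => w ew.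
rewrite -(lin0 pl); apply/pclassP; rewrite subr0; exact: ideal_gen_base.
Qed.

Lemma Lgn_hom (L : pzAlgType F) (u : letter g n -> dual -> L) : Lsys u ->
  exists f : Lgn H g n -> L,
    alg_morphism f /\ forall k phi, f (lgen k phi) = u k phi.
Proof.
move=> us; pose u' (x : Lgens H g n) := u x.1 x.2.
have [fl fm] := feval_morph u'.
have van w : @Lrel F H g n w -> feval u' w = 0.
  move: w; apply/(Lsys_vanish fl fm); congr (Lsys _): us.
  by apply/funext => k; apply/funext => phi; rewrite feval_gen.
exists (peval u' (E := @Lrel F H g n)); split; first exact: peval_morph.
by move=> k phi; rewrite /lgen peval_gen.
Qed.

Lemma eq_Lgn (L : pzAlgType F) (f h : Lgn H g n -> L) :
  alg_morphism f -> alg_morphism h ->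
  (forall k phi, f (lgen k phi) = h (lgen k phi)) -> f =1 h.
Proof. by move=> fm hm fh; apply: eq_presented => // -[k phi]; apply: fh. Qed.

Lemma Lgn_ind (P : Lgn H g n -> Prop) :
  P 1 -> (forall (c : F) x y, P x -> P y -> P (c *: x + y)) ->
  (forall k phi y, P y -> P (lgen k phi * y)) -> forall z, P z.
Proof. by move=> P1 PL PM; apply: presented_ind => // -[k phi]; apply: PM. Qed.

End UniversalSystem.

Section SystemMap.
Variables (L L' : pzAlgType F) (f : L -> L').
Hypothesis fm : alg_morphism f.

Lemma mmap_genmx (u : dual -> L) I : mmap_amat f (genmx u I) = genmx (f \o u) I.
Proof. by rewrite /genmx /mmap_amat -map_mx_comp. Qed.

Lemma mmap_Ap d (X : tens H H) (p q : H -> amat L d) :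
  mmap_amat f (Ap X p q) = Ap X (mmap_amat f \o p) (mmap_amat f \o q).
Proof.
have [ml [_ mM]] := mmap_amat_morph fm d; rewrite /Ap (linear_tsum _ _ ml).
by apply: eq_tsum => a b; rewrite mM.
Qed.

Lemma mmap_scal1 I J : mmap_amat f \o scal1 L I J =1 scal1 L' I J.
Proof. by move=> h /=; rewrite /scal1 mmap_slot1 // /scal mmap_sc. Qed.
Lemma mmap_scal2 I J : mmap_amat f \o scal2 L I J =1 scal2 L' I J.
Proof. by move=> h /=; rewrite /scal2 mmap_slot2 // /scal mmap_sc. Qed.

Lemma Lsys_map g n (u : letter g n -> dual -> L) :
  Lsys u -> Lsys (fun k => f \o u k).
Proof.
move=> [ul ut uf ue uh].
have mM d := (mmap_amat_morph fm d).2.2.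
have R12 I J : mmap_amat f (Rel (scal1 L I J) (scal2 L I J))
    = Rel (scal1 L' I J) (scal2 L' I J).
  rewrite /Rel mmap_Ap; apply: eq_Ap; [exact: mmap_scal1 | exact: mmap_scal2].
have R21 I J : mmap_amat f (Rel (scal2 L I J) (scal1 L I J))
    = Rel (scal2 L' I J) (scal1 L' I J).
  rewrite /Rel mmap_Ap; apply: eq_Ap; [exact: mmap_scal2 | exact: mmap_scal1].
have R12' I J : mmap_amat f (Rinv (scal1 L I J) (scal2 L I J))
    = Rinv (scal1 L' I J) (scal2 L' I J).
  rewrite /Rinv /Rel mmap_Ap; apply: eq_Ap => h; [exact: mmap_scal1 | exact: mmap_scal2].
have R21' I J : mmap_amat f (Rinv (scal2 L I J) (scal1 L I J))
    = Rinv (scal2 L' I J) (scal1 L' I J).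
  rewrite /Rinv /Rel mmap_Ap; apply: eq_Ap => h; [exact: mmap_scal2 | exact: mmap_scal1].
split.
- by move=> k; apply: linear_comp; [apply: ul | case: fm].
- by move=> k /=; rewrite ut fm.2.1.
- move=> k I J; rewrite -!mmap_genmx uf !mM R21 R21'.
  by rewrite mmap_slot1 // mmap_slot2.
- move=> k l kl I J; rewrite -!mmap_genmx; have := congr1 (mmap_amat f) (ue k l kl I J).
  by rewrite !mM R12 R12' mmap_slot1 // mmap_slot2.
- move=> i I J; rewrite -!mmap_genmx; have := congr1 (mmap_amat f) (uh i I J).
  by rewrite !mM R12 R12' R21 mmap_slot1 // mmap_slot2.
Qed.

End SystemMap.
End GraphSystem.

(** * Conjugation by Lambda *)

Section Inverses.
Variable B : pzRingType.
Implicit Types x y z u v : B.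

Definition inv_pair x x' := x * x' = 1 /\ x' * x = 1.

Lemma inv_pair_sym x x' : inv_pair x x' -> inv_pair x' x.
Proof. by case. Qed.
Lemma inv_pairM x x' y y' : inv_pair x x' -> inv_pair y y' ->
  inv_pair (x * y) (y' * x').
Proof.
move=> [xx x'x] [yy y'y]; split.
  by rewrite mulrA -[x * y * y']mulrA yy mulr1.
by rewrite mulrA -[y' * x' * x]mulrA x'x mulr1.
Qed.
Lemma inv_uniq x x' x'' : inv_pair x x' -> inv_pair x x'' -> x' = x''.
Proof. by move=> [_ x'x] [xx'' _]; exact: ring_inv_uniq x'x xx''. Qed.

Lemma inv_comm x x' y : inv_pair x x' -> GRing.comm x y -> GRing.comm x' y.
Proof.
move=> [xx x'x] c; rewrite /GRing.comm -[y in LHS]mulr1 -xx [y * (x * x')]mulrA -c.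
by rewrite !mulrA x'x mul1r.
Qed.

Lemma inv_lcancel x x' y z : inv_pair x x' -> x * y = x * z -> y = z.
Proof. by move=> [_ x'x] e; rewrite -[y]mul1r -[z]mul1r -x'x -!mulrA e. Qed.
Lemma inv_rcancel x x' y z : inv_pair x x' -> y * x = z * x -> y = z.
Proof. by move=> [xx' _] e; rewrite -[y]mulr1 -[z]mulr1 -xx' !mulrA e. Qed.

Lemma conj_inj x x' u v : inv_pair x x' -> x * u * x' = x * v * x' -> u = v.
Proof.
move=> px /(inv_rcancel (inv_pair_sym px)); exact: (inv_lcancel px).
Qed.

Lemma conjM x x' u v : inv_pair x x' -> x * u * x' * (x * v * x') = x * (u * v) * x'.
Proof. by move=> [_ x'x]; rewrite !mulrA -[_ * x' * x]mulrA x'x mulr1. Qed.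

Lemma comm_conj x x' u v : inv_pair x x' ->
  GRing.comm (x * u * x') (x * v * x') <-> GRing.comm u v.
Proof.
move=> px; rewrite /GRing.comm !conjM //; split=> [|-> //].
exact: conj_inj.
Qed.

Lemma conj_cancel x x' y y' t : x' * x = 1 -> y * y' = 1 ->
  t = x' * (x * t * y) * y'.
Proof. by move=> xx yy; rewrite -!mulrA yy mulr1 mulrA xx mul1r. Qed.

Lemma conj_fix x x' u : inv_pair x x' -> GRing.comm x u -> x * u * x' = u.
Proof. by move=> [xx _] ->; rewrite -mulrA xx mulr1. Qed.

Lemma inv_mulK x x' y : inv_pair x x' -> x' * (x * y) = y.
Proof. by move=> [_ x'x]; rewrite mulrA x'x mul1r. Qed.
Lemma inv_mulrK x x' y : inv_pair x x' -> y * x * x' = y.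
Proof. by move=> [xx' _]; rewrite -mulrA xx' mulr1. Qed.

Section Conjugation.
(* In use, a1 and a2 are a matrix Lambda placed in the first and in the       *)
(* second slot, and r and s are R and R' on these slots.                      *)
Variables a1 a1' a2 a2' : B.
Hypotheses (p1 : inv_pair a1 a1') (p2 : inv_pair a2 a2').

Lemma ybe_slide r : a2' * a1' * r = r * a1' * a2' -> a1' * r * a2 = a2 * r * a1'.
Proof.
move=> ybe; apply: (inv_lcancel (inv_pair_sym p2)).
by rewrite !mulrA ybe p2.2 mul1r -[r * a1' * a2' * a2]mulrA p2.2 mulr1.
Qed.

Lemma ybe_inv r r' : inv_pair r r' -> a2' * a1' * r = r * a1' * a2' ->
  a1' * a2' * r' = r' * a2' * a1'.
Proof.
move=> pr ybe; apply: (inv_lcancel pr); apply: (inv_rcancel pr).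
by rewrite !mulrA -ybe (inv_mulrK _ (inv_pair_sym pr)) pr.1 mul1r.
Qed.

(** Yang-Baxter reorders the inner a_1' r a_2, after which a_2 passes u_1 and a_1' passes u_2. The
    outer factors collect into a_1 a_2, which is Lambda on the tensor product module
    ([Lam_mtens]). *)
Lemma fusion_conj r r' u1 u2 : inv_pair r r' ->
  a2' * a1' * r = r * a1' * a2' -> GRing.comm a2 u1 -> GRing.comm a1 u2 ->
  a1 * u1 * a1' * r * (a2 * u2 * a2') * r'
  = a1 * a2 * (u1 * r * u2 * r') * (a2' * a1').
Proof.
move=> pr ybe c2 c1.
transitivity (a1 * u1 * (a1' * r * a2) * u2 * a2' * r'); first by rewrite !mulrA.
rewrite (ybe_slide ybe).
transitivity (a1 * (u1 * a2) * r * (a1' * u2) * a2' * r'); first by rewrite !mulrA.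
rewrite -c2 (inv_comm p1 c1).
transitivity (a1 * a2 * u1 * r * u2 * (a1' * a2' * r')); first by rewrite !mulrA.
by rewrite (ybe_inv pr ybe) !mulrA.
Qed.

Lemma ybe_left r : a1' * a2' * r = r * a2' * a1' -> r * a1 * a2 = a2 * a1 * r.
Proof.
move=> ybe; apply: (inv_lcancel (inv_pairM (inv_pair_sym p1) (inv_pair_sym p2))).
rewrite !mulrA ybe -[a1' * a2' * a2]mulrA p2.2 mulr1 p1.2 mul1r.
by rewrite (inv_mulrK _ (inv_pair_sym p1)) (inv_mulrK _ (inv_pair_sym p2)).
Qed.

(** Both sides of the handle relation turn out to be conjugated by the same element a_2 a_1, so the
    relation before and after conjugation is the same. *)
Lemma handle_conj r r' s u1 u2 : inv_pair r r' ->
  a1' * a2' * r = r * a2' * a1' -> a2' * a1' * s = s * a1' * a2' ->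
  GRing.comm a2 u1 -> GRing.comm a1 u2 ->
  r * (a1 * u1 * a1') * s * (a2 * u2 * a2')
    = a2 * a1 * (r * u1 * s * u2) * (a1' * a2') /\
  a2 * u2 * a2' * r * (a1 * u1 * a1') * r'
    = a2 * a1 * (u2 * r * u1 * r') * (a1' * a2').
Proof.
move=> pr yr ys c2 c1; split.
  transitivity (r * a1 * u1 * (a1' * s * a2) * u2 * a2'); first by rewrite !mulrA.
  rewrite (ybe_slide ys).
  transitivity (r * a1 * (u1 * a2) * s * (a1' * u2) * a2'); first by rewrite !mulrA.
  rewrite -c2 (inv_comm p1 c1).
  transitivity (r * a1 * a2 * u1 * s * u2 * (a1' * a2')); first by rewrite !mulrA.
  by rewrite (ybe_left yr) !mulrA.
have slide : a2' * r * a1 = a1 * r * a2'.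
  apply: (inv_lcancel (inv_pair_sym p1)).
  by rewrite !mulrA yr p1.2 mul1r -[r * a2' * a1' * a1]mulrA p1.2 mulr1.
have yr' : a2' * a1' * r' = r' * a1' * a2'.
  apply: (inv_lcancel pr); apply: (inv_rcancel pr).
  by rewrite !mulrA -yr (inv_mulrK _ (inv_pair_sym pr)) pr.1 mul1r.
transitivity (a2 * u2 * (a2' * r * a1) * u1 * a1' * r'); first by rewrite !mulrA.
rewrite slide.
transitivity (a2 * (u2 * a1) * r * (a2' * u1) * a1' * r'); first by rewrite !mulrA.
rewrite -c1 (inv_comm p2 c2).
transitivity (a2 * a1 * u2 * r * u1 * (a2' * a1' * r')); first by rewrite !mulrA.
by rewrite yr' !mulrA.
Qed.

(** In use, a is the Lambda of the sites before the first matrix, c that of its own site, and w that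
    of the sites strictly between, c and w being in the second slot. Equivariance says that c' r
    commutes with u_1, so conjugation by r can be traded for conjugation by a_2 c. Both members are
    then conjugates by a_2 c, and after that by a_1 and by w, which leaves commutation of u_1 and
    v_2. *)
Lemma exchange_conj r r' c c' w w' u1 v2 :
  inv_pair r r' -> inv_pair c c' -> inv_pair w w' ->
  a1' * a2' * r = r * a2' * a1' -> GRing.comm (c' * r) u1 ->
  GRing.comm a2 u1 -> GRing.comm w u1 -> GRing.comm a1 c -> GRing.comm a1 w ->
  GRing.comm a1 v2 ->
  GRing.comm (r * (a1 * u1 * a1') * r') ((a2 * c * w) * v2 * (w' * (c' * a2')))
  <-> GRing.comm u1 v2.
Proof.
move=> pr pc pw ybe equiv c2u cwu c1c c1w c1v.
have -> : r * (a1 * u1 * a1') * r' = (a2 * c) * (a1 * u1 * a1') * (c' * a2').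
  rewrite -{1}(conj_fix p2 c2u).
  have pl : inv_pair (r * a1 * a2) (a2' * (a1' * r')).
    by apply: inv_pairM => //; apply: inv_pairM.
  transitivity ((r * a1 * a2) * u1 * (a2' * (a1' * r'))); first by rewrite !mulrA.
  have pl2 : inv_pair (a2 * a1 * r) (r' * (a1' * a2')).
    by apply: inv_pairM => //; apply: inv_pairM.
  have e := ybe_left ybe; move: pl; rewrite e => pl.
  rewrite (inv_uniq pl pl2).
  transitivity (a2 * a1 * (r * u1 * r') * (a1' * a2')); first by rewrite !mulrA.
  have -> : r * u1 * r' = c * u1 * c'.
    apply: (inv_rcancel pr); rewrite (inv_mulrK _ (inv_pair_sym pr)).
    apply: (inv_lcancel (inv_pair_sym pc)).
    by rewrite -!mulrA [c' * (r * u1)]mulrA equiv (inv_mulK _ pc).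
  transitivity (a2 * (a1 * c) * u1 * (c' * a1') * a2'); first by rewrite !mulrA.
  rewrite c1c [c' * a1'](_ : _ = a1' * c'); first by rewrite !mulrA.
  by apply/esym; apply: (inv_comm p1); apply/commr_sym; apply: (inv_comm pc); apply/commr_sym.
have -> : a2 * c * w * v2 * (w' * (c' * a2')) = (a2 * c) * (w * v2 * w') * (c' * a2').
  by rewrite !mulrA.
rewrite (comm_conj _ _ (inv_pairM p2 pc)).
have c1w' : GRing.comm a1 w' by apply/commr_sym/(inv_comm pw)/commr_sym.
have {1}<- : a1 * (w * v2 * w') * a1' = w * v2 * w'.
  by apply: conj_fix => //; do 2?apply: commrM.
rewrite (comm_conj _ _ p1).
have {1}<- : w * u1 * w' = u1 by exact: conj_fix.
exact: comm_conj.
Qed.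

End Conjugation.
End Inverses.

(** * The regular module, whose matrix coefficients span the dual of H *)

Section Regular.
Variables (F : fieldType) (H : hopfAlg F).
Local Notation dual := 'Hom(hopf_sort H, F^o).
Let b := vbasis {:H}.

Definition reg_rep (x : H) : 'M[F]_(\dim {:H}) :=
  \matrix_(i, j) coord b i (x * b`_j).

Fact reg_rep_linear : linear reg_rep.
Proof.
by move=> c x y; apply/matrixP => i j; rewrite !mxE mulrDl -scalerAl linearP.
Qed.
HB.instance Definition _ :=
  GRing.isLinear.Build F H 'M[F]_(\dim {:H}) _ reg_rep reg_rep_linear.

Let coordE x : x = \sum_i coord b i x *: b`_i.
Proof. exact: coord_vbasis (memvf x). Qed.

Fact reg_rep1 : reg_rep 1 = 1%:M.
Proof.
apply/matrixP => i j; rewrite !mxE mul1r coord_free ?(basis_free (vbasisP _)) //.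
by rewrite eq_sym.
Qed.

Fact reg_repM x y : reg_rep (x * y) = reg_rep x *m reg_rep y.
Proof.
apply/matrixP => i j; rewrite !mxE -mulrA [y * _]coordE mulr_sumr linear_sum.
by apply: eq_bigr => k _; rewrite -scalerAr linearZ /= !mxE mulrC.
Qed.

Definition regular_mod : hmod H := HMod reg_rep1 reg_repM.

Lemma TmxE (I : hmod H) i j (x : H) : Tmx I i j x = mrep I x i j.
Proof. by rewrite mxE linfunE // => c y z; rewrite linearP !mxE. Qed.

(** Expanding 1 in the basis, and then each product of x with a basis vector, writes phi(x) = phi(x
    1) through coefficients of the regular module. Hence matrix identities over all modules
    determine linear maps on H^*. *)
Lemma dual_span (P : dual -> Prop) :
  P 0 -> (forall (c : F) phi psi, P phi -> P psi -> P (c *: phi + psi)) ->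
  (forall i j, P (Tmx regular_mod i j)) -> forall phi, P phi.
Proof.
move=> P0 PL PT phi.
have Psum I (r : seq I) (c : I -> F) (G : I -> dual) :
    (forall i, P (G i)) -> P (\sum_(i <- r) c i *: G i).
  by move=> PG; elim/big_ind: _ => [//|x y Px Py|i _];
    [have := PL 1 _ _ Px Py; rewrite scale1r | have := PL (c i) _ _ (PG i) P0; rewrite addr0].
have -> : phi = \sum_(i < \dim {:H}) (phi (b`_i) : F) *:
    \sum_(j < \dim {:H}) coord b j 1 *: Tmx regular_mod i j.
  apply/lfunP => x; rewrite sum_lfunE.
  transitivity (\sum_(i < \dim {:H}) phi b`_i * coord b i x).
    rewrite [in LHS](coordE x) linear_sum; apply: eq_bigr => i _.
    by rewrite linearZ mulrC.
  apply: eq_bigr => i _; rewrite scale_lfunE sum_lfunE; congr (_ * _).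
  rewrite -[in LHS](mulr1 x) [in LHS](coordE 1) mulr_sumr linear_sum.
  by apply: eq_bigr => j _; rewrite scale_lfunE TmxE mxE -scalerAr linearZ.
by apply: (Psum) => i; apply: (Psum).
Qed.

End Regular.

(** * Effect of conjugation by Lambda on each graph relation *)

Section Twist.
Variables (F : fieldType) (H : ribbonHopf F).
Local Notation dual := 'Hom(hopf_sort H, F^o).

Lemma comm3E (B : pzRingType) (x y z t : B) :
  x * y * z * t = t * x * y * z <-> GRing.comm (x * y * z) t.
Proof. by rewrite /GRing.comm !mulrA. Qed.

Lemma alg_Ap (B B' : pzAlgType F) (m : B -> B') X (f g : H -> B) :
  alg_morphism m -> m (Ap X f g) = Ap X (m \o f) (m \o g).
Proof.
move=> [ml [_ mM]]; rewrite /Ap (linear_tsum _ _ ml).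
by apply: eq_tsum => a b; rewrite mM.
Qed.

Section Coefficients.
Variable L : pzAlgType F.
Implicit Types (I J : hmod H) (u v : dual -> L) (s : H -> L).

Lemma mul_liftl d (x : L) (M : amat L d) i j : (mlift d x * M) i j = x * M i j.
Proof. by rewrite -[_ * M]/(_ *m _) mul_scalar_mx mxE. Qed.

Lemma mul_liftr d (x : L) (M : amat L d) i j : (M * mlift d x) i j = M i j * x.
Proof.
rewrite -[M * _]/(_ *m _) mxE (bigD1 j) //= big1 => [|k nk]; rewrite mxE ?eqxx ?addr0 //.
by rewrite (negPf nk) mulr0.
Qed.

Definition lsc d s (h : H) : amat L d := mlift d (s h).

Lemma lsc_morph d s : alg_morphism s -> alg_morphism (lsc d s).
Proof. by move=> sm; apply: (alg_comp sm); apply: mlift_morph. Qed.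

Lemma commuting_lsc_scal s I : commuting (lsc (mdim I) s) (scal L I).
Proof. by move=> x y; apply: comm_lift_sc. Qed.

Lemma slot1_lsc d e s h : slot1 e (lsc d s h) = lsc (d * e) s h.
Proof. exact: slot1_lift. Qed.
Lemma slot2_lsc d e s h : slot2 d (lsc e s h) = lsc (d * e) s h.
Proof. exact: slot2_lift. Qed.

Lemma commuting_lsc_scal1 s I J : commuting (lsc _ s) (scal1 L I J).
Proof. by move=> x y; rewrite -slot2_lsc; apply/commr_sym/comm_scal_slot2. Qed.
Lemma commuting_lsc_scal2 s I J : commuting (lsc _ s) (scal2 L I J).
Proof. by move=> x y; rewrite -slot1_lsc; apply/commr_sym/comm_scal_slot1. Qed.

(* Multiplies the matrices of u on both sides, see genmx_sandwich.            *)
Definition sandwich u s (X Y : tens H H) (phi : dual) : L :=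
  \tsum_(x, y <- X) \tsum_(z, w <- Y) s x * u (dtransr (dtransl phi y) w) * s z.

Lemma dtransl_linear (y : H) : linear (fun phi : dual => dtransl phi y).
Proof.
by move=> c phi psi; apply/lfunP => x; rewrite !(dtranslE, add_lfunE, scale_lfunE).
Qed.

Lemma sandwich_linear u s X Y : linear u -> linear (sandwich u s X Y).
Proof.
move=> ul c phi psi; apply: tsumDr => x y; apply: tsumDr => z w.
by rewrite dtransl_linear dtransrDl ul mulrDr mulrDl -pzscaleAr -pzscaleAl.
Qed.

(** Translating a form on its two sides multiplies its matrix by the actions of y and w. Conjugated
    matrices, one for each module, thereby come from a single linear map on H^*, as a system
    requires. *)
Lemma genmx_sandwich u s X Y I : linear u ->
  genmx (sandwich u s X Y) I
  = Ap X (lsc _ s) (scal L I) * genmx u I * Ap Y (lsc _ s) (scal L I).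
Proof.
move=> ul; rewrite [Ap X _ _]/Ap !mulr_tsumr.
have gt (V W : vectType F) (Z : tens V W) (f : V -> W -> dual -> L) :
    genmx (fun phi => \tsum_(a, b <- Z) f a b phi) I = \tsum_(a, b <- Z) genmx (f a b) I.
  apply/matrixP => i j; rewrite mxE.
  have el : linear (fun M : amat L (mdim I) => M i j : L).
    by move=> c M N; rewrite mxE amatZE.
  transitivity (\tsum_(a, b <- Z) (genmx (f a b) I i j : L)).
    by apply: eq_tsum => a b; rewrite [RHS]mxE.
  by symmetry; exact: (linear_tsum (fun a b => genmx (f a b) I) Z el).
rewrite gt; apply: eq_tsum => x y; rewrite gt [Ap Y _ _]/Ap mulr_tsuml.
apply: eq_tsum => z w.
have cl : GRing.comm (scal L I w) (lsc (mdim I) s z).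
  exact/commr_sym/commuting_lsc_scal.
rewrite -[_ * scal L I w]cl.
have -> : lsc (mdim I) s x * scal L I y * genmx u I * (scal L I w * lsc _ s z)
   = lsc (mdim I) s x * (scal L I y * genmx u I * scal L I w) * lsc _ s z.
  by rewrite !mulrA.
have -> : scal L I y * genmx u I * scal L I w
    = genmx (fun phi => u (dtransr (dtransl phi y) w)) I.
  apply/matrixP => i j; rewrite [RHS]mxE.
  have -> : dtransr (dtransl (Tmx I i j) y) w
      = \sum_l \sum_k (mrep I y i k * mrep I w l j) *: Tmx I k l.
    apply/lfunP => h; rewrite dtransrE dtranslE TmxE !mrepM mulmxA mxE sum_lfunE.
    apply: eq_bigr => l _ /=.
    rewrite sum_lfunE mxE mulr_suml; apply: eq_bigr => k _.
    by rewrite scale_lfunE TmxE [RHS]mulrAC.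
  rewrite -[LHS]/((_ *m _) i j) mxE.
  rewrite (big_morph u (linD ul) (lin0 ul)); apply: eq_bigr => l _.
  rewrite (big_morph u (linD ul) (lin0 ul)) -[(scal L I y * _) i l]/((_ *m _) i l) mxE.
  rewrite mulr_suml; apply: eq_bigr => k _; rewrite (linZ ul) !mxE.
  by rewrite -pzscaleAr mulr1 -!pzscaleAl mul1r scalerA [X in X *: _ = _]mulrC.
by apply/matrixP => i j; rewrite mul_liftr mul_liftl mxE [in RHS]mxE.
Qed.

Lemma eq_genmx u v I : u =1 v -> genmx u I = genmx v I.
Proof. by move=> uv; apply/matrixP => i j; rewrite !mxE uv. Qed.

(* The matrix of s(L^(-)) and its inverse.                                    *)
Definition Lam s I : amat L (mdim I) := Rinv (lsc _ s) (scal L I).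
Definition LamV s I : amat L (mdim I) := Rel (lsc _ s) (scal L I).

Definition twisted s u v := forall I, genmx v I = Lam s I * genmx u I * LamV s I.

Definition equivariant s u :=
  forall I h, GRing.comm (conv (lsc _ s) (scal L I) h) (genmx u I).

Lemma Lam_inv s I : alg_morphism s -> inv_pair (Lam s I) (LamV s I).
Proof.
move=> sm; apply: RinvP; [exact: lsc_morph | exact: scal_morph|].
exact: commuting_lsc_scal.
Qed.

Lemma twist_exists s u : alg_morphism s -> linear u ->
  exists v, linear v /\ twisted s u v.
Proof.
move=> sm ul; exists (sandwich u s (\tsum_(a, b <- Rmat H) a \ox antipode_inv H b) (Rmat H)).
split=> [|I]; first exact: sandwich_linear.
rewrite genmx_sandwich // -Rinv_Ap //; [exact: (lsc_morph _ sm).1 | exact: (scal_morph L I).1].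
Qed.

Lemma untwist_exists s v : alg_morphism s -> linear v ->
  exists u, linear u /\ twisted s u v.
Proof.
move=> sm vl; exists (sandwich v s (Rmat H) (\tsum_(a, b <- Rmat H) a \ox antipode_inv H b)).
split=> [|I]; first exact: sandwich_linear.
rewrite genmx_sandwich // -Rinv_Ap //; first last.
- exact: (scal_morph L I).1.
- exact: (lsc_morph _ sm).1.
have [ll lr] := Lam_inv I sm.
by rewrite -[Ap (Rmat H) _ _]/(LamV s I) -[Rinv _ _]/(Lam s I) -!mulrA ll mulr1 mulrA ll mul1r.
Qed.

Lemma genmx_mtriv u : genmx u (mtriv H) = mlift 1 (u (counit H)).
Proof.
by apply/matrixP => i j; rewrite /genmx Tmx_mtriv !mxE !ord1 eqxx !mulr1n.
Qed.

Lemma genmx_inj u v : linear u -> linear v -> (forall I, genmx u I = genmx v I) ->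
  u =1 v.
Proof.
move=> ul vl uv; apply: dual_span => [|c phi psi e1 e2|i j].
- by rewrite (lin0 ul) (lin0 vl).
- by rewrite ul vl e1 e2.
- by have /matrixP/(_ i j) := uv (regular_mod H); rewrite !mxE.
Qed.

Lemma twist_triv s u v : alg_morphism s -> twisted s u v ->
  (u (counit H) = 1 <-> v (counit H) = 1).
Proof.
move=> sm t; have [ll lr] := Lam_inv (mtriv H) sm.
have lift1 (w : dual -> L) : w (counit H) = 1 <-> genmx w (mtriv H) = 1.
  rewrite genmx_mtriv; split=> [->|/matrixP/(_ ord0 ord0)].
    exact: (mlift_morph L 1).2.1.
  by rewrite !mxE eqxx.
rewrite !lift1 t; split=> [->|e]; first by rewrite mulr1; exact: ll.
by apply: (conj_inj (Lam_inv _ sm)); rewrite e mulr1; exact: esym ll.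
Qed.

Section TwoSlots.
Variables (I J : hmod H) (s : H -> L).
Hypothesis sm : alg_morphism s.

Let r12 := Rel (scal1 L I J) (scal2 L I J).
Let r21 := Rel (scal2 L I J) (scal1 L I J).

Lemma slot1_Lam : slot1 (mdim J) (Lam s I) = Rinv (lsc _ s) (scal1 L I J).
Proof.
rewrite /Lam /Rinv /Rel alg_Ap; last exact: slot1_morph.
by apply: eq_Ap => // h; apply: slot1_lsc.
Qed.
Lemma slot2_Lam : slot2 (mdim I) (Lam s J) = Rinv (lsc _ s) (scal2 L I J).
Proof.
rewrite /Lam /Rinv /Rel alg_Ap; last exact: slot2_morph.
by apply: eq_Ap => // h; apply: slot2_lsc.
Qed.
Lemma slot1_LamV : slot1 (mdim J) (LamV s I) = Rel (lsc _ s) (scal1 L I J).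
Proof.
rewrite /LamV /Rel alg_Ap; last exact: slot1_morph.
by apply: eq_Ap => // h; apply: slot1_lsc.
Qed.
Lemma slot2_LamV : slot2 (mdim I) (LamV s J) = Rel (lsc _ s) (scal2 L I J).
Proof.
rewrite /LamV /Rel alg_Ap; last exact: slot2_morph.
by apply: eq_Ap => // h; apply: slot2_lsc.
Qed.

Lemma slot1_inv : inv_pair (slot1 (mdim J) (Lam s I)) (slot1 (mdim J) (LamV s I)).
Proof.
have [_ [m1 mM]] := slot1_morph L (mdim I) (mdim J); have [ll lr] := Lam_inv I sm.
by split; rewrite -mM ?ll ?lr m1.
Qed.
Lemma slot2_inv : inv_pair (slot2 (mdim I) (Lam s J)) (slot2 (mdim I) (LamV s J)).
Proof.
have [_ [m1 mM]] := slot2_morph L (mdim I) (mdim J); have [ll lr] := Lam_inv J sm.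
by split; rewrite -mM ?ll ?lr m1.
Qed.

Let s12 := @commuting_lsc_scal1 s I J.
Let s21 := @commuting_lsc_scal2 s I J.
Let c12 := @commuting_scal _ _ L I J.
Let m1 := scal1_morph L I J.
Let m2 := scal2_morph L I J.
Let ms : alg_morphism (lsc (mdim I * mdim J) s) := lsc_morph _ sm.

Lemma ybe_s21 : slot2 _ (LamV s J) * slot1 _ (LamV s I) * r21
  = r21 * slot1 _ (LamV s I) * slot2 _ (LamV s J).
Proof. by rewrite slot1_LamV slot2_LamV; apply: YBE => //; apply: commutingC. Qed.

Lemma ybe_s12 : slot1 _ (LamV s I) * slot2 _ (LamV s J) * r12
  = r12 * slot2 _ (LamV s J) * slot1 _ (LamV s I).
Proof. by rewrite slot1_LamV slot2_LamV; apply: YBE. Qed.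

Lemma LamV_mtens : LamV s (mtens I J)
  = slot2 (mdim I) (LamV s J) * slot1 (mdim J) (LamV s I).
Proof.
rewrite slot1_LamV slot2_LamV -Rel_convr //; first last.
- exact: commutingC.
- exact: m2.1.
- exact: m1.1.
by apply: eq_Ap => // h; apply: scal_mtens.
Qed.

Lemma Lam_mtens : Lam s (mtens I J)
  = slot1 (mdim J) (Lam s I) * slot2 (mdim I) (Lam s J).
Proof.
apply: (inv_uniq (x := LamV s (mtens I J))).
  exact/inv_pair_sym/Lam_inv.
rewrite LamV_mtens; apply: inv_pair_sym; apply: inv_pairM;
  [exact: slot1_inv | exact: slot2_inv].
Qed.

Lemma r12_inv : inv_pair r12 (Rinv (scal1 L I J) (scal2 L I J)).
Proof. by have [] := RinvP m1 m2 c12. Qed.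
Lemma r21_inv : inv_pair r21 (Rinv (scal2 L I J) (scal1 L I J)).
Proof. by have [] := RinvP m2 m1 (commutingC c12). Qed.

Lemma comm_lsc_slot1 u h : (forall phi, GRing.comm (s h) (u phi)) ->
  GRing.comm (lsc _ s h) (slot1 (mdim J) (genmx u I)).
Proof.
move=> c; rewrite -slot1_lsc /GRing.comm -!(slot1_morph L _ _).2.2; congr slot1.
by apply/comm_lift => i j; rewrite mxE.
Qed.

Lemma comm_Lam2_slot1 u : (forall h phi, GRing.comm (s h) (u phi)) ->
  GRing.comm (slot2 _ (Lam s J)) (slot1 (mdim J) (genmx u I)).
Proof.
move=> c; rewrite slot2_Lam; apply/commr_sym/comm_Ap => h; apply: commr_sym.
  exact: comm_lsc_slot1.
exact: comm_scal_slot1.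
Qed.

Lemma comm_Lam1_slot2 (M : amat L (mdim J)) :
  (forall h, GRing.comm (mlift _ (s h)) M) ->
  GRing.comm (slot1 _ (Lam s I)) (slot2 (mdim I) M).
Proof.
move=> c; rewrite slot1_Lam; apply/commr_sym/comm_Ap => h; apply: commr_sym.
  by rewrite -slot2_lsc /GRing.comm -!(slot2_morph L _ _).2.2; congr slot2; apply: c.
exact: comm_scal_slot2.
Qed.

End TwoSlots.

Lemma genmx_twisted1 s u v I J : twisted s u v ->
  slot1 (mdim J) (genmx v I) = slot1 _ (Lam s I) * slot1 _ (genmx u I) * slot1 _ (LamV s I).
Proof. by move=> ->; rewrite !(slot1_morph L _ _).2.2. Qed.
Lemma genmx_twisted2 s u v I J : twisted s u v ->
  slot2 (mdim I) (genmx v J) = slot2 _ (Lam s J) * slot2 _ (genmx u J) * slot2 _ (LamV s J).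
Proof. by move=> ->; rewrite !(slot2_morph L _ _).2.2. Qed.

Lemma comm_lift_genmx s u h J : (forall phi, GRing.comm (s h) (u phi)) ->
  GRing.comm (mlift _ (s h)) (genmx u J).
Proof. by move=> c; apply/comm_lift => i j; rewrite mxE. Qed.

(** An equivalence on purpose: one direction shows that alpha respects the relation, the other
    recovers the relation for unconjugated matrices when the inverse is built. *)
Lemma twist_fusion s u v : alg_morphism s -> twisted s u v ->
  (forall h phi, GRing.comm (s h) (u phi)) -> fusion_eq u <-> fusion_eq v.
Proof.
move=> sm t c.
suff e I J : (genmx u (mtens I J) = slot1 _ (genmx u I) * Rel (scal2 L I J) (scal1 L I J)
      * slot2 _ (genmx u J) * Rinv (scal2 L I J) (scal1 L I J)) <->
    (genmx v (mtens I J) = slot1 _ (genmx v I) * Rel (scal2 L I J) (scal1 L I J)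
      * slot2 _ (genmx v J) * Rinv (scal2 L I J) (scal1 L I J)).
  by split=> h I J; apply/e; apply: h.
rewrite (genmx_twisted1 I J t) (genmx_twisted2 I J t) t.
rewrite (fusion_conj (slot1_inv I J sm) (slot2_inv I J sm) (r21_inv I J)); first last.
- by apply: comm_Lam1_slot2 => h; apply: comm_lift_genmx.
- exact: comm_Lam2_slot1.
- exact: ybe_s21.
rewrite -Lam_mtens // -LamV_mtens //; split=> [-> //|].
exact: (conj_inj (Lam_inv _ sm)).
Qed.

Lemma twist_handle s b a vb va : alg_morphism s -> twisted s b vb -> twisted s a va ->
  (forall h phi, GRing.comm (s h) (b phi)) -> (forall h phi, GRing.comm (s h) (a phi)) ->
  handle_eq b a <-> handle_eq vb va.
Proof.
move=> sm tb ta cb ca.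
suff e I J : (Rel (scal1 L I J) (scal2 L I J) * slot1 _ (genmx b I)
       * Rel (scal2 L I J) (scal1 L I J) * slot2 _ (genmx a J)
     = slot2 _ (genmx a J) * Rel (scal1 L I J) (scal2 L I J) * slot1 _ (genmx b I)
       * Rinv (scal1 L I J) (scal2 L I J)) <->
    (Rel (scal1 L I J) (scal2 L I J) * slot1 _ (genmx vb I)
       * Rel (scal2 L I J) (scal1 L I J) * slot2 _ (genmx va J)
     = slot2 _ (genmx va J) * Rel (scal1 L I J) (scal2 L I J) * slot1 _ (genmx vb I)
       * Rinv (scal1 L I J) (scal2 L I J)).
  by split=> h I J; apply/e; apply: h.
rewrite (genmx_twisted1 I J tb) (genmx_twisted2 I J ta).
have p1 := slot1_inv I J sm; have p2 := slot2_inv I J sm.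
have [] := @handle_conj _ _ _ _ _ p1 p2 _ _ (Rel (scal2 L I J) (scal1 L I J))
  (slot1 _ (genmx b I)) (slot2 _ (genmx a J)) (r12_inv I J).
- exact: ybe_s12.
- exact: ybe_s21.
- exact: comm_Lam2_slot1.
- by apply: comm_Lam1_slot2 => h; apply: comm_lift_genmx.
move=> -> ->; split=> [-> //|].
exact: (conj_inj (inv_pairM p2 p1)).
Qed.

(** Here [s] gathers the moment maps of the sites before that of [u], [r] is the moment map of the
    site of [u], and [W] is the Lambda of the sites between the two. Slot by slot this is
    [exchange_conj]; the regular module then turns commutation of matrices into commutation of
    values. *)
Lemma twist_exchange s (r : H -> L) (W WV : forall J, amat L (mdim J)) u v ut
    (vt : dual -> L) :
  alg_morphism s -> alg_morphism r -> linear u -> linear v ->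
  (forall J, inv_pair (W J) (WV J)) ->
  twisted s u ut ->
  (forall J, genmx vt J
     = Lam s J * Lam r J * W J * genmx v J * (WV J * (LamV r J * LamV s J))) ->
  (forall h phi, GRing.comm (s h) (u phi)) ->
  (forall h phi, GRing.comm (s h) (v phi)) ->
  commuting s r -> equivariant r u ->
  (forall J phi, GRing.comm (mlift _ (u phi)) (W J)) ->
  (forall J h, GRing.comm (mlift _ (s h)) (W J)) ->
  exchange_eq ut vt <-> forall phi psi, GRing.comm (u phi) (v psi).
Proof.
move=> sm rm ul vl pW tu tv csu csv csr eqv cuW csW.
transitivity (forall I J, GRing.comm (slot1 (mdim J) (genmx u I)) (slot2 (mdim I) (genmx v J))).
  suff e I J : (Rel (scal1 L I J) (scal2 L I J) * slot1 _ (genmx ut I)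
         * Rinv (scal1 L I J) (scal2 L I J) * slot2 _ (genmx vt J)
      = slot2 _ (genmx vt J) * Rel (scal1 L I J) (scal2 L I J) * slot1 _ (genmx ut I)
        * Rinv (scal1 L I J) (scal2 L I J)) <->
      GRing.comm (slot1 (mdim J) (genmx u I)) (slot2 (mdim I) (genmx v J)).
    by split=> h I J; apply/e; apply: h.
  have [_ [m1 mM]] := slot2_morph L (mdim I) (mdim J).
  rewrite (genmx_twisted1 I J tu) tv !mM.
  have pw : inv_pair (slot2 (mdim I) (W J)) (slot2 (mdim I) (WV J)).
    by have [h1 h2] := pW J; split; rewrite -mM ?h1 ?h2 m1.
  rewrite -(exchange_conj (slot1_inv I J sm) (slot2_inv I J sm) (r12_inv I J)
     (slot2_inv I J rm) pw (ybe_s12 I J sm)).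
  - exact: comm3E.
  - rewrite slot2_LamV -Rel_convl; first last.
    + exact: commuting_scal.
    + exact: scal2_morph.
    + exact: (scal1_morph L I J).1.
    + exact: (lsc_morph _ rm).1.
    apply/commr_sym/comm_Ap => h; apply/commr_sym; last exact: comm_scal_slot1.
    have -> : conv (lsc _ r) (scal1 L I J) h
        = slot1 (mdim J) (conv (lsc _ r) (scal L I) h).
      rewrite /conv alg_Ap; last exact: slot1_morph.
      by apply: eq_Ap => // x; rewrite /= slot1_lsc.
    by rewrite /GRing.comm -!(slot1_morph L _ _).2.2 eqv.
  - exact: comm_Lam2_slot1.
  - apply/commr_sym/comm_slots => i j k l; rewrite mxE.
    by have /comm_lift := cuW J (Tmx I i j); apply.
  - apply: comm_Lam1_slot2 => h; apply/comm_Ap => x; last exact: comm_lift_sc.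
    by rewrite /lsc /GRing.comm -!(mlift_morph L _).2.2 csr.
  - exact: comm_Lam1_slot2.
  - by apply: comm_Lam1_slot2 => h; apply: comm_lift_genmx.
split=> [c phi|c I J]; last by apply/comm_slots => i j k l; rewrite !mxE.
elim/dual_span: phi => [psi|k f1 f2 h1 h2 psi|i j psi].
- by rewrite (lin0 ul); apply: commr_sym; apply: commr0.
- by apply/commr_sym; rewrite ul; apply: commrD; [|apply/commr_sym];
    rewrite ?/GRing.comm -?pzscaleAl -?pzscaleAr ?h1 ?h2.
elim/dual_span: psi => [|k f1 f2 h1 h2|i' j'].
- by rewrite (lin0 vl); apply: commr0.
- rewrite vl; apply: commrD => //.
  by rewrite /GRing.comm -pzscaleAl -pzscaleAr h1.
- by have /comm_slots/(_ i j i' j') := c (regular_mod H) (regular_mod H); rewrite !mxE.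
Qed.

End Coefficients.
End Twist.

(** Write h = S(k). By [conv_antipode] the left side is s(S k_1) p(S k_2) T; the hypothesis moves
    p(S k_2) across T at the cost of a factor s(k_2), which cancels against s(S k_1). *)
Lemma conv_slide (F : fieldType) (H : ribbonHopf F) (B : pzAlgType F)
    (p s : H -> B) (T : B) :
  alg_morphism p -> alg_morphism s -> commuting p s ->
  (forall k, p (antipode H k) * T
     = \tsum_(a, b <- comul H k) s a * T * p (antipode H b)) ->
  forall h, conv p s h * T = T * p h.
Proof.
move=> pm sm c tT h; pose t := p \o antipode H.
have tl : linear t := linear_comp (@antipode_linear F H) pm.1.
have sl : linear (s \o antipode H) := linear_comp (@antipode_linear F H) sm.1.
rewrite -[h](antipodeVK); set k := antipode_inv H h.
rewrite -[conv _ _ _]/((conv p s \o antipode H) k) conv_antipode //.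
rewrite /conv /Ap mulr_tsumr.
transitivity (\tsum_(k1, k' <- comul H k) \tsum_(k2, k3 <- comul H k')
    (s (antipode H k1) * s k2 * T * t k3)).
  apply: eq_tsum => a b; rewrite -mulrA [X in _ * X]tT mulr_tsuml.
  by apply: eq_tsum => x y; rewrite !mulrA.
rewrite -(comulA_trilin (f := fun a b c => s (antipode H a) * s b * T * t c)).
- rewrite -[RHS]/(T * t k) -[in RHS](counitl k) (linear_tsum _ _ tl) mulr_tsuml.
  apply: eq_tsum => k' k3; rewrite -!mulr_tsumr.
  rewrite -[\tsum_(_, _ <- _) _]/(conv (s \o antipode H) s k') conv_antil //.
  by rewrite /cunit -!pzscaleAl mul1r (linZ tl) pzscaleAr.
- move=> k0 u v b d; rewrite -![s (antipode H _)]/((s \o antipode H) _) sl !mulrDl.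
  by rewrite -!pzscaleAl.
- by move=> k0 u v b d; rewrite sm.1 mulrDr !mulrDl -pzscaleAr -!pzscaleAl.
- by move=> k0 u v b d; rewrite tl mulrDr -pzscaleAr.
Qed.

(** * The Heisenberg double *)

Section Heisenberg.
Variables (F : fieldType) (H : ribbonHopf F).
Local Notation Si := (antipode_inv H).
Local Notation dual := 'Hom(hopf_sort H, F^o).
Implicit Types (phi psi chi : dual) (h k : H) (x y : heis H).

Lemma heis_OH psi h : heis_O psi * heis_H h = psi \ox h.
Proof.
rewrite -[_ * _]/(hmul _ _) hmul_pure /hmulf comul1 tsum_pure; last first.
  split=> ? c u v; first by rewrite dtransrDr dmulDr pureDl.
  by rewrite mulrDl -scalerAl pureDr.
by rewrite dtransr1 dmul1r mul1r.
Qed.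

Lemma heis_O_linear : linear (@heis_O F H).
Proof. by move=> c phi psi; rewrite /heis_O pureDl. Qed.

Lemma heis_H_morph : alg_morphism (@heis_H F H).
Proof.
split; first by move=> c h k; rewrite /heis_H pureDr.
split=> // h k; rewrite -[RHS]/(hmul _ _) hmul_pure /hmulf.
transitivity (\tsum_(a, b <- comul H h) (counit H \ox ((counit H a *: b) * k) : heis H)).
  rewrite /heis_H -[in LHS](counitl h) (mulr_tsumr (A := H)).
  by rewrite (linear_tsum (h := fun t : H => counit H \ox t)) // => c u v;
    rewrite pureDr.
apply: eq_tsum => a b; rewrite dmul1l dtransr_counit -scalerAl.
by apply/matrixP => i j; rewrite !mxE !linearZ /= mulrCA mulrA.
Qed.

Lemma heis_HO h phi :
  heis_H h * heis_O phi
  = \tsum_(a, b <- comul H h) heis_O (dtransr phi a) * heis_H b.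
Proof.
rewrite -[LHS]/(hmul _ _) hmul_pure /hmulf; apply: eq_tsum => a b.
by rewrite heis_OH mulr1 dmul1l.
Qed.

Definition hact x chi : dual := \tsum_(psi, h <- x) dmul psi (dtransr chi h).

Lemma hact_linearl chi : linear (fun x => hact x chi).
Proof. by move=> c x y; rewrite /hact tsumDl. Qed.

Lemma hact_linearr x : linear (hact x).
Proof. by move=> c phi psi; apply: tsumDr => chi h; rewrite dtransrDl dmulDr. Qed.

Lemma heis_actE x chi : heis_act H x chi = hact x chi.
Proof.
pose D : lmodType F := 'End(dual).
pose f psi h : D := linfun (fun phi : dual => dmul psi (dtransr phi h)).
have fl : linear (fun x : heis H => \tsum_(psi, h <- x) f psi h : D).
  by move=> c u v; rewrite tsumDl.
have -> : heis_act H x = \tsum_(psi, h <- x) f psi h by rewrite /heis_act (linfunE fl).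
have el : linear (fun g : D => (g : 'End(dual)) chi : dual).
  by move=> c u v; rewrite add_lfunE scale_lfunE.
rewrite (linear_tsum f x el); apply: eq_tsum => psi h.
by rewrite linfunE // => c u v; rewrite dtransrDl dmulDr.
Qed.

Lemma hact_pure psi h chi : hact (psi \ox h) chi = dmul psi (dtransr chi h).
Proof.
rewrite /hact tsum_pure //; split=> [k c u v|phi c u v]; first by rewrite dmulDl.
by rewrite dtransrDr dmulDr.
Qed.

Lemma hact_O psi chi : hact (heis_O psi) chi = dmul psi chi.
Proof. by rewrite hact_pure dtransr1. Qed.

Lemma hact_H h chi : hact (heis_H h) chi = dtransr chi h.
Proof. by rewrite hact_pure dmul1l. Qed.

Lemma hact_tsum (V W : vectType F) (X : tens V W) (f : V -> W -> heis H) chi :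
  hact (\tsum_(a, b <- X) f a b) chi = \tsum_(a, b <- X) hact (f a b) chi.
Proof. exact: (linear_tsum f X (hact_linearl chi)). Qed.

Lemma hactM x y chi : hact (x * y) chi = hact x (hact y chi).
Proof.
move: x; apply: eq_tens_lin => [c u v|c u v|psi h].
- by rewrite mulrDl -pzscaleAl hact_linearl.
- by rewrite hact_linearl.
move: y; apply: eq_tens_lin => [c u v|c u v|phi k].
- by rewrite mulrDr -pzscaleAr hact_linearl.
- by rewrite hact_linearl hact_linearr.
rewrite -[_ * _]/(hmul _ _) hmul_pure /hmulf hact_tsum !hact_pure.
rewrite dtransr_dmul (linear_tsum (h := dmul psi)) => [|c u v]; last exact: dmulDr.
by apply: eq_tsum => a b; rewrite hact_pure dtransrM dmulA.
Qed.

(** If X = sum of psi ⊗ h acts by zero, testing on all forms gives sum psi(x_1) x_2 h = 0 for every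
    x ([ev1]). Multiplying by S^(-1)(x_3) removes x_2 and leaves sum psi(x) h = 0 ([ev2]), whence X
    = 0 in coordinates. *)
Lemma heis_act_inj : lker (heis_act H) == 0%VS.
Proof.
apply/eqP/vspaceP => X; rewrite memv0 memv_ker; apply/idP/idP => [|/eqP->]; last first.
  by rewrite linear0.
move=> /eqP aX0.
have ev0 (x : H) chi : \tsum_(psi, h <- X) \tsum_(a, b <- comul H x)
    (psi a * chi (b * h) : F^o) = 0.
  transitivity (hact X chi x); last by rewrite -heis_actE aX0 !lfunE.
  rewrite /hact (linear_tsum (h := fun g : dual => g x)) => [|c u v]; last first.
    by rewrite add_lfunE scale_lfunE.
  apply: eq_tsum => psi h; rewrite dmulE.
  by apply: eq_tsum => a b; rewrite dtransrE.
have sep (x : H) : (forall chi, chi x = 0) -> x = 0.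
  move=> x0; rewrite (coord_vbasis (memvf x)) big1 // => i _.
  have := x0 (linfun (coord (vbasis {:H}) i : H -> F^o)).
  by rewrite linfunE => [->|c u v]; rewrite ?scale0r ?linearP.
have ev1 (x : H) : \tsum_(psi, h <- X) \tsum_(a, b <- comul H x) (psi a *: (b * h)) = 0.
  apply: sep => chi; rewrite -[RHS](ev0 x chi).
  rewrite (linear_tsum (h := fun t : H => chi t)) => [|c u v]; last exact: linearP.
  apply: eq_tsum => psi h.
  rewrite (linear_tsum (h := fun t : H => chi t)) => [|c u v]; last exact: linearP.
  by apply: eq_tsum => a b; rewrite linearZ.
have ev2 (x : H) : \tsum_(psi, h <- X) (psi x *: h) = 0.
  transitivity (\tsum_(x1, x2 <- comul H x) Si x2 *
      (\tsum_(psi, h <- X) \tsum_(a, b <- comul H x1) (psi a *: (b * h)))); last first.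
    by rewrite /tsum; apply: big1 => i _; apply: big1 => j _;
      rewrite [X in _ * X]ev1 mulr0 scaler0.
  transitivity (\tsum_(x1, x2 <- comul H x) \tsum_(psi, h <- X)
      \tsum_(a, b <- comul H x1) (psi a *: (Si x2 * b * h))); last first.
    apply: eq_tsum => x1 x2; rewrite (mulr_tsuml (A := H)); apply: eq_tsum => psi h.
    rewrite (mulr_tsuml (A := H)); apply: eq_tsum => a b.
    by rewrite -scalerAr mulrA.
  rewrite tsum_exchange; apply: eq_tsum => psi h.
  rewrite (comulA_trilin (f := fun a b c => psi a *: (Si c * b * h))); first last.
  - by move=> c u v b d; rewrite linearP !mulrDl scalerDr -!scalerAl !scalerA mulrC.
  - move=> c u v b d; rewrite mulrDr !mulrDl scalerDr -scalerAr -scalerAl.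
    by rewrite !scalerA mulrC.
  - by move=> c u v b d; rewrite linearP scalerDl scalerA.
  rewrite -[in LHS](counitr x) (linear_tsum (h := fun t : H => psi t *: h)); last first.
    by move=> c u v; rewrite linearP scalerDl scalerA.
  apply: eq_tsum => a x'.
  transitivity (psi a *: ((\tsum_(b, c <- comul H x') Si c * b) * h)).
    by rewrite antipode_invl -scalerAl mul1r linearZ scalerA mulrC.
  rewrite (mulr_tsumr (A := H)) (linear_tsum (h := fun t : H => psi a *: t)) //.
  by move=> c u v; rewrite scalerDr !scalerA mulrC.
apply/eqP/matrixP => i j; rewrite !mxE.
have Xj : \sum_k X k j *: (vbasis {:dual})`_k = 0.
  apply/lfunP => x; rewrite sum_lfunE [RHS]lfunE.
  transitivity (coord (vbasis {:H}) j (\tsum_(psi, h <- X) (psi x *: h))); last first.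
    by rewrite ev2 linear0.
  rewrite /tsum linear_sum; apply: eq_bigr => k _; rewrite linear_sum (bigD1 j) //=.
  rewrite big1 ?addr0 => [|l nl]; rewrite !linearZ /= ?scale_lfunE.
    by rewrite coord_free ?(basis_free (vbasisP _)) // eqxx !mulr1.
  rewrite coord_free ?(basis_free (vbasisP _)) //.
  by rewrite (negPf nl) !mulr0.
have := congr1 (coord (vbasis {:dual}) i) Xj; rewrite linear0 => <-.
rewrite linear_sum (bigD1 i) //= big1 ?addr0 => [|l nl]; rewrite linearZ /=.
  by rewrite coord_free ?(basis_free (vbasisP _)) // eqxx mulr1.
by rewrite coord_free ?(basis_free (vbasisP _)) // (negPf nl) mulr0.
Qed.

Lemma dim_hom (U V : vectType F) : \dim {:'Hom(U, V)} = (\dim {:U} * \dim {:V})%N.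
Proof. by rewrite !dimvf. Qed.

Lemma dim_tens (U V : vectType F) : \dim {:tens U V} = (\dim {:U} * \dim {:V})%N.
Proof. by rewrite dimvf. Qed.

(** Injectivity and equality of dimensions, both (dim H)^2. This is what makes [heis_tilde], defined
    through an inverse linear map, act as intended ([hact_tilde]). *)
Lemma heis_act_surj : limg (heis_act H) = fullv.
Proof.
apply/eqP; rewrite eqEdim subvf /= limg_dim_eq ?(eqP heis_act_inj) ?capv0 //.
by rewrite dim_tens !dim_hom !dimvf /= muln1 leqnn.
Qed.

Lemma hact_inj x y : (forall chi, hact x chi = hact y chi) -> x = y.
Proof.
move=> e; have /lker0P hi := heis_act_inj; apply: hi.
by apply/lfunP => chi; rewrite !heis_actE.
Qed.

Lemma hact_tilde h chi : hact (heis_tilde h) chi = dtransl chi (Si h).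
Proof.
rewrite -heis_actE limg_lfunVK ?heis_act_surj ?memvf // linfunE //.
exact: dtransl_linear.
Qed.

Lemma heis_tilde_morph : alg_morphism (@heis_tilde F H).
Proof.
split; last split.
- move=> c h k; apply: hact_inj => chi.
  rewrite hact_linearl !hact_tilde; apply/lfunP => x.
  by rewrite add_lfunE scale_lfunE !dtranslE linearP mulrDl -scalerAl linearP.
- apply: hact_inj => chi; rewrite hact_tilde -[RHS]/(hact (heis_O (counit H)) chi) hact_O.
  by rewrite dmul1l; apply/lfunP => x; rewrite dtranslE antipode_inv1 mul1r.
- move=> h k; apply: hact_inj => chi; rewrite hactM !hact_tilde.
  by apply/lfunP => x; rewrite !dtranslE antipode_invM mulrA.
Qed.

Lemma commuting_tilde_H : commuting (@heis_tilde F H) (@heis_H F H).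
Proof.
move=> h k; apply: hact_inj => chi; rewrite !hactM !hact_tilde !hact_H.
by apply/lfunP => x; rewrite !(dtranslE, dtransrE) mulrA.
Qed.

Lemma heis_tildeO k phi :
  heis_tilde (antipode H k) * heis_O phi
  = \tsum_(a, b <- comul H k) heis_O (dtransl phi a) * heis_tilde (antipode H b).
Proof.
apply: hact_inj => chi; rewrite hact_tsum hactM hact_tilde antipodeK.
rewrite hact_O; apply/lfunP => x; rewrite dtranslE dmulE.
rewrite (comul_mul_tsum (f := fun a b => phi a * chi b : F^o)); last first.
  split=> [y|y] c u v; rewrite linearP; first by rewrite mulrDl -scalerAl.
  by rewrite mulrDr -scalerAr.
rewrite (linear_tsum (h := fun f : dual => f x)) => [|c u v]; last first.
  by rewrite add_lfunE scale_lfunE.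
apply: eq_tsum => a b; rewrite hactM hact_tilde antipodeK hact_O dmulE.
by apply: eq_tsum => c d; rewrite !dtranslE.
Qed.

Section Matrices.
Variable I : hmod H.
Local Notation T := (genmx (@heis_O F H) I).
Local Notation lscH := (lsc (mdim I) (@heis_H F H)).
Local Notation lscT := (lsc (mdim I) (@heis_tilde F H)).
Local Notation sc := (scal (heis H) I).

Lemma amat_tsum (L : pzAlgType F) d (V W : vectType F) (X : tens V W)
    (f : V -> W -> amat L d) i j :
  (\tsum_(a, b <- X) f a b) i j = \tsum_(a, b <- X) f a b i j.
Proof.
apply: (linear_tsum (h := fun M : amat L d => M i j)).
by move=> c M N; rewrite mxE amatZE.
Qed.

Lemma mul_Tscal h i j : (T * sc h) i j = heis_O (dtransr (Tmx I i j) h).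
Proof.
rewrite -[T * _]/(_ *m _) mxE.
have -> : dtransr (Tmx I i j) h = \sum_k mrep I h k j *: Tmx I i k.
  apply/lfunP => x; rewrite dtransrE TmxE mrepM mxE sum_lfunE.
  by apply: eq_bigr => k _; rewrite scale_lfunE TmxE mulrC.
rewrite (big_morph _ (linD heis_O_linear) (lin0 heis_O_linear)).
apply: eq_bigr => k _; rewrite (linZ heis_O_linear) [T i k]mxE [sc h k j]mxE.
by rewrite -pzscaleAr mulr1.
Qed.

Lemma mul_scalT h i j : (sc h * T) i j = heis_O (dtransl (Tmx I i j) h).
Proof.
rewrite -[sc h * _]/(_ *m _) mxE.
have -> : dtransl (Tmx I i j) h = \sum_k mrep I h i k *: Tmx I k j.
  apply/lfunP => x; rewrite dtranslE TmxE mrepM mxE sum_lfunE.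
  by apply: eq_bigr => k _; rewrite scale_lfunE TmxE.
rewrite (big_morph _ (linD heis_O_linear) (lin0 heis_O_linear)).
apply: eq_bigr => k _; rewrite (linZ heis_O_linear) [T k j]mxE [sc h i k]mxE.
by rewrite -pzscaleAl mul1r.
Qed.

Lemma lscH_T h : lscH h * T = T * conv sc lscH h.
Proof.
rewrite /conv /Ap mulr_tsuml; apply/matrixP => i j.
rewrite mul_liftl mxE heis_HO amat_tsum; apply: eq_tsum => a b.
by rewrite mulrA mul_liftr mul_Tscal.
Qed.

(** The tilde of S(k) acts by the left translation phi(k ?), which distributes over a product of
    forms along the coproduct of k ([heis_tildeO]); [conv_slide] converts this into the stated
    form. *)
Lemma lscT_T h : conv lscT sc h * T = T * lscT h.
Proof.
have tT k : lscT (antipode H k) * T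
    = \tsum_(a, b <- comul H k) sc a * T * lscT (antipode H b).
  apply/matrixP => i j; rewrite mul_liftl mxE heis_tildeO amat_tsum.
  by apply: eq_tsum => a b; rewrite mul_liftr mul_scalT.
apply: (conv_slide (p := lscT)) tT h; last exact: commuting_lsc_scal.
  exact: (lsc_morph _ heis_tilde_morph).
exact: scal_morph.
Qed.

End Matrices.
End Heisenberg.

(** * The isomorphisms Psi and the moment maps *)

Section HandleCalculus.
Variables (F : fieldType) (H : ribbonHopf F) (B : pzAlgType F).
Variables f1 f2 f3 : H -> B.
Hypotheses (m1 : alg_morphism f1) (m2 : alg_morphism f2) (m3 : alg_morphism f3).
Hypotheses (c12 : commuting f1 f2) (c13 : commuting f1 f3) (c23 : commuting f2 f3).

Let c21 := commutingC c12.
Let c31 := commutingC c13.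
Let c32 := commutingC c23.
Let l1 := m1.1.
Let l2 := m2.1.
Let l3 := m3.1.

(** The morphisms [f1] and [f2] are the actions on the two modules and [f3] maps into the algebra,
    so that R_13 R_31 is the matrix L^(+) L^(-)-1 in the first slot. Two uses of Yang-Baxter reorder
    the factors. *)
Lemma fusion_loop :
  Rel (conv f1 f2) f3 * Rel f3 (conv f1 f2)
  = Rel f1 f3 * Rel f3 f1 * Rel f2 f1 * (Rel f2 f3 * Rel f3 f2) * Rinv f2 f1.
Proof.
have [_ RR'] := RinvP m2 m1 c21.
rewrite Rel_convl // Rel_convr //.
transitivity (Rel f1 f3 * (Rel f3 f1 * Rel f2 f1 * Rel f2 f3) * Rel f3 f2 * Rinv f2 f1);
  last by rewrite !mulrA.
rewrite -(YBE m2 m3 m1 c23 c21 c31).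
transitivity (Rel f1 f3 * Rel f2 f3 * (Rel f2 f1 * Rel f3 f1 * Rel f3 f2) * Rinv f2 f1);
  last by rewrite !mulrA.
by rewrite -(YBE m3 m2 m1 c32 c31 c21) -!mulrA RR' mulr1.
Qed.

Section Translated.
Variables t1 t2 : B.
Hypotheses (ct1 : forall h, GRing.comm (f2 h) t1) (ct2 : forall h, GRing.comm (f1 h) t2).
Hypotheses (h1 : forall h, f3 h * t1 = t1 * conv f1 f3 h)
           (h2 : forall h, f3 h * t2 = t2 * conv f2 f3 h).

Let r23t1 : Rel f2 f3 * t1 = t1 * (Rel f2 f3 * Rel f2 f1).
Proof.
rewrite -Rel_convr // {1}/Rel /Ap mulr_tsumr mulr_tsuml; apply: eq_tsum => a b.
by rewrite -mulrA h1 !mulrA ct1.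
Qed.

Let r32t1 : Rel f3 f2 * t1 = t1 * (Rel f1 f2 * Rel f3 f2).
Proof.
rewrite -Rel_convl // {1}/Rel /Ap mulr_tsumr mulr_tsuml; apply: eq_tsum => a b.
by rewrite -mulrA ct1 mulrA h1 mulrA.
Qed.

Let r31t2 : Rel f3 f1 * t2 = t2 * (Rel f2 f1 * Rel f3 f1).
Proof.
rewrite -Rel_convl // {1}/Rel /Ap mulr_tsumr mulr_tsuml; apply: eq_tsum => a b.
by rewrite -mulrA ct2 mulrA h2 mulrA.
Qed.

(** Here [t1], [t2] stand for T_1, T_2, and [h1], [h2] are the relation h psi = psi(? h') h'' in
    matrix form. Moving an R-matrix with a leg in H past T creates one more factor acting on the
    modules only, such as R_21; these supply what the Yang-Baxter moves of [fusion_loop] need. *)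
Lemma fusion_translated :
  Rel (conv f1 f2) f3 * (t1 * t2) * Rel f3 (conv f1 f2)
  = Rel f1 f3 * t1 * Rel f3 f1 * Rel f2 f1 * (Rel f2 f3 * t2 * Rel f3 f2)
    * Rinv f2 f1.
Proof.
have [_ RR'] := RinvP m2 m1 c21.
rewrite Rel_convl // Rel_convr //.
transitivity (Rel f1 f3 * t1 * (Rel f3 f1 * Rel f2 f1 * Rel f2 f3) * t2 * Rel f3 f2
  * Rinv f2 f1); last by rewrite !mulrA.
rewrite -(YBE m2 m3 m1 c23 c21 c31).
transitivity (Rel f1 f3 * (t1 * (Rel f2 f3 * Rel f2 f1)) * (Rel f3 f1 * t2) * Rel f3 f2
  * Rinv f2 f1); last by rewrite !mulrA.
rewrite -r23t1 r31t2.
transitivity (Rel f1 f3 * Rel f2 f3 * t1 * t2 * (Rel f2 f1 * Rel f3 f1 * Rel f3 f2)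
  * Rinv f2 f1); last by rewrite !mulrA.
by rewrite -(YBE m3 m2 m1 c32 c31 c21) -!mulrA RR' mulr1.
Qed.

Lemma handle_translated :
  Rel f1 f2 * (Rel f1 f3 * t1 * Rel f3 f1) * Rel f2 f1 * (Rel f2 f3 * Rel f3 f2)
  = Rel f2 f3 * Rel f3 f2 * Rel f1 f2 * (Rel f1 f3 * t1 * Rel f3 f1) * Rinv f1 f2.
Proof.
have [_ RR'] := RinvP m1 m2 c12.
transitivity (Rel f1 f2 * Rel f1 f3 * t1 * (Rel f3 f1 * Rel f2 f1 * Rel f2 f3) * Rel f3 f2);
  first by rewrite !mulrA.
rewrite -(YBE m2 m3 m1 c23 c21 c31).
transitivity (Rel f1 f2 * Rel f1 f3 * (t1 * (Rel f2 f3 * Rel f2 f1)) * Rel f3 f1 * Rel f3 f2);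
  first by rewrite !mulrA.
rewrite -r23t1.
transitivity (Rel f1 f2 * Rel f1 f3 * Rel f2 f3 * t1 * Rel f3 f1 * Rel f3 f2);
  first by rewrite !mulrA.
rewrite (YBE m1 m2 m3 c12 c13 c23).
transitivity (Rel f2 f3 * (Rel f3 f2 * Rel f1 f2 * Rel f1 f3) * t1 * Rel f3 f1 * Rinv f1 f2);
  last by rewrite !mulrA.
rewrite -(YBE m1 m3 m2 c13 c12 c32).
transitivity (Rel f2 f3 * Rel f1 f3 * Rel f1 f2 * (Rel f3 f2 * t1) * Rel f3 f1 * Rinv f1 f2);
  last by rewrite !mulrA.
rewrite r32t1.
transitivity (Rel f2 f3 * Rel f1 f3 * Rel f1 f2 * t1 * (Rel f1 f2 * Rel f3 f2 * Rel f3 f1)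
  * Rinv f1 f2); last by rewrite !mulrA.
have <- : Rel f3 f1 * Rel f3 f2 * Rel f1 f2 = Rel f1 f2 * Rel f3 f2 * Rel f3 f1.
  exact: (YBE m3 m1 m2 c31 c32 c12).
by rewrite -!mulrA RR' mulr1.
Qed.

End Translated.

Lemma loop_equivariant (p : H -> B) h : alg_morphism p ->
  commuting p f1 -> commuting p f3 ->
  GRing.comm (conv (conv p f3) f1 h) (Rel f1 f3 * Rel f3 f1).
Proof.
move=> pm p1 p3; have pl := pm.1; rewrite convA // /conv; apply/commr_sym.
apply: comm_Ap => x; apply/commr_sym.
  by apply: commrM; apply: comm_Rel => y; [apply: p1|apply: p3|apply: p3|apply: p1].
by rewrite /GRing.comm mulrA -(Rel_intertwine x m1 m3 c13) -!mulrA (Rel_intertwine x m3 m1).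
Qed.

(** The R-matrices on the two sides exchange the factors [f1] and [f3] of the iterated coproduct.
    Between them t commutes with p(h') f1(h'') f3(h'''): the factor f1 absorbed by [hp] is the one
    that [h3] restores. *)
Lemma translated_equivariant (p : H -> B) t h : alg_morphism p ->
  commuting p f1 -> commuting p f3 ->
  (forall x, f3 x * t = t * conv f1 f3 x) -> (forall x, conv p f1 x * t = t * p x) ->
  GRing.comm (conv (conv p f3) f1 h) (Rel f1 f3 * t * Rel f3 f1).
Proof.
move=> pm p1 p3 h3 hp; have pl := pm.1.
have push (q : H -> B) r :
    conv p q h * r = \tsum_(a, b <- comul H h) (p a * (q b * r)).
  by rewrite /conv /Ap mulr_tsumr; apply: eq_tsum => a b; rewrite mulrA.
have pull (q : H -> B) r : (forall x, GRing.comm (p x) r) ->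
    r * conv p q h = \tsum_(a, b <- comul H h) (p a * (r * q b)).
  move=> c; rewrite /conv /Ap mulr_tsuml; apply: eq_tsum => a b.
  by rewrite mulrA -c mulrA.
have cp13 x : GRing.comm (p x) (Rel f1 f3) by apply: comm_Rel => y; [apply: p1|apply: p3].
have cp31 x : GRing.comm (p x) (Rel f3 f1) by apply: comm_Rel => y; [apply: p3|apply: p1].
have e13 : Rel f1 f3 * conv p (conv f1 f3) h = conv p (conv f3 f1) h * Rel f1 f3.
  rewrite pull // push; apply: eq_tsum => a b; congr (_ * _).
  exact: Rel_intertwine.
have e31 : Rel f3 f1 * conv p (conv f3 f1) h = conv p (conv f1 f3) h * Rel f3 f1.
  rewrite pull // push; apply: eq_tsum => a b; congr (_ * _).
  exact: Rel_intertwine.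
have et : conv p (conv f1 f3) h * t = t * conv p (conv f1 f3) h.
  transitivity (conv (conv p f1) f3 h * t); first by rewrite convA.
  transitivity (\tsum_(a, b <- comul H h) (conv p f1 a * (t * conv f1 f3 b))).
    rewrite [in LHS]/conv [in LHS]/Ap mulr_tsumr; apply: eq_tsum => a b.
    by rewrite -mulrA h3.
  have -> : t * conv p (conv f1 f3) h
      = \tsum_(a, b <- comul H h) t * (p a * conv f1 f3 b) by exact: mulr_tsuml.
  by apply: eq_tsum => a b; rewrite mulrA hp mulrA.
rewrite convA // /GRing.comm.
transitivity (Rel f1 f3 * conv p (conv f1 f3) h * t * Rel f3 f1).
  by rewrite e13 !mulrA.
by rewrite -[_ * conv _ _ _ * t]mulrA et -!mulrA e31.
Qed.

End HandleCalculus.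

(** * The systems in an algebra acted on by H that define the Psi morphisms *)

Section LoopSystem.
Variables (F : fieldType) (H : ribbonHopf F) (L : pzAlgType F).
Local Notation dual := 'Hom(hopf_sort H, F^o).
Implicit Types (I J : hmod H).
Variable r : H -> L.
Hypothesis rm : alg_morphism r.

(** For [r] the identity this is the bijection of factorizability, and its matrix is L^(+) L^(-)-1
    ([genmx_loop]). *)
Definition loop (phi : dual) : L :=
  \tsum_(x, y <- tmul (Rmat H) (tflip (Rmat H))) (phi x : F) *: r y.

Lemma loop_linear : linear loop.
Proof.
by move=> c phi psi; apply: tsumDr => a b; rewrite add_lfunE scale_lfunE scalerDl scalerA.
Qed.

Lemma genmx_loop I :
  genmx loop I = Rel (scal L I) (lsc _ r) * Rel (lsc _ r) (scal L I).
Proof.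
have sm := scal_morph L I; have lm := lsc_morph (mdim I) rm.
have c := commutingC (@commuting_lsc_scal _ _ L r I).
have -> : Rel (lsc _ r) (scal L I) = Ap (tflip (Rmat H)) (scal L I) (lsc _ r).
  by rewrite Ap_flip //; [case: sm|case: lm].
rewrite -Ap_mul //; apply/matrixP => i j; rewrite mxE /Ap amat_tsum.
by apply: eq_tsum => a b; rewrite mul_liftr TmxE mxE -pzscaleAl mul1r.
Qed.

Lemma slot1_Rel I J (f g : H -> amat L (mdim I)) :
  slot1 (mdim J) (Rel f g) = Rel (slot1 (mdim J) \o f) (slot1 (mdim J) \o g).
Proof. by apply: alg_Ap; apply: slot1_morph. Qed.
Lemma slot2_Rel I J (f g : H -> amat L (mdim J)) :
  slot2 (mdim I) (Rel f g) = Rel (slot2 (mdim I) \o f) (slot2 (mdim I) \o g).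
Proof. by apply: alg_Ap; apply: slot2_morph. Qed.

Lemma slot1_loop I J : slot1 (mdim J) (genmx loop I)
  = Rel (scal1 L I J) (lsc _ r) * Rel (lsc _ r) (scal1 L I J).
Proof.
rewrite genmx_loop (slot1_morph _ _ _).2.2 !(@slot1_Rel I J).
by congr (_ * _); apply: eq_Ap => // h; apply: slot1_lsc.
Qed.
Lemma slot2_loop I J : slot2 (mdim I) (genmx loop J)
  = Rel (scal2 L I J) (lsc _ r) * Rel (lsc _ r) (scal2 L I J).
Proof.
rewrite genmx_loop (slot2_morph _ _ _).2.2 !(@slot2_Rel I J).
by congr (_ * _); apply: eq_Ap => // h; apply: slot2_lsc.
Qed.

Let m1 := @scal1_morph _ H L.
Let m2 := @scal2_morph _ H L.
Let m3 d := lsc_morph d rm.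
Let c12 := @commuting_scal _ H L.
Let c13 I J := commutingC (@commuting_lsc_scal1 _ _ L r I J).
Let c23 I J := commutingC (@commuting_lsc_scal2 _ _ L r I J).

Lemma Rel_mtens I J :
  Rel (scal L (mtens I J)) (lsc _ r) = Rel (conv (scal1 L I J) (scal2 L I J)) (lsc _ r).
Proof. by apply: eq_Ap => // h; apply: scal_mtens. Qed.
Lemma Rel_mtensV I J :
  Rel (lsc _ r) (scal L (mtens I J)) = Rel (lsc _ r) (conv (scal1 L I J) (scal2 L I J)).
Proof. by apply: eq_Ap => // h; apply: scal_mtens. Qed.

Lemma loop_fusion : fusion_eq loop.
Proof.
move=> I J; rewrite slot1_loop slot2_loop genmx_loop Rel_mtens Rel_mtensV.
exact: fusion_loop (m1 I J) (m2 I J) (m3 _) (@c12 I J) (@c13 I J) (@c23 I J).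
Qed.

Lemma scal_mtriv h : scal L (mtriv H) h = cunit _ h.
Proof.
by apply/matrixP => i j; rewrite !mxE !ord1 eqxx !mulr1n.
Qed.

Lemma Rel_mtriv : Rel (scal L (mtriv H)) (lsc _ r) = 1.
Proof. by rewrite -[RHS](Rel_cunitl (m3 1)); apply: eq_Ap => //; apply: scal_mtriv. Qed.
Lemma Rel_mtrivV : Rel (lsc _ r) (scal L (mtriv H)) = 1.
Proof. by rewrite -[RHS](Rel_cunitr (m3 1)); apply: eq_Ap => //; apply: scal_mtriv. Qed.

Lemma loop_triv : loop (counit H) = 1.
Proof.
have : genmx loop (mtriv H) = 1.
  by rewrite genmx_loop Rel_mtriv Rel_mtrivV mulr1.
by rewrite genmx_mtriv => /matrixP/(_ ord0 ord0); rewrite !mxE eqxx.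
Qed.

Lemma equivariant_loop (p : H -> L) : alg_morphism p -> commuting p r ->
  equivariant (conv p r) loop.
Proof.
move=> pm pr I h; rewrite genmx_loop.
rewrite (_ : conv _ _ h = conv (conv (lsc _ p) (lsc _ r)) (scal L I) h); last first.
  apply: eq_Ap => // x; rewrite /lsc /conv alg_Ap //; exact: mlift_morph.
apply: loop_equivariant.
- exact: scal_morph.
- exact: lsc_morph.
- exact/commutingC/commuting_lsc_scal.
- exact: lsc_morph.
- exact: commuting_lsc_scal.
- by move=> x y; rewrite /lsc /GRing.comm -!(mlift_morph L _).2.2 pr.
Qed.

Section WithTranslation.
Variable u0 : dual -> L.
Hypothesis ul : linear u0.
Hypothesis u0_triv : u0 (counit H) = 1.
Hypothesis u0_mtens : forall I J,
  genmx u0 (mtens I J) = slot1 (mdim J) (genmx u0 I) * slot2 (mdim I) (genmx u0 J).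
Hypothesis u0_shift : forall I h,
  lsc _ r h * genmx u0 I = genmx u0 I * conv (scal L I) (lsc _ r) h.

Definition tloop : dual -> L := sandwich u0 r (tflip (Rmat H)) (Rmat H).

Lemma tloop_linear : linear tloop.
Proof. exact: sandwich_linear. Qed.

Lemma genmx_tloop I : genmx tloop I
  = Rel (scal L I) (lsc _ r) * genmx u0 I * Rel (lsc _ r) (scal L I).
Proof.
rewrite genmx_sandwich // Ap_flip //; first last.
- exact: commuting_lsc_scal.
- exact: (scal_morph L I).1.
- exact: (lsc_morph _ rm).1.
Qed.

Lemma slot1_tloop I J : slot1 (mdim J) (genmx tloop I)
  = Rel (scal1 L I J) (lsc _ r) * slot1 _ (genmx u0 I) * Rel (lsc _ r) (scal1 L I J).
Proof.
rewrite genmx_tloop !(slot1_morph _ _ _).2.2 !(@slot1_Rel I J).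
by congr (_ * _ * _); apply: eq_Ap => // h; apply: slot1_lsc.
Qed.
Lemma slot2_tloop I J : slot2 (mdim I) (genmx tloop J)
  = Rel (scal2 L I J) (lsc _ r) * slot2 _ (genmx u0 J) * Rel (lsc _ r) (scal2 L I J).
Proof.
rewrite genmx_tloop !(slot2_morph _ _ _).2.2 !(@slot2_Rel I J).
by congr (_ * _ * _); apply: eq_Ap => // h; apply: slot2_lsc.
Qed.

Let shift1 I J h : lsc _ r h * slot1 (mdim J) (genmx u0 I)
  = slot1 _ (genmx u0 I) * conv (scal1 L I J) (lsc _ r) h.
Proof.
rewrite -slot1_lsc -(slot1_morph _ _ _).2.2 u0_shift (slot1_morph _ _ _).2.2.
congr (_ * _); rewrite /conv alg_Ap; last exact: slot1_morph.
by apply: eq_Ap => // x; apply: slot1_lsc.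
Qed.
Let shift2 I J h : lsc _ r h * slot2 (mdim I) (genmx u0 J)
  = slot2 _ (genmx u0 J) * conv (scal2 L I J) (lsc _ r) h.
Proof.
rewrite -slot2_lsc -(slot2_morph _ _ _).2.2 u0_shift (slot2_morph _ _ _).2.2.
congr (_ * _); rewrite /conv alg_Ap; last exact: slot2_morph.
by apply: eq_Ap => // x; apply: slot2_lsc.
Qed.

Lemma tloop_fusion : fusion_eq tloop.
Proof.
move=> I J; rewrite slot1_tloop slot2_tloop genmx_tloop Rel_mtens Rel_mtensV u0_mtens.
apply: fusion_translated (m1 I J) (m2 I J) (m3 _) (@c12 I J) (@c13 I J) (@c23 I J) _ _ _ _ _ _.
- by move=> h; apply: comm_scal_slot1.
- by move=> h; apply: comm_scal_slot2.
- exact: shift1.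
- exact: shift2.
Qed.

Lemma tloop_handle : handle_eq tloop loop.
Proof.
move=> I J; rewrite slot1_tloop slot2_loop.
apply: handle_translated (m1 I J) (m2 I J) (m3 _) (@c12 I J) (@c13 I J) (@c23 I J) _ _ _.
- by move=> h; apply: comm_scal_slot1.
- exact: shift1.
Qed.

Lemma tloop_triv : tloop (counit H) = 1.
Proof.
have : genmx tloop (mtriv H) = 1.
  rewrite genmx_tloop Rel_mtriv Rel_mtrivV mul1r mulr1 genmx_mtriv u0_triv.
  exact: (mlift_morph L 1).2.1.
by rewrite genmx_mtriv => /matrixP/(_ ord0 ord0); rewrite !mxE eqxx.
Qed.

Lemma equivariant_tloop (p : H -> L) : alg_morphism p -> commuting p r ->
  (forall I h, conv (lsc _ p) (scal L I) h * genmx u0 I = genmx u0 I * lsc _ p h) ->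
  equivariant (conv p r) tloop.
Proof.
move=> pm pr hp I h; rewrite genmx_tloop.
rewrite (_ : conv _ _ h = conv (conv (lsc _ p) (lsc _ r)) (scal L I) h); last first.
  apply: eq_Ap => // x; rewrite /lsc /conv alg_Ap //; exact: mlift_morph.
apply: translated_equivariant; first last.
- exact: hp.
- exact: u0_shift.
- by move=> x y; rewrite /lsc /GRing.comm -!(mlift_morph L _).2.2 pr.
- exact: commuting_lsc_scal.
- exact: lsc_morph.
- exact/commutingC/commuting_lsc_scal.
- exact: lsc_morph.
- exact: scal_morph.
Qed.

End WithTranslation.
End LoopSystem.

(** * Spanning sets obtained from the fusion and handle relations *)

Section Spanning.
Variables (F : fieldType) (H : ribbonHopf F) (L : pzAlgType F).
Local Notation dual := 'Hom(hopf_sort H, F^o).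
Implicit Types (I J : hmod H).

Section Subspace.
Variable P : L -> Prop.
Hypotheses (P0 : P 0) (PL : forall (c : F) x y, P x -> P y -> P (c *: x + y)).

Definition inP d (M : amat L d) := forall i j, P (M i j).

Lemma subspace_sum T (r : seq T) (G : T -> L) :
  (forall i, P (G i)) -> P (\sum_(i <- r) G i).
Proof.
move=> PG; elim/big_ind: _ => // x y Px Py.
by have := PL 1 Px Py; rewrite scale1r.
Qed.

Lemma subspace_scale c x : P x -> P (c *: x).
Proof. by move=> Px; have := PL c Px P0; rewrite addr0. Qed.

Lemma subspace_tsum (V W : vectType F) (X : tens V W) (f : V -> W -> L) :
  (forall a b, P (f a b)) -> P (\tsum_(a, b <- X) f a b).
Proof.
by move=> Pf; do 2!apply: subspace_sum => ?; apply: subspace_scale.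
Qed.

Lemma inP_mscl d (N : 'M[F]_d) (M : amat L d) : inP M -> inP (msc L N * M).
Proof.
move=> PM i j; rewrite -[_ * _]/(_ *m _) mxE; apply: subspace_sum => k.
by rewrite mxE -pzscaleAl mul1r; apply: subspace_scale.
Qed.

Lemma inP_mscr d (N : 'M[F]_d) (M : amat L d) : inP M -> inP (M * msc L N).
Proof.
move=> PM i j; rewrite -[_ * _]/(_ *m _) mxE; apply: subspace_sum => k.
by rewrite [X in _ * X]mxE -pzscaleAr mulr1; apply: subspace_scale.
Qed.

Lemma inP_tsum d (V W : vectType F) (X : tens V W) (f : V -> W -> amat L d) :
  (forall a b, inP (f a b)) -> inP (\tsum_(a, b <- X) f a b).
Proof. by move=> Pf i j; rewrite amat_tsum; apply: subspace_tsum => a b; apply: Pf. Qed.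

Lemma scal1_msc I J h : scal1 L I J h = msc L (tensmx (mrep I h) 1%:M).
Proof. by rewrite msc_tens msc1 (slot2_morph L _ _).2.1 mulr1. Qed.
Lemma scal2_msc I J h : scal2 L I J h = msc L (tensmx 1%:M (mrep J h)).
Proof. by rewrite msc_tens msc1 (slot1_morph L _ _).2.1 mul1r. Qed.

(** The legs of a second R act from outside: one in the second slot passes M_1, the other in the
    first slot passes M_2, and together they cancel the inner R'. These factors are scalar matrices,
    so entries stay in the subspace P. *)
Lemma uncross I J (M1 : amat L (mdim I)) (M2 : amat L (mdim J)) :
  inP (slot1 (mdim J) M1 * Rel (scal2 L I J) (scal1 L I J) * slot2 (mdim I) M2) ->
  inP (slot1 (mdim J) M1 * slot2 (mdim I) M2).
Proof.
set M := _ * _ * _ => PM.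
have -> : slot1 (mdim J) M1 * slot2 (mdim I) M2
    = \tsum_(c, d <- Rmat H) scal2 L I J c * M * scal1 L I J (antipode H d).
  have m1 := scal1_morph L I J; have m2 := scal2_morph L I J.
  rewrite -[slot1 _ _]mulr1 -(Rel_crossed m2 m1) mulr_tsuml mulr_tsumr.
  apply: eq_tsum => c d; rewrite mulr_tsuml mulr_tsumr.
  rewrite /M [Rel _ _]/Rel /Ap mulr_tsuml mulr_tsumr mulr_tsuml mulr_tsumr.
  apply: eq_tsum => a b; rewrite m2.2.2 m1.2.2 !mulrA.
  rewrite -[in LHS](@comm_scal_slot1 _ _ L I J c M1) -!mulrA; do 4!congr (_ * _).
  exact: comm_scal_slot2.
apply: inP_tsum => c d; rewrite scal1_msc scal2_msc.
by apply/inP_mscr/inP_mscl.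
Qed.

End Subspace.

(** The fusion relation puts the entries of U_1 R' U_2 among linear combinations of values of u, and
    [uncross] removes R'. *)
Lemma fusion_product (u : dual -> L) : linear u -> fusion_eq u ->
  forall phi psi, exists chi, u phi * u psi = u chi.
Proof.
move=> ul uf.
pose P z := exists chi, z = u chi.
have P0 : P 0 by exists 0; rewrite (lin0 ul).
have PL (c : F) x y : P x -> P y -> P (c *: x + y).
  by move=> [f1 ->] [f2 ->]; exists (c *: f1 + f2); rewrite ul.
have PT i j k l :
    P (u (Tmx (regular_mod H) i j) * u (Tmx (regular_mod H) k l)).
  set I := regular_mod H.
  have hP : inP P (slot1 (mdim I) (genmx u I) * slot2 (mdim I) (genmx u I)).
    apply: (uncross P0 PL).
    have -> : slot1 (mdim I) (genmx u I) * Rel (scal2 L I I) (scal1 L I I)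
        * slot2 (mdim I) (genmx u I)
        = genmx u (mtens I I) * Rel (scal2 L I I) (scal1 L I I).
      by rewrite uf -[RHS]mulrA (r21_inv L I I).2 mulr1.
    rewrite -msc_R'; apply: (inP_mscr P0 PL) => p q.
    by exists (Tmx (mtens I I) p q); rewrite mxE.
  by have := hP (mxtens_index (i, k)) (mxtens_index (j, l)); rewrite mul_slotE !mxE.
move=> phi psi; elim/dual_span: phi => [|c f1 f2 h1 h2|i j].
- by rewrite (lin0 ul) mul0r.
- by rewrite ul mulrDl -pzscaleAl; apply: PL.
elim/dual_span: psi => [|c f1 f2 h1 h2|k l].
- by rewrite (lin0 ul) mulr0.
- by rewrite ul mulrDr -pzscaleAr; apply: PL.
exact: PT.
Qed.

Lemma handle_product (b a : dual -> L) (P : L -> Prop) :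
  linear b -> linear a -> handle_eq b a ->
  P 0 -> (forall (c : F) x y, P x -> P y -> P (c *: x + y)) ->
  (forall phi psi, P (a phi * b psi)) -> forall phi psi, P (b phi * a psi).
Proof.
move=> bl al h P0 PL Pab.
have PT i j k l :
    P (b (Tmx (regular_mod H) i j) * a (Tmx (regular_mod H) k l)).
  set I := regular_mod H.
  have hP : inP P (slot1 (mdim I) (genmx b I) * slot2 (mdim I) (genmx a I)).
    apply: (uncross P0 PL).
    have -> : slot1 (mdim I) (genmx b I) * Rel (scal2 L I I) (scal1 L I I)
        * slot2 (mdim I) (genmx a I)
      = Rinv (scal1 L I I) (scal2 L I I)
        * (slot2 (mdim I) (genmx a I) * Rel (scal1 L I I) (scal2 L I I)
           * slot1 (mdim I) (genmx b I) * Rinv (scal1 L I I) (scal2 L I I)).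
      by rewrite -h !mulrA (r12_inv L I I).2 mul1r.
    rewrite -msc_Rinv; apply: (inP_mscl P0 PL); apply: (inP_mscr P0 PL).
    rewrite -msc_R => p q; case: (mxtens_indexP p) => p1 p2.
    case: (mxtens_indexP q) => q1 q2.
    rewrite -[_ * slot1 _ _]/(_ *m _) mxE; apply: (subspace_sum P0 PL) => r.
    rewrite -[(_ * msc _ _) _ r]/((_ *m _) _ r) mxE mulr_suml.
    apply: (subspace_sum P0 PL) => s; rewrite [msc _ _ _ _]mxE -pzscaleAr mulr1.
    rewrite -pzscaleAl; apply: (subspace_scale P0 PL).
    case: (mxtens_indexP r) => r1 r2; case: (mxtens_indexP s) => s1 s2.
    by rewrite slot1E slot2E !mxE; do 2!case: eqP => _; rewrite ?mulr0n ?mulr1n ?mul0r ?mulr0.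
  by have := hP (mxtens_index (i, k)) (mxtens_index (j, l)); rewrite mul_slotE !mxE.
move=> phi psi; elim/dual_span: phi => [|c f1 f2 h1 h2|i j].
- by rewrite (lin0 bl) mul0r.
- by rewrite bl mulrDl -pzscaleAl; apply: PL.
elim/dual_span: psi => [|c f1 f2 h1 h2|k l].
- by rewrite (lin0 al) mulr0.
- by rewrite al mulrDr -pzscaleAr; apply: PL.
exact: PT.
Qed.

End Spanning.

(** * Bijectivity of the Psi morphisms and equivariance of the generators *)

Section Psi.
Variables (F : fieldType) (H : ribbonHopf F).
Local Notation dual := 'Hom(hopf_sort H, F^o).
Implicit Types (I J : hmod H).
Hypothesis factH : factorizable H.

Local Notation kM := (lM 0 (ord0 : 'I_1)).
Local Notation kA := (lA 0 (ord0 : 'I_1)).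
Local Notation kB := (lB 0 (ord0 : 'I_1)).

Lemma letter01 (k : letter 0 1) : k = kM.
Proof. by case: k => [[[]//]|j]; rewrite (ord1 j). Qed.

Lemma letter10 (k : letter 1 0) : k = kA \/ k = kB.
Proof. by case: k => [[i b]|[]//]; rewrite (ord1 i); case: b; [left|right]. Qed.

Lemma Lplus_Rel I : Lplus I = Rel (scal H I) (lsc _ (@id H)) :> amat H _.
Proof.
apply/matrixP => i j; rewrite mxE /Rel /Ap amat_tsum; apply: eq_tsum => a b.
by rewrite mul_liftr mxE -scalerAl mul1r.
Qed.

Lemma Lminus_Lam I : Lminus I = Lam (@id H) I.
Proof.
apply/matrixP => i j; rewrite mxE /Lam /Rinv /Rel /Ap amat_tsum; apply: eq_tsum => a b.
by rewrite mul_liftl mxE -scalerAr mulr1.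
Qed.

Lemma Ltilde_Lam I : Ltilde I = Lam (@heis_tilde F H) I.
Proof.
apply/matrixP => i j; rewrite mxE /Lam /Rinv /Rel /Ap amat_tsum; apply: eq_tsum => a b.
by rewrite mul_liftl mxE -pzscaleAr mulr1.
Qed.

Section MapLam.
Variables (L L' : pzAlgType F) (f : L -> L') (s : H -> L).
Hypothesis fm : alg_morphism f.

Lemma mmap_scal I h : mmap_amat f (scal L I h) = scal L' I h.
Proof. exact: mmap_sc. Qed.
Lemma mmap_lsc d h : mmap_amat f (lsc d s h) = lsc d (f \o s) h.
Proof. exact: mmap_lift. Qed.

Lemma mmap_Lam I : mmap_amat f (Lam s I) = Lam (f \o s) I.
Proof.
rewrite /Lam /Rinv /Rel mmap_Ap //; apply: eq_Ap => h; [exact: mmap_lsc|].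
exact: mmap_scal.
Qed.
Lemma mmap_LamV I : mmap_amat f (LamV s I) = LamV (f \o s) I.
Proof.
rewrite /LamV /Rel mmap_Ap //; apply: eq_Ap => h; [exact: mmap_lsc|].
exact: mmap_scal.
Qed.
End MapLam.

(** [LamV] follows the order of the convolution, because comultiplying the first leg of R gives R_13
    R_23; its inverse [Lam] reverses it. Thus a moment map convolved on the left contributes its
    factor of Lambda on the right. *)
Lemma Lam_conv (L : pzAlgType F) (p r : H -> L) I :
  alg_morphism p -> alg_morphism r -> commuting p r ->
  Lam (conv p r) I = Lam r I * Lam p I /\ LamV (conv p r) I = LamV p I * LamV r I.
Proof.
move=> pm rm pr; have sm := scal_morph L I.
have pm' := lsc_morph (mdim I) pm; have rm' := lsc_morph (mdim I) rm.
have e : LamV (conv p r) I = LamV p I * LamV r I.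
  rewrite /LamV -Rel_convl //; first last.
  - exact: commuting_lsc_scal.
  - exact: rm'.1.
  - exact: pm'.1.
  apply: eq_Ap => // x; rewrite /lsc /conv alg_Ap //; exact: mlift_morph.
split=> //; apply: (inv_uniq (x := LamV (conv p r) I)).
  by apply/inv_pair_sym/Lam_inv; apply: conv_morph.
by rewrite e; apply: inv_pairM; apply/inv_pair_sym/Lam_inv.
Qed.

Lemma sys01 : @Lsys F H H 0 1 (fun=> loop (@id H)).
Proof.
split=> [k|k|k|k l|[]//].
- exact: (loop_linear (@id H)).
- exact: loop_triv (alg_id H).
- exact: loop_fusion (alg_id H).
- by rewrite (letter01 k) (letter01 l) ltnn.
Qed.

Lemma ncinv_Lminus (L : pzAlgType F) (s : H -> L) I : alg_morphism s ->
  ncinvmx (Lam s I) = LamV s I.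
Proof. by move=> sm; have [h1 h2] := Lam_inv I sm; apply: ncinvmxE. Qed.

(** Replaces the matrix condition over all modules by one on linear forms. With [Lgn_hom] it shows
    that the selection defining [Psi01] has something to select. *)
Lemma is_Psi01E (f : Lgn H 0 1 -> H) :
  is_Psi01 f <-> alg_morphism f /\ forall phi, f (lgen kM phi) = loop (@id H) phi.
Proof.
have val I : Lplus I *m ncinvmx (Lminus I) = genmx (loop (@id H)) I.
  rewrite Lplus_Rel Lminus_Lam ncinv_Lminus; last exact: alg_id.
  by rewrite (genmx_loop (alg_id H)).
split=> -[fm fv]; split=> //; last first.
  move=> I; rewrite val; apply/matrixP => i j; rewrite !mxE; exact: fv.
apply: genmx_inj.
- exact: (linear_comp (sys_linear (lgen_sys H 0 1) kM) fm.1).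
- exact: (loop_linear (@id H)).
by move=> I; rewrite -val -fv; apply/matrixP => i j; rewrite !mxE.
Qed.

Lemma Psi01P : is_Psi01 (@Psi01 F H).
Proof.
have [f [fm fv]] := Lgn_hom sys01.
have fP : is_Psi01 f by apply/is_Psi01E.
rewrite /Psi01; case: xgetP => [//|/(_ (f : {classic _}))]; by move=> /(_ fP).
Qed.

Let Psi01m : alg_morphism (@Psi01 F H) := (proj1 (is_Psi01E _) Psi01P).1.

Lemma Lgn01_span z : exists phi, z = lgen (H := H) kM phi.
Proof.
have sys := lgen_sys H 0 1; have ul := sys_linear sys kM.
elim/Lgn_ind: z => [|c x y [f1 ->] [f2 ->]|k phi y [psi ->]].
- by exists (counit H); rewrite (sys_trivial sys).
- by exists (c *: f1 + f2); rewrite ul.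
- rewrite (letter01 k); have [chi e] := fusion_product ul (sys_fusion sys kM) phi psi.
  by exists chi.
Qed.

Lemma Psi01_bij : bijective (@Psi01 F H).
Proof.
have v := (proj1 (is_Psi01E _) Psi01P).2; have [g gK Kg] := factH.
exists (fun h => lgen kM (g h)) => [z|h].
  have [phi ->] := Lgn01_span z; rewrite v; congr lgen; exact: gK.
rewrite v; exact: Kg.
Qed.

Lemma Psi01_invP : alg_morphism (@Psi01_inv F H) /\
  cancel (@Psi01_inv F H) (@Psi01 F H).
Proof.
have [pl [p1 pM]] := Psi01m; have inj := bij_inj Psi01_bij.
have K : cancel (@Psi01_inv F H) (@Psi01 F H).
  move=> h; rewrite /Psi01_inv; case: xgetP => [x _ //|].
  by have [g _ Kg] := Psi01_bij => /(_ (g h)); rewrite /= Kg.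
split=> //; split; last split.
- by move=> c x y; apply: inj; rewrite K; rewrite pl !K.
- by apply: inj; rewrite K p1.
- by move=> x y; apply: inj; rewrite K pM !K.
Qed.

Section MapEquivariant.
Variables (L L' : pzAlgType F) (f : L -> L') (s : H -> L) (u : dual -> L).
Hypothesis fm : alg_morphism f.

Lemma mmap_conv I h : mmap_amat f (conv (lsc (mdim I) s) (scal L I) h)
  = conv (lsc _ (f \o s)) (scal L' I) h.
Proof.
rewrite /conv mmap_Ap //; apply: eq_Ap => x; rewrite /= ?mmap_lsc //.
by rewrite mmap_scal.
Qed.

Lemma equivariant_map : equivariant s u -> equivariant (f \o s) (f \o u).
Proof.
move=> e I h; have := congr1 (mmap_amat f) (e I h).
by rewrite !(mmap_amat_morph fm _).2.2 mmap_genmx mmap_conv.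
Qed.

Lemma equivariant_inj : injective f -> equivariant (f \o s) (f \o u) -> equivariant s u.
Proof.
move=> inj e I h; have := e I h; rewrite /GRing.comm -mmap_conv -mmap_genmx.
rewrite -!(mmap_amat_morph fm _).2.2 => /matrixP em.
by apply/matrixP => i j; apply: inj; have := em i j; rewrite !mxE.
Qed.
End MapEquivariant.

Lemma equivariant_ext (L : pzAlgType F) (s s' : H -> L) (u u' : dual -> L) :
  s =1 s' -> u =1 u' -> equivariant s u -> equivariant s' u'.
Proof.
by move=> es eu e I h; rewrite -(eq_genmx I eu)
  -(eq_conv (f := lsc _ s) (g := scal L I)) // => x; rewrite /lsc es.
Qed.

Lemma equivariant01 k : equivariant (@Psi01_inv F H) (lgen (H := H) (k : letter 0 1)).
Proof.
have v := (proj1 (is_Psi01E _) Psi01P).2; have [im K] := Psi01_invP.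
apply: (equivariant_inj Psi01m (bij_inj Psi01_bij)).
have cu : commuting (cunit H) (@id H) by move=> x y; apply/commr_sym/comm_cunit.
apply: (equivariant_ext _ _ (equivariant_loop (alg_id H) (cunit_morph H H) cu)).
  by move=> h; rewrite conv_unitl //= K.
by move=> phi; rewrite (letter01 k) /= v.
Qed.

Definition u10 (k : letter 1 0) : dual -> heis H :=
  if k is inl (_, false) then tloop (@heis_H F H) (@heis_O F H)
  else loop (@heis_H F H).

Let hm := heis_H_morph H.
Let tm := heis_tilde_morph H.

Lemma heis_OM phi psi : heis_O phi * heis_O psi = heis_O (dmul phi psi) :> heis H.
Proof. by apply: hact_inj => chi; rewrite hactM !hact_O dmulA. Qed.

Lemma heis_O_mtens I J : genmx (@heis_O F H) (mtens I J)
  = slot1 (mdim J) (genmx (@heis_O F H) I) * slot2 (mdim I) (genmx (@heis_O F H) J).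
Proof.
have gE (K : hmod H) i j : genmx (@heis_O F H) K i j = heis_O (Tmx K i j) by rewrite mxE.
apply: amat_slotP => i1 i2 j1 j2; rewrite mul_slotE !gE heis_OM.
rewrite [LHS](gE (mtens I J)); apply: (congr1 (@heis_O F H)); apply/lfunP => x.
rewrite dmulE TmxE /mtens_rep /act2 /tsum summxE; apply: eq_bigr => i _.
rewrite summxE; apply: eq_bigr => j _; rewrite mxE tensmxE !TmxE //.
Qed.

Lemma sys10 : Lsys u10.
Proof.
have Om := heis_O_mtens; have Os I h := lscH_T I h.
have Ol := @heis_O_linear F H.
split=> [k|k|k|k l|i].
- by case: (letter10 k) => ->; [apply: loop_linear | apply: tloop_linear].
- case: (letter10 k) => ->; [exact: loop_triv hm | exact: tloop_triv].
- case: (letter10 k) => ->; [exact: loop_fusion hm | exact: tloop_fusion].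
- by case: (letter10 k) (letter10 l) => [] -> [] ->.
- exact: tloop_handle.
Qed.

Lemma mmap_heis_H I :
  map_mx (@heis_H F H) (Lplus I) = Rel (scal _ I) (lsc _ (@heis_H F H)) :> amat _ _ /\
  map_mx (@heis_H F H) (Lminus I) = Lam (@heis_H F H) I.
Proof.
split; last by rewrite Lminus_Lam -[LHS]/(mmap_amat _ _) mmap_Lam.
rewrite Lplus_Rel; etransitivity.
  exact: (mmap_Ap hm (Rmat H) (scal H I) (lsc _ (@id H))).
apply: eq_Ap => h; first exact: mmap_scal.
exact: mmap_lsc.
Qed.

Lemma is_Psi10E (f : Lgn H 1 0 -> heis H) :
  is_Psi10 f <-> alg_morphism f /\ forall k phi, f (lgen k phi) = u10 k phi.
Proof.
have valA I : map_mx (@heis_H F H) (Lplus I) *m ncinvmx (map_mx (@heis_H F H) (Lminus I))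
    = genmx (loop (@heis_H F H)) I.
  have [-> ->] := mmap_heis_H I; rewrite ncinv_Lminus //.
  by rewrite (genmx_loop hm).
have valB I : map_mx (@heis_H F H) (Lplus I) *m map_mx (@heis_O F H) (Tmx I)
      *m ncinvmx (map_mx (@heis_H F H) (Lminus I))
    = genmx (tloop (@heis_H F H) (@heis_O F H)) I.
  have [-> ->] := mmap_heis_H I; rewrite ncinv_Lminus //.
  by rewrite (genmx_tloop hm) //; exact: heis_O_linear.
split=> -[fm fv]; split=> //; last first.
  move=> I /=; rewrite valA valB.
  by split; apply/matrixP => i j; rewrite !mxE; exact: fv.
have Ol := @heis_O_linear F H.
move=> k; apply: genmx_inj.
- exact: (linear_comp (sys_linear (lgen_sys H 1 0) k) fm.1).
- exact: sys_linear sys10 k.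
move=> I; have [eA eB] := fv I.
case: (letter10 k) => ->; [rewrite -[RHS]valA -eA | rewrite -[RHS]valB -eB];
  by apply/matrixP => i j; rewrite !mxE.
Qed.

Lemma Psi10P : is_Psi10 (@Psi10 F H).
Proof.
have [f [fm fv]] := Lgn_hom sys10.
have fP : is_Psi10 f by apply/is_Psi10E.
rewrite /Psi10; case: xgetP => [//|/(_ (f : {classic _}))]; by move=> /(_ fP).
Qed.

Let Psi10m : alg_morphism (@Psi10 F H) := (proj1 (is_Psi10E _) Psi10P).1.
Let Psi10v := (proj1 (is_Psi10E _) Psi10P).2.

Definition AB_sum (X : tens dual dual) : Lgn H 1 0 :=
  \tsum_(phi, psi <- X) lgen kA phi * lgen kB psi.

Lemma AB_sum_linear : linear AB_sum.
Proof. by move=> c X Y; rewrite /AB_sum tsumDl. Qed.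

(** Sums of products A B contain 1 and are stable under left multiplication by generators: two A's,
    or two B's, merge by fusion, and a B to the left of an A is reordered by the handle relation. *)
Lemma Lgn10_span z : exists X, z = AB_sum X.
Proof.
have sys := lgen_sys H 1 0; have aL := sys_linear sys kA; have bL := sys_linear sys kB.
pose P z := exists X, z = AB_sum X.
have P0 : P 0 by exists 0; rewrite (lin0 AB_sum_linear).
have PL (c : F) x y : P x -> P y -> P (c *: x + y).
  by move=> [X ->] [Y ->]; exists (c *: X + Y); rewrite AB_sum_linear.
have Pab phi psi : P (lgen kA phi * lgen kB psi).
  by exists (phi \ox psi); rewrite /AB_sum tsum_pure //; apply: bilin_mul.
have Pba phi psi : P (lgen kB phi * lgen kA psi).
  exact: handle_product bL aL (sys_handle sys ord0) P0 PL Pab phi psi.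
have Pr x psi : P x -> P (x * lgen kB psi).
  move=> [X ->]; rewrite /AB_sum mulr_tsumr; apply: (subspace_tsum P0 PL) => f1 f2.
  rewrite -mulrA; have [chi ->] := fusion_product bL (sys_fusion sys kB) f2 psi.
  exact: Pab.
suff : P z by [].
elim/Lgn_ind: z => [|//|k phi y [X ->]].
  by have := Pab (counit H) (counit H); rewrite !(sys_trivial sys) mulr1.
rewrite /AB_sum mulr_tsuml; apply: (subspace_tsum P0 PL) => f1 f2; rewrite mulrA.
case: (letter10 k) => ->; last exact: Pr.
have [chi ->] := fusion_product aL (sys_fusion sys kA) phi f1; exact: Pab.
Qed.

(** The images of the A generators fill H by factorizability. Together with the images of the B
    generators they then yield O(H), and these two subalgebras generate. *)
Lemma Psi10_surj (x : heis H) : exists z, Psi10 z = x.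
Proof.
have [pl [p1 pM]] := Psi10m.
pose P (x : heis H) := exists z, Psi10 z = x.
have P0 : P 0 by exists 0; rewrite (lin0 pl).
have PL (c : F) y y' : P y -> P y' -> P (c *: y + y').
  by move=> [z <-] [z' <-]; exists (c *: z + z'); rewrite pl.
have PM y y' : P y -> P y' -> P (y * y').
  by move=> [z <-] [z' <-]; exists (z * z'); rewrite pM.
have PH h : P (heis_H h).
  have [g _ Kg] := factH; exists (lgen kA (g h)); rewrite Psi10v /u10 /loop.
  rewrite -[in RHS](Kg h) (linear_tsum _ _ hm.1).
  by apply: eq_tsum => a b; rewrite (linZ hm.1).
have PO phi : P (heis_O phi).
  (* [Xi] is the inverse of R. Multiplying L^(+) T L^(-)-1 on both sides by the inverse R-matrices,
     whose entries lie in H, recovers T. *)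
  pose Xi := \tsum_(a, b <- Rmat H) a \ox antipode_inv H b.
  have Ol := @heis_O_linear F H; have tl := tloop_linear (@heis_H F H) Ol.
  have -> : heis_O phi = sandwich (tloop (@heis_H F H) (@heis_O F H)) (@heis_H F H)
      (tflip Xi) Xi phi.
    move: phi; apply: genmx_inj => // [|I]; first exact: sandwich_linear.
    have sm := scal_morph (heis H) I; have lm := lsc_morph (mdim I) hm.
    have c := @commuting_lsc_scal _ _ (heis H) (@heis_H F H) I.
    rewrite genmx_sandwich // (genmx_tloop hm) //.
    have eXi f k : linear f -> linear k -> Ap Xi f k = Rinv f k :> amat (heis H) (mdim I).
      by move=> fl kl; rewrite Rinv_Ap.
    rewrite Ap_flip //; [|exact: lm.1|exact: sm.1].
    rewrite !eXi; [|exact: lm.1|exact: sm.1|exact: sm.1|exact: lm.1].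
    have [q1 _] := RinvP sm lm (commutingC c); have [_ q2] := RinvP lm sm c.
    exact: conj_cancel q1 q2.
  rewrite /sandwich; apply: (subspace_tsum P0 PL) => a b.
  apply: (subspace_tsum P0 PL) => a' b'; apply: (PM) => //; apply: (PM) => //.
  by exists (lgen kB (dtransr (dtransl phi b) b')); rewrite Psi10v.
rewrite [x]tens_pureE; apply: (subspace_tsum P0 PL) => psi h.
by rewrite -heis_OH; apply: (PM).
Qed.

(** The composite from H^* ⊗ H^* through L_{1,0}(H) to the Heisenberg double is onto between spaces
    of dimension (dim H)^2, hence injective; as its first map is onto, [Psi10] is injective. *)
Lemma Psi10_bij : bijective (@Psi10 F H).
Proof.
have [pl _] := Psi10m.
have tl : linear (fun X : tens dual dual => Psi10 (AB_sum X)).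
  exact: linear_comp AB_sum_linear pl.
pose t : 'Hom(tens dual dual, heis H) := linfun (fun X => Psi10 (AB_sum X) : heis H).
have tE X : t X = Psi10 (AB_sum X) by rewrite linfunE.
have tfull : limg t = fullv.
  apply/vspaceP => x; rewrite memvf; apply/esym.
  have [z <-] := Psi10_surj x; have [X ->] := Lgn10_span z.
  by rewrite -tE memv_img ?memvf.
have tker : lker t == 0%VS.
  rewrite -dimv_eq0; have := limg_ker_dim t fullv; rewrite capfv tfull.
  rewrite !dim_tens !dim_hom !dimvf /= muln1 => /eqP.
  by rewrite -[X in _ == X]add0n eqn_add2r.
have inj : injective (@Psi10 F H).
  move=> z z'; have [X ->] := Lgn10_span z; have [X' ->] := Lgn10_span z'.
  by have /lker0P/(_ X X') := tker; rewrite !tE => ti /ti ->.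
have [g gK] := choice Psi10_surj.
by exists g => // z; apply: inj; rewrite gK.
Qed.

Lemma Psi10_invP : alg_morphism (@Psi10_inv F H) /\
  cancel (@Psi10_inv F H) (@Psi10 F H).
Proof.
have [pl [p1 pM]] := Psi10m; have inj := bij_inj Psi10_bij.
have K : cancel (@Psi10_inv F H) (@Psi10 F H).
  move=> h; rewrite /Psi10_inv; case: xgetP => [x _ //|].
  by have [g _ Kg] := Psi10_bij => /(_ (g h)); rewrite /= Kg.
split=> //; split; last split.
- by move=> c x y; apply: inj; rewrite K; rewrite pl !K.
- by apply: inj; rewrite K p1.
- by move=> x y; apply: inj; rewrite K pM !K.
Qed.

Definition moment10 : H -> Lgn H 1 0 := @Psi10_inv F H \o conv (@heis_tilde F H) (@heis_H F H).

Lemma moment10_morph : alg_morphism moment10.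
Proof.
apply: alg_comp (Psi10_invP).1; apply: conv_morph => //; exact: commuting_tilde_H.
Qed.

Lemma equivariant10 k : equivariant moment10 (lgen (H := H) (k : letter 1 0)).
Proof.
have [im K] := Psi10_invP.
apply: (equivariant_inj Psi10m (bij_inj Psi10_bij)).
apply: (equivariant_ext (s := conv (@heis_tilde F H) (@heis_H F H)) (u := u10 k)).
- by move=> h; rewrite /moment10 /= K.
- by move=> phi; rewrite /= Psi10v.
have c := @commuting_tilde_H F H.
case: (letter10 k) => ->; first exact: equivariant_loop.
apply: equivariant_tloop => //; [exact: heis_O_linear | exact: lscH_T | exact: lscT_T].
Qed.

Lemma Mminus_Lam I : Mminus I = Lam (@Psi01_inv F H) I.
Proof.
rewrite /Mminus Lminus_Lam -[LHS]/(mmap_amat _ _) mmap_Lam //; exact: (Psi01_invP).1.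
Qed.

Lemma Cminus_Lam I : Cminus I = Lam moment10 I.
Proof.
rewrite /Cminus Ltilde_Lam (mmap_heis_H I).2.
rewrite -[_ *m _]/(_ * _) -(Lam_conv I tm hm (@commuting_tilde_H F H)).1.
rewrite -[LHS]/(mmap_amat _ _) mmap_Lam //; exact: (Psi10_invP).1.
Qed.

End Psi.

(** * The tensor product and the map alpha *)

Section TensorUniversal.
Variables (F : fieldType) (I : finType).
Variables (X : I -> choiceType) (E : forall k, freealg F (X k) -> Prop).
Local Notation A k := (presented (@E k)).
Local Notation T := (bigtens E).
Local Notation ptup := (ptuple E).
Local Notation tgen := (@pgen F ptup (@tens_rel F I X E)).

Implicit Types (a b : ptup).

Lemma upd_same a k (x : A k) : upd a x k = x.
Proof. by rewrite ffunE dfwith_in. Qed.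

Lemma upd_other a k (x : A k) l : k != l -> upd a x l = a l.
Proof. by move=> kl; rewrite ffunE dfwith_out. Qed.

Let one : ptup := [ffun k => 1].

Let oneE k : one k = 1. Proof. exact: ffunE. Qed.

Lemma tgen1 : tgen one = 1 :> T.
Proof. by apply/pclassP/ideal_gen_base/tens_rel1. Qed.

Lemma tgenM a b : tgen a * tgen b = tgen [ffun k => a k * b k] :> T.
Proof. by rewrite -[LHS]pclassM; apply/pclassP/ideal_gen_base/tens_relM. Qed.

Lemma tgenL a k (c : F) (x y : A k) :
  tgen (upd a (c *: x + y)) = c *: (tgen (upd a x) : T) + tgen (upd a y).
Proof.
transitivity (pclass (@tens_rel F I X E)
    (c *: freegen F (upd a x) + freegen F (upd a y))).
  by apply/pclassP/ideal_gen_base/tens_relL.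
by rewrite pclassD pclassZ.
Qed.

Lemma tens_in_morph k : alg_morphism (@tens_in F I X E k).
Proof.
split; first by move=> c x y; apply: tgenL.
split=> [|x y].
  rewrite -tgen1 /tens_in; congr pgen; apply/ffunP => l.
  have [<-|kl] := eqVneq k l; first by rewrite upd_same ffunE.
  by rewrite upd_other.
rewrite tgenM /tens_in; congr pgen; apply/ffunP => l.
rewrite [RHS]ffunE; have [<-|kl] := eqVneq k l; first by rewrite !upd_same.
by rewrite !upd_other // !ffunE mulr1.
Qed.

Lemma tens_in_comm k l (x : A k) (y : A l) : k != l ->
  GRing.comm (tens_in x) (tens_in y).
Proof.
move=> kl; have cm m : GRing.comm (upd one x m) (upd one y m).
  have [em|km] := eqVneq k m; last first.
    have -> : upd one x m = 1 by rewrite upd_other // oneE.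
    exact/esym/commr1.
  case: m / em; have -> : upd one y k = 1 by rewrite upd_other 1?eq_sym // oneE.
  exact: commr1.
transitivity (tgen [ffun m => upd one x m * upd one y m] : T); first exact: tgenM.
transitivity (tgen [ffun m => upd one y m * upd one x m] : T); last first.
  by symmetry; exact: tgenM.
by apply: (congr1 tgen); apply/ffunP => m; rewrite [LHS]ffunE [RHS]ffunE cm.
Qed.

(** A pure tensor is the product of its components placed in their factors, so a morphism is
    determined on the factors ([eq_bigtens]). *)
Lemma tgen_prod a : tgen a = \prod_(k <- enum I) tens_in (a k) :> T.
Proof.
have : uniq (enum I) by exact: enum_uniq.
have -> : a = [ffun k => if k \in enum I then a k else 1] :> ptup.
  by apply/ffunP => k; rewrite ffunE mem_enum.
rewrite [RHS](eq_bigr (fun k => tens_in (a k))) => [|k _]; last first.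
  by rewrite ffunE mem_enum.
elim: (enum I) => [_|k s ih /= /andP[ks us]].
  by rewrite big_nil -tgen1; congr pgen; apply/ffunP => k; rewrite !ffunE.
rewrite big_cons -ih // tgenM; congr pgen; apply/ffunP => l; rewrite !ffunE inE.
have [el|lk] := eqVneq l k.
  by case: k / el ks => /negPf ->; rewrite dfwith_in mulr1.
by rewrite dfwith_out 1?eq_sym // ffunE mul1r.
Qed.

Section Morphism.
Variables (L : pzAlgType F) (e : forall k, A k -> L).
Hypothesis em : forall k, alg_morphism (@e k).
Hypothesis ec : forall k l, k != l -> forall (x : A k) (y : A l), GRing.comm (e x) (e y).

Let val a : L := \prod_(k <- enum I) e (a k).

Let val_mul a b (s : seq I) : uniq s ->
  (\prod_(k <- s) e (a k)) * (\prod_(k <- s) e (b k)) = \prod_(k <- s) e (a k * b k).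
Proof.
elim: s => [_|k s ih /= /andP[ks us]]; first by rewrite !big_nil mulr1.
rewrite !big_cons -ih // (em k).2.2 -!mulrA; congr (_ * _); rewrite !mulrA.
congr (_ * _); apply/commr_sym; rewrite big_seq.
elim/big_rec: _ => [|l x ls cx]; first exact: commr1.
by apply: commrM => //; apply: ec; apply: contraNneq ks => ->.
Qed.

Let val_split a k : exists p q : L, forall x : A k, val (upd a x) = p * e x * q.
Proof.
have := enum_uniq I; have : k \in enum I by rewrite mem_enum.
rewrite /val; case/splitPr => s1 s2; rewrite cat_uniq /= => /and3P[_ /norP[ks1 _]].
case/andP => ks2 _.
exists (\prod_(l <- s1) e (a l)), (\prod_(l <- s2) e (a l)) => x.
rewrite big_cat big_cons /= upd_same mulrA.
have out (s : seq I) : k \notin s ->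
    \prod_(l <- s) e (upd a x l) = \prod_(l <- s) e (a l).
  move=> ks; apply: eq_big_seq => l ls; rewrite upd_other //.
  by apply: contraNneq ks => ->.
by rewrite !out.
Qed.

(** A pure tensor is sent to the ordered product of the images of its components. Commutation gives
    the product relation ([val_mul]), and isolating one factor ([val_split]) gives
    multilinearity. *)
Lemma bigtens_hom : exists f : T -> L,
  alg_morphism f /\ forall k (x : A k), f (tens_in x) = e x.
Proof.
have [fl [f1 fM]] := feval_morph val.
have fB v w : feval val (v - w) = feval val v - feval val w.
  by rewrite (linD fl) -scaleN1r (linZ fl) scaleN1r.
have van w : @tens_rel F I X E w -> feval val w = 0.
  case=> [|a b|a k c x y].
  - rewrite fB f1 feval_gen /val big1 ?subrr // => k _.
    by rewrite ffunE (em k).2.1.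
  - rewrite fB fM !feval_gen /val val_mul ?enum_uniq //.
    by apply/eqP; rewrite subr_eq0; apply/eqP/eq_bigr => k _; rewrite ffunE.
  - rewrite fB fl !feval_gen; have [p [q h]] := val_split a k.
    rewrite !h (em k).1 mulrDr mulrDl -pzscaleAr -pzscaleAl.
    by rewrite subrr.
exists (peval val (E := @tens_rel F I X E)); split; first exact: peval_morph.
move=> k x; rewrite /tens_in peval_gen // /val.
have := enum_uniq I; have : k \in enum I by rewrite mem_enum.
case/splitPr => s1 s2; rewrite cat_uniq /= => /and3P[_ /norP[ks1 _]].
case/andP => ks2 _; rewrite big_cat big_cons /= upd_same.
have out (s : seq I) : k \notin s -> \prod_(l <- s) e (upd one x l) = 1.
  move=> ks; apply: big1_seq => l /= ls; rewrite upd_other ?ffunE ?(em l).2.1 //.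
  by apply: contraNneq ks => ->.
by rewrite !out // mul1r mulr1.
Qed.

Lemma eq_bigtens (f h : T -> L) : alg_morphism f -> alg_morphism h ->
  (forall k (x : A k), f (tens_in x) = h (tens_in x)) -> f =1 h.
Proof.
move=> fm hm fh; apply: eq_presented => // a; rewrite tgen_prod.
rewrite (big_morph f fm.2.2 fm.2.1) (big_morph h hm.2.2 hm.2.1).
by apply: eq_bigr => k _; apply: fh.
Qed.

End Morphism.
End TensorUniversal.

(** * Dressing and undressing of generators in an arbitrary algebra *)

Section Alpha.
Variables (F : fieldType) (H : ribbonHopf F).
Local Notation dual := 'Hom(hopf_sort H, F^o).
Hypothesis factH : factorizable H.
Variables g n : nat.

Local Notation K := ('I_g + 'I_n)%type.
Local Notation A k := (Lgn H (@fgenus g n k) (@fpunct g n k)).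
Local Notation loc k := (letter (@fgenus g n k) (@fpunct g n k)).

Definition index (k : K) : nat := match k with inl i => i | inr j => (g + j)%N end.

Lemma index_lt k : (index k < g + n)%N.
Proof. by case: k => [i|j] /=; rewrite ?ltn_add2l // ltn_addr. Qed.

Lemma index_inj : injective index.
Proof.
move=> [i|j] [i'|j'] //= e.
- by congr inl; apply: val_inj.
- by have := ltn_ord i; rewrite e ltnNge leq_addr.
- by have := ltn_ord i'; rewrite -e ltnNge leq_addr.
- by congr inr; apply: val_inj; apply/eqP; rewrite -(eqn_add2l g) e.
Qed.

Definition site_at (m : nat) : option K := [pick k | index k == m].

Lemma site_atK k : site_at (index k) = Some k.
Proof.
rewrite /site_at; case: pickP => [l /eqP/index_inj -> //|/(_ k)].
by rewrite eqxx.
Qed.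

Lemma site_atP m k : site_at m = Some k -> index k = m.
Proof. by rewrite /site_at; case: pickP => [l /eqP e [<-]|]. Qed.

Lemma site_at_lt m : (m < g + n)%N -> exists k, index k = m.
Proof.
move=> mN; have [mg|gm] := ltnP m g; first by exists (inl (Ordinal mg)).
have mgn : (m - g < n)%N by rewrite ltn_subLR.
by exists (inr (Ordinal mgn)); rewrite /= subnKC.
Qed.

Definition global (k : K) : loc k -> letter g n :=
  match k return loc k -> letter g n with
  | inl i => fun l => if l is inl (_, false) then lB n i else lA n i
  | inr j => fun _ => lM g j
  end.

Lemma site_global k (l : loc k) : site (global l) = index k.
Proof. by case: k l => [i [[? []]|?]|j ?]. Qed.

Lemma local_site k (l1 l2 : loc k) : ~~ (site l1 < site l2)%N.
Proof.
case: k l1 l2 => [i|j] l1 l2; last by rewrite (letter01 l1) (letter01 l2) ltnn.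
by case: (letter10 l1) (letter10 l2) => [] -> [] ->.
Qed.

Lemma global_handle k (o : 'I_(@fgenus g n k)) :
  exists i, global (lB _ o : loc k) = lB n i /\ global (lA _ o : loc k) = lA n i.
Proof. by case: k o => [i o|j []//]; exists i. Qed.

Lemma globalP (l : letter g n) : exists k (l' : loc k), l = global l'.
Proof.
case: l => [[i b]|j]; last by exists (inr j), (lM 0 ord0).
by exists (inl i), (inl (ord0, b)); case: b.
Qed.

Definition moment (k : K) : H -> A k :=
  match k return H -> A k with
  | inl _ => @moment10 F H
  | inr _ => @Psi01_inv F H
  end.

Lemma moment_morph k : alg_morphism (@moment k).
Proof. by case: k => ?; [exact: moment10_morph | exact: (Psi01_invP factH).1]. Qed.

Lemma moment_equivariant k (l : loc k) : equivariant (@moment k) (lgen (H := H) l).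
Proof. by case: k l => ? l; [exact: equivariant10 | exact: equivariant01]. Qed.

Section OneTarget.
Variable L : pzAlgType F.
Implicit Types (e : forall k, A k -> L).

Local Notation act e k := (e k \o @moment k).
Local Notation gen e l := (fun phi => e _ (lgen l phi)).

(* The paper's Lambda_(m+1), for m <= g, and Gamma_(m+1), for m >= g, are     *)
(* Lam (action e m), where e embeds the sites in the tensor product.          *)
Fixpoint action e (m : nat) : H -> L :=
  if m is p.+1 then
    if site_at p is Some k then conv (act e k) (action e p) else action e p
  else @cunit F H L.

(** Only the sites below N are constrained, because [undress] builds the morphisms one site after
    the other while the later ones are still arbitrary. *)
Record commuting_upto e (N : nat) : Prop := CommutingUpto {
  upto_morph : forall k, (index k < N)%N -> alg_morphism (e k);
  upto_comm : forall k l (x : A k) (y : A l), (index k < N)%N -> (index l < N)%N ->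
    k != l -> GRing.comm (e k x) (e l y)
}.

Lemma comm_action e m z :
  (forall k (x : A k), (index k < m)%N -> GRing.comm z (e k x)) ->
  forall h, GRing.comm z (action e m h).
Proof.
elim: m => [|m ih] cz h /=; first exact: comm_cunit.
have cz' : forall h, GRing.comm z (action e m h).
  by apply: ih => k x km; apply: cz; apply: ltnW.
case E: (site_at m) => [k|] //; apply: comm_Ap => // x /=.
by apply: cz; rewrite (site_atP E).
Qed.

Lemma action_comm e N m k : commuting_upto e N -> (m <= index k)%N -> (index k < N)%N ->
  forall h (x : A k), GRing.comm (action e m h) (e k x).
Proof.
move=> [_ cN] mk kN h x; apply/commr_sym; move: h; apply: comm_action => l y lm.
have lk := leq_trans lm mk; apply: cN => //; first exact: ltn_trans kN.
by apply: contraTneq lk => ->; rewrite ltnn.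
Qed.

Lemma action_morph e N m : commuting_upto e N -> (m <= N)%N ->
  alg_morphism (action e m).
Proof.
move=> eN; elim: m => [|m ih] mN /=; first exact: cunit_morph.
have am := ih (ltnW mN).
case E: (site_at m) => [k|] //; have ek := site_atP E.
have kN : (index k < N)%N by rewrite ek.
apply: conv_morph => //.
  by apply: alg_comp (moment_morph k) _; apply: (upto_morph eN).
by move=> x y; apply/commr_sym; apply: (action_comm eN) => //; rewrite ek.
Qed.

Lemma act_morph e N k : commuting_upto e N -> (index k < N)%N ->
  alg_morphism (act e k).
Proof. by move=> eN kN; apply: alg_comp (moment_morph k) _; apply: (upto_morph eN). Qed.

Lemma Lam_action_step e N k I : commuting_upto e N -> (index k < N)%N ->
  Lam (action e (index k).+1) I = Lam (action e (index k)) I * Lam (act e k) I /\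
  LamV (action e (index k).+1) I = LamV (act e k) I * LamV (action e (index k)) I.
Proof.
move=> eN kN /=; rewrite site_atK; apply: Lam_conv.
- exact: act_morph eN kN.
- by apply: action_morph eN _; apply: ltnW.
- by move=> x y; apply/commr_sym; apply: (action_comm eN).
Qed.

(** Splits the Lambda of site j into that of site k, the factor of site k itself, and a remainder
    [W] from the sites strictly between; this is the shape that [twist_exchange] takes. *)
Lemma Lam_between e N k j : commuting_upto e N -> (index k < j)%N -> (j <= N)%N ->
  exists W WV : forall J : hmod H, amat L (mdim J),
  [/\ forall J, inv_pair (W J) (WV J),
      forall J, Lam (action e j) J = Lam (action e (index k)) J * Lam (act e k) J * W J,
      forall J, LamV (action e j) J
        = WV J * (LamV (act e k) J * LamV (action e (index k)) J)
    & forall z, (forall l (x : A l), (index k < index l < j)%N -> GRing.comm z (e l x)) ->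
      forall J, GRing.comm (mlift _ z) (W J)].
Proof.
move=> eN; elim: j => [//|j ih]; rewrite ltnS leq_eqVlt => /orP[/eqP<-|kj] jN.
  exists (fun=> 1), (fun=> 1); split=> [J|J|J|z _ J].
  - by split; rewrite mulr1.
  - by rewrite mulr1 (Lam_action_step J eN jN).1.
  - by rewrite mul1r (Lam_action_step J eN jN).2.
  - exact: commr1.
have [W [WV [pW eW eWV cW]]] := ih kj (ltnW jN).
have := jN; case E: (site_at j) => [l|] jN'; last first.
  exists W, WV; split=> //= [J|J|z cz]; rewrite ?E //.
  by apply: cW => l x /andP[kl lj]; apply: cz; rewrite kl ltnS ltnW.
have el := site_atP E; have lN : (index l < N)%N by rewrite el.
have st J := Lam_action_step J eN lN.
exists (fun J => W J * Lam (act e l) J), (fun J => LamV (act e l) J * WV J).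
split=> [J|J|J|z cz J].
- by apply: inv_pairM => //; apply: Lam_inv; apply: act_morph eN lN.
- by rewrite -el (st J).1 el eW !mulrA.
- by rewrite -el (st J).2 el eWV !mulrA.
- apply: commrM.
    by apply: cW => l' x /andP[kl lj]; apply: cz; rewrite kl ltnS ltnW.
  apply: comm_Ap => h /=; last exact: comm_lift_sc.
  rewrite /lsc /GRing.comm -!(mlift_morph L _).2.2; congr mlift; apply: cz.
  by rewrite el kj leqnn.
Qed.

Lemma equivariant_act e N k (l : loc k) : commuting_upto e N -> (index k < N)%N ->
  equivariant (act e k) (gen e l).
Proof.
move=> eN kN; exact: equivariant_map (upto_morph eN kN) (moment_equivariant l).
Qed.

Definition dressed e (u : letter g n -> dual -> L) (N : nat) :=
  forall k (l : loc k), (index k < N)%N ->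
    twisted (action e (index k)) (gen e l) (u (global l)).

Lemma gen_linear e N k (l : loc k) : commuting_upto e N -> (index k < N)%N ->
  linear (gen e l).
Proof.
move=> eN kN; have em := upto_morph eN kN.
exact: (linear_comp (sys_linear (lgen_sys H _ _) l) em.1).
Qed.

Lemma gen_sys e N k : commuting_upto e N -> (index k < N)%N ->
  Lsys (fun l : loc k => gen e l).
Proof.
move=> eN kN; have em := upto_morph eN kN; exact: (Lsys_map em (lgen_sys H _ _)).
Qed.

Lemma comm_gen (k : K) (f : A k -> L) z : alg_morphism f ->
  (forall (l : loc k) phi, GRing.comm z (f (lgen l phi))) ->
  forall x, GRing.comm z (f x).
Proof.
move=> [fl [f1 fM]] cz; elim/Lgn_ind => [|c x y cx cy|l phi y cy].
- by rewrite f1; apply: commr1.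
- by rewrite fl; apply: commrD => //; rewrite /GRing.comm -pzscaleAl -pzscaleAr cx.
- by rewrite fM; apply: commrM.
Qed.

(** The map [v] at the later site need not come from [e]: in [undress] it belongs to a site that has
    no morphism yet. *)
Lemma exchange_dressed e N k (l : loc k) j (ut vt v : dual -> L) :
  commuting_upto e N -> (index k < j)%N -> (j <= N)%N -> linear v ->
  twisted (action e (index k)) (gen e l) ut ->
  twisted (action e j) v vt ->
  (forall h phi, GRing.comm (action e (index k) h) (v phi)) ->
  exchange_eq ut vt <-> forall phi psi, GRing.comm (e k (lgen l phi)) (v psi).
Proof.
move=> eN kj jN vl tu tv cv; have kN := leq_trans kj jN.
have [W [WV [pW eW eWV cW]]] := Lam_between eN kj jN.
apply: (twist_exchange (s := action e (index k)) (r := act e k) (W := W) (WV := WV)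
  (u := gen e l) (v := v)) => //.
- by apply: action_morph eN (ltnW kN).
- exact: act_morph eN kN.
- exact: gen_linear eN kN.
- by move=> J; rewrite tv eW eWV !mulrA.
- by move=> h phi; apply: (action_comm eN).
- by move=> x y; apply: (action_comm eN).
- exact: equivariant_act eN kN.
- move=> J phi; apply: cW => l' x /andP[kl lj]; apply: (upto_comm eN) => //.
    exact: leq_trans lj jN.
  by apply: contraTneq kl => ->; rewrite ltnn.
- move=> J h; apply: cW => l' x /andP[kl lj]; apply: (action_comm eN).
    exact: ltnW.
  exact: leq_trans lj jN.
Qed.

Lemma dressed_sys e u : commuting_upto e (g + n) -> (forall l, linear (u l)) ->
  dressed e u (g + n) -> Lsys u.
Proof.
move=> eN ul d; have lt := index_lt.
have am k : alg_morphism (action e (index k)).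
  by apply: action_morph eN (ltnW (lt k)).
have ac k h x := action_comm eN (leqnn (index k)) (lt k) h x.
split=> // [l|l|l1 l2|i].
- have [k [l' ->]] := globalP l; apply/(twist_triv (am k) (d k l' (lt k))).
  exact: (sys_trivial (gen_sys eN (lt k)) l').
- have [k [l' ->]] := globalP l; apply/(twist_fusion (am k) (d k l' (lt k))).
    by move=> h phi; apply: ac.
  exact: (sys_fusion (gen_sys eN (lt k)) l').
- have [k1 [l1' ->]] := globalP l1; have [k2 [l2' ->]] := globalP l2.
  rewrite !site_global => k12.
  apply/(exchange_dressed eN k12 (ltnW (lt k2))
    (gen_linear l2' eN (lt k2)) (d k1 l1' (lt k1)) (d k2 l2' (lt k2))).
    by move=> h phi; apply: (action_comm eN); rewrite // ltnW.
  move=> phi psi; apply: (upto_comm eN) => //.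
  by apply: contraTneq k12 => ->; rewrite ltnn.
- pose k : K := inl i; pose b : loc k := lB 0 ord0; pose a : loc k := lA 0 ord0.
  apply/(twist_handle (am k) (d k b (lt k)) (d k a (lt k))).
  + by move=> h phi; apply: ac.
  + by move=> h phi; apply: ac.
  + exact: (sys_handle (gen_sys (k := k) eN (lt k)) ord0).
Qed.

Lemma dress_exists e : commuting_upto e (g + n) ->
  exists u, (forall l, linear (u l)) /\ dressed e u (g + n).
Proof.
move=> eN; have lt := index_lt.
have ex (l : letter g n) : exists v, linear v /\
    forall k (l' : loc k), l = global l' -> twisted (action e (index k)) (gen e l') v.
  have [k [l' ->]] := globalP l.
  have am : alg_morphism (action e (index k)) by apply: action_morph eN (ltnW (lt k)).
  have [v [vl tv]] := twist_exists am (gen_linear l' eN (lt k)).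
  exists v; split=> // k2 l2 e12.
  (* A global letter determines its factor and its local letter, so the map chosen for one
     decomposition serves every other. *)
  have ek : k = k2 by apply: index_inj; rewrite -(site_global l') -(site_global l2) e12.
  case: k2 / ek l2 e12 => l2 e12.
  suff <- : l' = l2 by [].
  move: l' l2 {tv} e12; case: (k) => [i|j].
    by move=> [[o b]|[]//] [[o' b']|[]//]; rewrite (ord1 o) (ord1 o'); case: b b' => [] [].
  by move=> [[[]//]|o] [[[]//]|o'] _; rewrite (ord1 o) (ord1 o').
have [u hu] := choice ex.
exists u; split=> [l|k l kN]; first exact: (hu l).1.
exact: (hu (global l)).2.
Qed.

Lemma eq_action e e' m : (forall k, (index k < m)%N -> e k = e' k) ->
  action e m = action e' m.
Proof.
elim: m => [//|m ih] ee /=; rewrite ih => [|k km]; last exact/ee/ltnW.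
by case E: (site_at m) => [k|] //; rewrite ee // (site_atP E).
Qed.

(** Strong induction on the site: the Lambda to be undone involves earlier sites only, where both
    families already agree. *)
Lemma dressed_uniq e e' u : commuting_upto e (g + n) -> commuting_upto e' (g + n) ->
  dressed e u (g + n) -> dressed e' u (g + n) -> forall k, e k = e' k.
Proof.
move=> eN eN' d d' k; have lt := index_lt.
have [m] := ubnP (index k); elim: m k => [//|m ih] k; rewrite ltnS => km.
have ea : action e (index k) = action e' (index k).
  by apply: eq_action => l lk; apply: ih; apply: leq_trans lk km.
apply/funext; apply: eq_Lgn => [||l phi]; [exact: upto_morph eN _ (lt k)|
  exact: upto_morph eN' _ (lt k)|].
move: phi; apply: (genmx_inj (u := gen e l) (v := gen e' l)).
- exact: gen_linear eN (lt k).
- exact: gen_linear eN' (lt k).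
move=> I; have := d k l (lt k) I; rewrite (d' k l (lt k) I) ea => h.
by apply/esym/(conj_inj (Lam_inv I (action_morph eN' (ltnW (lt k))))).
Qed.

(** Undoing the conjugation at site N gives maps [v] that commute with the earlier factors and
    satisfy the relations of the N-th one, hence a further morphism. *)
Lemma undress e u N : commuting_upto e N -> (N < g + n)%N -> Lsys u -> dressed e u N ->
  exists e', commuting_upto e' N.+1 /\ dressed e' u N.+1.
Proof.
move=> eN Ngn us d; have [k0 ek0] := site_at_lt Ngn.
have am : alg_morphism (action e N) by exact: action_morph eN _.
have ex (l : loc k0) : exists v, linear v /\ twisted (action e N) v (u (global l)).
  exact: untwist_exists am (sys_linear us _).
have [v hv] := choice ex.
(* Strong induction on the earlier site k: [exchange_dressed] needs the sites before k to commute
   with [v] already, and then reads the exchange relation of [u] as commutation at k. *)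
have cv k (x : A k) : (index k < N)%N -> forall l psi, GRing.comm (e k x) (v l psi).
  have [m] := ubnP (index k); elim: m k x => [//|m ih] k x; rewrite ltnS => km kN l psi.
  apply/commr_sym; move: x; apply: comm_gen => [|l' phi]; first exact: upto_morph eN _ kN.
  apply/commr_sym; move: phi psi.
  apply/(exchange_dressed eN kN (leqnn N) (hv l).1 (d k l' kN) (hv l).2).
    move=> h psi; apply/commr_sym; move: h; apply: comm_action => k' x k'k.
    by apply/commr_sym; apply: ih; [exact: leq_trans k'k km | exact: ltn_trans k'k kN].
  by apply: (sys_exchange us); rewrite !site_global ek0.
have ca h l psi : GRing.comm (action e N h) (v l psi).
  apply/commr_sym; move: h; apply: comm_action => k x kN.
  by apply/commr_sym; apply: cv.
have vs : Lsys v.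
  split.
  - by move=> l; exact: (hv l).1.
  - by move=> l; apply/(twist_triv am (hv l).2); exact: sys_trivial us _.
  - move=> l; apply/(twist_fusion am (hv l).2) => [h phi|]; first exact: ca.
    exact: sys_fusion us _.
  - by move=> l1 l2; rewrite (negPf (local_site l1 l2)).
  - move=> o; have [i [eb ea]] := global_handle o.
    apply/(twist_handle am (hv (lB _ o)).2 (hv (lA _ o)).2).
    + by move=> h phi; apply: ca.
    + by move=> h phi; apply: ca.
    + by rewrite eb ea; apply: (sys_handle us).
have [e0 [e0m e0v]] := Lgn_hom vs.
pose e' := dfwith e e0.
have e'k0 : e' k0 = e0 by rewrite /e' dfwith_in.
have e'k k : (index k < N)%N -> e' k = e k.
  by move=> kN; rewrite /e' dfwith_out //; apply: contraTneq kN => <-; rewrite ek0 ltnn.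
have ea m : (m <= N)%N -> action e' m = action e m.
  by move=> mN; apply: eq_action => k km; apply: e'k; apply: leq_trans km mN.
have cases k : (index k < N.+1)%N -> k = k0 \/ (index k < N)%N.
  rewrite ltnS leq_eqVlt => /orP[/eqP kN|kN]; last by right.
  by left; apply: index_inj; rewrite kN.
have c0 k (x : A k) (y : A k0) : (index k < N)%N -> GRing.comm (e k x) (e0 y).
  move=> kN; move: y; apply: comm_gen => // l phi; rewrite e0v; exact: cv.
exists e'; split; first split.
- move=> k /cases[->|kN]; [by rewrite e'k0 | by rewrite e'k //; apply: (upto_morph eN)].
- move=> k l x y /cases[ek|kN] /cases[el|lN] kl.
  + by case/eqP: kl; rewrite ek el.
  + by subst k; rewrite e'k0 e'k //; apply/commr_sym/c0.
  + by subst l; rewrite e'k0 e'k //; apply: c0.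
  + by rewrite !e'k //; apply: (upto_comm eN).
move=> k l /cases[ek|kN].
  subst k; rewrite ek0 ea // e'k0.
  have -> : (fun phi => e0 (lgen l phi)) = v l by apply/funext => phi; rewrite e0v.
  exact: (hv l).2.
by rewrite e'k // ea 1?ltnW //; apply: d.
Qed.

Lemma undress_exists u : Lsys u ->
  exists e, commuting_upto e (g + n) /\ dressed e u (g + n).
Proof.
move=> us; suff : forall N, (N <= g + n)%N ->
    exists e, commuting_upto e N /\ dressed e u N by apply.
(* No site lies below 0, so any family starts the induction. *)
elim=> [_|N ih NN]; first by exists (fun k _ => 0).
have [e [eN d]] := ih (ltnW NN); exact: undress eN NN us d.
Qed.

End OneTarget.
End Alpha.

(** * The isomorphism alpha and its inverse *)

Section Main.
Variables (F : fieldType) (H : ribbonHopf F).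
Local Notation dual := 'Hom(hopf_sort H, F^o).
Hypothesis factH : factorizable H.
Variables g n : nat.

Local Notation K := ('I_g + 'I_n)%type.
Local Notation A k := (Lgn H (@fgenus g n k) (@fpunct g n k)).
Local Notation T := (Ltens H g n).

Definition ins (k : K) : A k -> T :=
  @tens_in F _ _ (fun k => @Lrel F H (fgenus k) (fpunct k)) k.

Arguments ins : clear implicits.

Lemma ins_upto N : commuting_upto ins N.
Proof.
split=> [k _|k l x y _ _ kl]; first exact: tens_in_morph.
exact: tens_in_comm.
Qed.

Lemma big_ord_prefix (R : Type) (x : R) (op : Monoid.law x) p (G : 'I_p -> R) (i : 'I_p) :
  \big[op/x]_(k < p | (k < i.+1)%N) G k
  = op (\big[op/x]_(k < p | (k < i)%N) G k) (G i).
Proof.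
pose G' m := if insub m is Some k then G k else x.
have GE m : (m <= p)%N -> \big[op/x]_(k < p | (k < m)%N) G k = \big[op/x]_(k < m) G' k.
  move=> mp; rewrite (big_ord_widen p G' mp); apply: eq_bigr => k _.
  by rewrite /G' valK.
by rewrite !GE ?(ltnW (ltn_ord i)) // big_ord_recr /= /G' valK.
Qed.

Lemma uC_Lam (i : 'I_g) I : uC n i I = Lam (ins (inl i) \o moment10 (H := H)) I.
Proof.
rewrite /uC (Cminus_Lam factH) -[LHS]/(mmap_amat (ins (inl i)) _).
exact: mmap_Lam (tens_in_morph _ _) _.
Qed.

Lemma uMminus_Lam (j : 'I_n) I :
  uMminus g j I = Lam (ins (inr j) \o @Psi01_inv F H) I.
Proof.
rewrite /uMminus (Mminus_Lam factH) -[LHS]/(mmap_amat (ins (inr j)) _).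
exact: mmap_Lam (tens_in_morph _ _) _.
Qed.

Lemma Lam_cunit (L : pzAlgType F) (I : hmod H) : Lam (cunit L) I = 1.
Proof.
have cm := cunit_morph H L; have [_ e] := Lam_inv I cm.
have LV : LamV (cunit L) I = 1.
  rewrite /LamV -[RHS](Rel_cunitl (scal_morph L I)); apply: eq_Ap => // h.
  by rewrite /lsc /cunit (linZ (mlift_morph L _).1) (mlift_morph L _).2.1.
by rewrite LV mul1r in e.
Qed.

Lemma Lambda_Lam m (I : hmod H) : (m <= g)%N -> Lambda g n m I = Lam (action ins m) I.
Proof.
elim: m => [_|m ih mg].
  by rewrite /Lambda big_pred0 // Lam_cunit.
have st : Lam (action ins m.+1) I
    = Lam (action ins m) I * Lam (ins (inl (Ordinal mg)) \o moment10 (H := H)) I.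
  pose k : K := inl (Ordinal mg).
  exact: (Lam_action_step factH I (ins_upto _) (index_lt k)).1.
rewrite st -uC_Lam -(ih (ltnW mg)).
exact: (@big_ord_prefix (amat T (mdim I)) 1 *%R _ _ (Ordinal mg)).
Qed.

Lemma Gamma_Lam m (I : hmod H) : (m <= n)%N -> Gamma g n m I = Lam (action ins (g + m)) I.
Proof.
elim: m => [_|m ih mn].
  by rewrite /Gamma big_pred0 // mulmx1 addn0 Lambda_Lam.
rewrite addnS.
have st : Lam (action ins (g + m).+1) I = Lam (action ins (g + m)) I
    * Lam (ins (inr (Ordinal mn)) \o @Psi01_inv F H) I.
  pose k : K := inr (Ordinal mn).
  exact: (Lam_action_step factH I (ins_upto _) (index_lt k)).1.
rewrite st -uMminus_Lam -(ih (ltnW mn)) /Gamma -[RHS]mulmxA.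
congr (_ *m _).
exact: (@big_ord_prefix (amat T (mdim I)) 1 *%R _ _ (Ordinal mn)).
Qed.

(** Identifies Lambda_i and Gamma_i with the conjugating matrices of [dressed] for the canonical
    embeddings, so that the prescribed values of alpha say exactly that it dresses [ins]. *)
Lemma is_alphaE (f : Lgn H g n -> T) : is_alpha f <->
  alg_morphism f /\ dressed ins (fun l => f \o lgen l) (g + n).
Proof.
have inv m I : (m <= g + n)%N ->
    ncinvmx (Lam (action ins m) I : amat T (mdim I)) = LamV (action ins m) I.
  by move=> mN; exact: ncinv_Lminus (action_morph factH (ins_upto (g + n)) mN).
have eL (i : 'I_g) I (M : amat T (mdim I)) :
    Lambda g n i I *m M *m ncinvmx (Lambda g n i I)
    = Lam (action ins i) I * M * LamV (action ins i) I.
  rewrite Lambda_Lam ?inv ?(ltnW (ltn_ord i)) //.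
  exact: leq_trans (ltnW (ltn_ord i)) (leq_addr _ _).
have eG (j : 'I_n) I (M : amat T (mdim I)) :
    Gamma g n j I *m M *m ncinvmx (Gamma g n j I)
    = Lam (action ins (g + j)) I * M * LamV (action ins (g + j)) I.
  by rewrite Gamma_Lam ?inv ?(ltnW (ltn_ord j)) // leq_add2l ltnW.
have eU k (l : letter (@fgenus g n k) (@fpunct g n k)) I :
    map_mx (ins k) (Lmx l I) = genmx (fun phi => ins k (lgen l phi)) I.
  by rewrite -map_mx_comp.
have cg (B : pzRingType) (x y m m' : B) : m = m' -> x * m * y = x * m' * y.
  by move->.
have ef l I : map_mx f (Lmx l I) = genmx (f \o lgen l) I by rewrite -map_mx_comp.
split=> [[fm fA fB fM]|[fm d]].
  split=> // -[i|j] l _ I.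
    case: (letter10 l) => ->.
      transitivity (map_mx f (Lmx (lA n i) I)); first exact/esym/ef.
      rewrite fA; etransitivity; first exact: eL.
      exact/cg/eU.
    transitivity (map_mx f (Lmx (lB n i) I)); first exact/esym/ef.
    rewrite fB; etransitivity; first exact: eL.
    exact/cg/eU.
  rewrite (letter01 l); transitivity (map_mx f (Lmx (lM g j) I)); first exact/esym/ef.
  rewrite fM; etransitivity; first exact: eG.
  exact/cg/eU.
split=> // [I i|I i|I j].
- transitivity (genmx (f \o lgen (lA n i)) I); first exact: ef.
  etransitivity; first exact: (d (inl i) (lA 0 ord0) (index_lt _) I).
  symmetry; etransitivity; first exact: eL.
  exact/cg/(eU (inl i)).
- transitivity (genmx (f \o lgen (lB n i)) I); first exact: ef.
  etransitivity; first exact: (d (inl i) (lB 0 ord0) (index_lt _) I).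
  symmetry; etransitivity; first exact: eL.
  exact/cg/(eU (inl i)).
- transitivity (genmx (f \o lgen (lM g j)) I); first exact: ef.
  etransitivity; first exact: (d (inr j) (lM 0 ord0) (index_lt _) I).
  symmetry; etransitivity; first exact: eG.
  exact/cg/(eU (inr j)).
Qed.

Lemma dressed_map (L L' : pzAlgType F) (f : L -> L') (e : forall k : K, A k -> L) u N :
  alg_morphism f -> commuting_upto e N -> dressed e u N ->
  dressed (fun k => f \o e k) (fun l => f \o u l) N.
Proof.
move=> fm eN d k l kN I.
have ea m : action (fun k => f \o e k) m = f \o action e m.
  elim: m => [|m ih] /=; apply/funext => h /=.
    by rewrite /cunit (linZ fm.1) fm.2.1.
  by rewrite ih; case: (site_at g n m) => [k'|] //; rewrite /conv alg_Ap.
have := congr1 (mmap_amat f) (d k l kN I).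
by rewrite !(mmap_amat_morph fm _).2.2 ea -mmap_Lam // -mmap_LamV // !mmap_genmx.
Qed.

Lemma upto_map (L L' : pzAlgType F) (f : L -> L') (e : forall k : K, A k -> L) N :
  alg_morphism f -> commuting_upto e N -> commuting_upto (fun k => f \o e k) N.
Proof.
move=> fm [em ec]; split=> [k kN|k l x y kN lN kl].
  by apply: alg_comp fm; apply: em.
by rewrite /GRing.comm /= -!fm.2.2 ec.
Qed.

Lemma alpha_isomorphism : exists alpha : Lgn H g n -> T,
  [/\ is_alpha alpha, forall beta, is_alpha beta -> beta = alpha & bijective alpha].
Proof.
have iU := ins_upto (g + n).
have [u [ul du]] := dress_exists factH iU.
have [alpha [am av]] := Lgn_hom (dressed_sys factH iU ul du).
have au : (fun l => alpha \o lgen l) = u.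
  by apply/funext => l; apply/funext => phi; rewrite /= av.
have [e [eU de]] := undress_exists factH (lgen_sys H g n).
have [beta [bm bv]] : exists b : T -> Lgn H g n,
    alg_morphism b /\ forall k x, b (ins k x) = e k x.
  apply: bigtens_hom => [k|k l kl x y]; first by apply: (upto_morph eU); exact: index_lt.
  by apply: (upto_comm eU) => //; exact: index_lt.
have be : (fun k => beta \o ins k) = e.
  by apply/functional_extensionality_dep => k; apply/funext => x; apply: bv.
have alphaE f : is_alpha f -> f = alpha.
  move=> /is_alphaE[fm d]; apply/funext; apply: eq_Lgn => // l phi; rewrite av.
  have [k [l' ->]] := globalP l; move: phi; apply: genmx_inj.
  - exact: (linear_comp (sys_linear (lgen_sys H g n) _) fm.1).
  - exact: ul.
  move=> I; rewrite -[LHS]/(genmx (f \o lgen (global l')) I).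
  by rewrite (d k l' (index_lt k)) (du k l' (index_lt k)).
exists alpha; split=> //; first by apply/is_alphaE; rewrite au.
exists beta.
  move=> x; apply: (eq_Lgn (f := beta \o alpha) (h := id)) => [||l phi] //.
    exact: alg_comp.
  have [k [l' ->]] := globalP l; rewrite /= av; move: phi; apply: genmx_inj.
  - exact: (linear_comp (ul _) bm.1).
  - exact: sys_linear (lgen_sys H g n) _.
  (* Applying [beta] to the dressing of [ins] gives the dressing of [e], which is the family of
     generators itself. *)
  have := dressed_map bm iU du; rewrite be => d I.
  rewrite -[LHS]/(genmx (beta \o u (global l')) I).
  by rewrite (d k l' (index_lt k)) (de k l' (index_lt k)).
move=> x; apply: (eq_bigtens (f := alpha \o beta) (h := id)) => [||k y] //.
  exact: alg_comp.
rewrite -[LHS]/((alpha \o beta) (ins k y)) /= bv.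
(* Both [alpha] after [e] and [ins] undress the same system [u], so they coincide. *)
have := dressed_map am eU de; rewrite au => d.
have eq := dressed_uniq factH (upto_map am eU) iU d du k.
exact: (congr1 (fun h => h y) eq).
Qed.

End Main.

Theorem proposition3p5 (R : realType) (H : ribbonHopf R[i])
    (factH : factorizable H) (g n : nat) :
  exists alpha : Lgn H g n -> Ltens H g n,
    [/\ is_alpha alpha,
        forall beta, is_alpha beta -> beta = alpha
      & bijective alpha].
Proof. exact: alpha_isomorphism. Qed.
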